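(* Let $(M,g)$ be a compact Riemannian manifold of dimension $n\ge 2$ with constant sectional curvature $\kappa$. Then: (1) If $\kappa\neq 0$, then $(M,g)$ admits no conformal product structure. (2) If $\kappa=0$ and $n\ge 3$, then every conformal product structure on $(M,g)$ has zero Lee form with respect to $g$; equivalently, its Weyl connection is the Levi-Civita connection $\nabla^g$ of $g$.
   Context: All manifolds, metrics and distributions are smooth. A Weyl connection on a Riemannian manifold $(M,g)$ is a torsion-free linear connection $D$ on $TM$ satisfying $Dg=-2\theta\otimes g$ for some 1-form $\theta\in\Omega^1(M)$, called the Lee form of $D$ with respect to $g$. The Lee form determines $D$ through $$D_X\xi=\nabla^g_X\xi+\theta(\xi)X+\theta(X)\xi-g(X,\xi)\theta^\sharp,$$ where $\nabla^g$ is the Levi-Civita connection of $g$ and $\theta^\sharp$ is the vector field $g$-dual to $\theta$. A conformal product structure on $(M,g)$ consists of a Weyl connection $D$ on $(M,g)$ together with a decomposition $TM=T_1\oplus T_2$, where $T_1$ and $T_2$ are $g$-orthogonal, $D$-parallel, non-trivial distributions (subbundles of $TM$ of positive rank; $D$-parallel means that $D_XY\in\Gamma(T_i)$ for every vector field $X$ and every $Y\in\Gamma(T_i)$). *)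

(* Defs.v *)
From HB Require Import structures.
From mathcomp Require Import all_boot all_order all_algebra.
From mathcomp Require Import all_classical all_reals all_analysis.
Import Order.TTheory GRing.Theory Num.Theory.
Import numFieldNormedType.Exports.

Set Implicit Arguments.
Unset Strict Implicit.
Unset Printing Implicit Defensive.

Local Open Scope classical_set_scope.
Local Open Scope ring_scope.

Section SmoothManifold.
Context {R : realType} {n : nat}.

Fixpoint iter_partial (s : seq 'I_n) (f : 'rV[R]_n -> R) : 'rV[R]_n -> R :=
  if s is i :: s' then fun x => 'D_(delta_mx 0 i) (iter_partial s' f) x else f.

(* f is C^oo on the open set U: all iterated partial derivatives exist and are
   continuous at every point of U. *)
Definition smooth_on (U : set 'rV[R]_n) (f : 'rV[R]_n -> R) : Prop :=
  forall (s : seq 'I_n) (x : 'rV[R]_n), U x ->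
    {for x, continuous (iter_partial s f)} /\
    forall i : 'I_n, derivable (iter_partial s f) x (delta_mx 0 i).

(* A homeomorphism of an open set of M onto an open set of R^n; the values of
   chart_map and chart_inv outside these two sets are irrelevant. *)
Record chart (M : topologicalType) := Chart {
  chart_dom : set M;
  chart_map : M -> 'rV[R]_n;
  chart_inv : 'rV[R]_n -> M;
  chart_dom_open : open chart_dom;
  chart_img_open : open (chart_map @` chart_dom);
  chart_mapK : forall p, chart_dom p -> chart_inv (chart_map p) = p;
  chart_map_cont : forall p, chart_dom p -> {for p, continuous chart_map};
  chart_inv_cont : forall x, (chart_map @` chart_dom) x ->
    {for x, continuous chart_inv}
}.

Definition smoothly_compatible (M : topologicalType) (c c' : chart M) : Prop :=
  forall j : 'I_n,
    smooth_on (chart_map c @` (chart_dom c `&` chart_dom c'))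
              (fun x => chart_map c' (chart_inv c x) 0 j).

End SmoothManifold.

(* Smooth n-dimensional manifolds without boundary, not assumed connected. The
   atlas need not be maximal. *)
Record smoothManifold (R : realType) (n : nat) := SmoothManifold {
  carrier :> topologicalType;
  atlas : set (@chart R n carrier);
  manifold_hausdorff : hausdorff_space carrier;
  manifold_second_countable : @second_countable carrier;
  atlas_cover : forall p : carrier, exists2 c, atlas c & chart_dom c p;
  atlas_compatible : forall c c', atlas c -> atlas c' -> smoothly_compatible c c'
}.

Section TangentSpace.
Context {R : realType} {n : nat} (M : smoothManifold R n).

Definition smooth_fun (f : M -> R) : Prop :=
  forall c, atlas c ->
    smooth_on (chart_map c @` chart_dom c) (f \o chart_inv c).

(* Ambient vector space (pointwise operations) containing all tangent spaces. *)
Local Notation tvec := ((M -> R) -> R^o).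

(* T_p M is the space of derivations at p of the algebra of smooth functions.
   A tangent vector is extended by 0 to non-smooth functions, so that it is
   determined by its action on smooth functions. *)
Definition tangent (p : M) : set tvec :=
  [set v | [/\ forall f, ~ smooth_fun f -> v f = 0,
    forall (a : R) f h, smooth_fun f -> smooth_fun h ->
      v (fun x => a * f x + h x) = a * v f + v h &
    forall f h, smooth_fun f -> smooth_fun h ->
      v (fun x => f x * h x) = f p * v h + v f * h p]].

Definition lie_derivative (X : M -> tvec) (f : M -> R) : M -> R :=
  fun p => X p f.

Definition vector_field (X : M -> tvec) : Prop :=
  (forall p, tangent p (X p)) /\
  (forall f, smooth_fun f -> smooth_fun (lie_derivative X f)).

Definition scale_field (f : M -> R) (X : M -> tvec) : M -> tvec :=
  fun p => f p *: X p.

Definition lie_bracket (X Y : M -> tvec) : M -> tvec :=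
  fun p f => X p (lie_derivative Y f) - Y p (lie_derivative X f).

Definition one_form (theta : M -> tvec -> R) : Prop :=
  (forall p (a : R) u v, tangent p u -> tangent p v ->
     theta p (a *: u + v) = a * theta p u + theta p v) /\
  (forall X, vector_field X -> smooth_fun (fun p => theta p (X p))).

Record riemannianMetric := RiemannianMetric {
  metric :> M -> tvec -> tvec -> R;
  metric_linear : forall p (a : R) u v w,
    tangent p u -> tangent p v -> tangent p w ->
    metric p (a *: u + v) w = a * metric p u w + metric p v w;
  metric_sym : forall p u v, tangent p u -> tangent p v ->
    metric p u v = metric p v u;
  metric_pos : forall p u, tangent p u -> u <> 0 -> 0 < metric p u u;
  metric_smooth : forall X Y, vector_field X -> vector_field Y ->
    smooth_fun (fun p => metric p (X p) (Y p))
}.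

(* D X Y stands for D_X Y; linearity over R in Y follows from additivity and
   the Leibniz rule. *)
Definition linear_connection (D : (M -> tvec) -> (M -> tvec) -> (M -> tvec)) :
    Prop :=
  [/\ forall X Y, vector_field X -> vector_field Y -> vector_field (D X Y),
    forall f X X' Y, smooth_fun f ->
      vector_field X -> vector_field X' -> vector_field Y ->
      D (scale_field f X + X') Y = scale_field f (D X Y) + D X' Y,
    forall X Y Y', vector_field X -> vector_field Y -> vector_field Y' ->
      D X (Y + Y') = D X Y + D X Y' &
    forall f X Y, smooth_fun f -> vector_field X -> vector_field Y ->
      D X (scale_field f Y) =
        scale_field (lie_derivative X f) Y + scale_field f (D X Y)].

Definition torsion_free (D : (M -> tvec) -> (M -> tvec) -> (M -> tvec)) : Prop :=
  forall X Y, vector_field X -> vector_field Y ->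
    D X Y - D Y X = lie_bracket X Y.

(* (D_X g)(Y, Z) *)
Definition cov_metric (g : riemannianMetric)
    (D : (M -> tvec) -> (M -> tvec) -> (M -> tvec)) (X Y Z : M -> tvec) : M -> R :=
  fun p => lie_derivative X (fun q => g q (Y q) (Z q)) p
           - g p (D X Y p) (Z p) - g p (Y p) (D X Z p).

Definition levi_civita (g : riemannianMetric)
    (D : (M -> tvec) -> (M -> tvec) -> (M -> tvec)) : Prop :=
  [/\ linear_connection D, torsion_free D &
    forall X Y Z, vector_field X -> vector_field Y -> vector_field Z ->
      forall p, cov_metric g D X Y Z p = 0].

Definition curvature (D : (M -> tvec) -> (M -> tvec) -> (M -> tvec))
    (X Y Z : M -> tvec) : M -> tvec :=
  D X (D Y Z) - D Y (D X Z) - D (lie_bracket X Y) Z.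

(* Every plane in T_p M is spanned by the values at p of two vector fields. *)
Definition constant_sectional_curvature (g : riemannianMetric) (kappa : R) :
    Prop :=
  exists2 D, levi_civita g D &
    forall X Y p, vector_field X -> vector_field Y ->
      (forall a b : R, a *: X p + b *: Y p = 0 -> a = 0 /\ b = 0) ->
      g p (curvature D X Y Y p) (X p) /
        (g p (X p) (X p) * g p (Y p) (Y p) - g p (X p) (Y p) ^+ 2) = kappa.

(* theta is a 1-form with D g = - 2 theta (x) g. *)
Definition lee_form (g : riemannianMetric)
    (D : (M -> tvec) -> (M -> tvec) -> (M -> tvec)) (theta : M -> tvec -> R) :
    Prop :=
  one_form theta /\
  forall X Y Z, vector_field X -> vector_field Y -> vector_field Z ->
    forall p, cov_metric g D X Y Z p = - 2 * theta p (X p) * g p (Y p) (Z p).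

Definition weyl_connection (g : riemannianMetric)
    (D : (M -> tvec) -> (M -> tvec) -> (M -> tvec)) : Prop :=
  [/\ linear_connection D, torsion_free D & exists theta, lee_form g D theta].

(* Smooth rank r subbundle of TM. Local frames can be taken to be restrictions
   of global vector fields, by means of cutoff functions. *)
Definition smooth_distribution (r : nat) (T : M -> set tvec) : Prop :=
  forall p : M, exists X : 'I_r -> M -> tvec,
    (forall i, vector_field (X i)) /\
    \forall q \near p,
      (forall a : 'I_r -> R, \sum_i a i *: X i q = 0 -> forall i, a i = 0) /\
      T q = [set v | exists a : 'I_r -> R, v = \sum_i a i *: X i q].

Definition section_of (T : M -> set tvec) (Y : M -> tvec) : Prop :=
  vector_field Y /\ forall p, T p (Y p).

Definition parallel (D : (M -> tvec) -> (M -> tvec) -> (M -> tvec))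
    (T : M -> set tvec) : Prop :=
  forall X Y, vector_field X -> section_of T Y -> section_of T (D X Y).

Definition orthogonal_distributions (g : riemannianMetric)
    (T1 T2 : M -> set tvec) : Prop :=
  forall p u v, T1 p u -> T2 p v -> g p u v = 0.

(* TM = T1 (+) T2 *)
Definition tangent_decomposition (T1 T2 : M -> set tvec) : Prop :=
  forall p,
    (forall v, tangent p v ->
       exists v1 v2, [/\ T1 p v1, T2 p v2 & v = v1 + v2]) /\
    T1 p `&` T2 p = [set 0].

Definition conformal_product_structure (g : riemannianMetric)
    (D : (M -> tvec) -> (M -> tvec) -> (M -> tvec)) (T1 T2 : M -> set tvec) :
    Prop :=
  [/\ weyl_connection g D,
    exists2 r1, (0 < r1)%N & smooth_distribution r1 T1,
    exists2 r2, (0 < r2)%N & smooth_distribution r2 T2,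
    tangent_decomposition T1 T2 &
    [/\ orthogonal_distributions g T1 T2, parallel D T1 & parallel D T2]].

End TangentSpace.

(* Main.v *)
Require Import Defs.
From mathcomp Require Import all_boot all_order all_algebra.
From mathcomp Require Import all_classical all_reals all_analysis.
From mathcomp Require Import fingroup perm ring lra zify.
Import Order.TTheory GRing.Theory Num.Theory.
Import numFieldNormedType.Exports.

Set Implicit Arguments.
Unset Strict Implicit.
Unset Printing Implicit Defensive.

Local Open Scope classical_set_scope.
Local Open Scope ring_scope.

(** Let H1, H2 be the sections of T1, T2 dual to the restrictions of the Lee form
    theta. Comparing D with the Levi-Civita connection gives
      g(nabla_X x, y) = theta(y) g(X, x) - theta(x) g(X, y)   (x in T1, y in T2),
    so for unit x, y constancy of the curvature of the mixed planes reads
      g(nabla_x H1, x) - theta(x)^2 + g(nabla_y H2, y) - theta(y)^2 = kappa.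
    If kappa < 0 or n = 2, its trace over an orthonormal frame,
      div(r2 H1 + r1 H2) = kappa r1 r2 - r2 (r2 - 1) |H1|^2 - r1 (r1 - 1) |H2|^2,
    has a constant sign, against the divergence theorem. If kappa >= 0 and, say,
    r2 >= 2, the vanishing of R(v, w, x, v) for v, w in T2 makes |H1| constant along
    T2; at a maximum of |H1|^2 + e |H2|^2 the formula for mixed planes then forces
    H1 = 0, and at a maximum of |H2|^2 it gives H2 = 0, hence kappa = 0.

    The divergence theorem is obtained without integrals over R^n: these are only
    compared, through functions whose Riemann sums over (1/N)Z^n tend to 0. The sums
    of a partial derivative do so because a lattice translation is harmless; the
    change of variables follows by deforming the map to its linear part, the
    derivative of F(phi_t) det(D phi_t) in t being a divergence by Piola's identity. *)

(** The trace of the mixed curvatures has a strict sign only if [kappa] is negative, or positive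
    with both ranks equal to 1. For [kappa] >= 0 and [n] >= 3 its quadratic terms compete with
    [kappa], or one of them disappears because a rank is 1, so integration cannot give H1 = H2 = 0
    and a pointwise argument takes its place. There |H1|^2 alone carries no second-order information
    along T2, being constant in those directions; e |H2|^2 supplies it, and e is small so that H1
    stays away from 0 at the maximum. Tangent vectors are derivations of the globally smooth
    functions. Every local object (coordinates, frames, densities) is therefore represented by a
    global function or field that is correct only near one point. Of integration only this is used:
    null functions form a vector space closed under uniform limits with common support, and a
    continuous nonnegative one is 0. In a change of variables the linear part is a separate step,
    since the segment from it to the identity may meet singular matrices; it is factored into
    permutations, signs and triangular matrices. *)

Local Notation bv i := (delta_mx (0 : 'I_1) i).

(** * Differential calculus on R^n *)

Lemma cvg_sum (R : realType) (T I : Type) (F : set_system T) (FF : Filter F)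
    (r : seq I) (P : pred I) (f : I -> T -> R) (l : I -> R) :
  (forall i, P i -> f i x @[x --> F] --> l i) ->
  \sum_(i <- r | P i) f i x @[x --> F] --> \sum_(i <- r | P i) l i.
Proof.
move=> H; elim: r => [|i r IH].
  by rewrite big_nil; under eq_fun do rewrite big_nil; exact: cvg_cst.
rewrite big_cons; under eq_fun do rewrite big_cons.
by case: ifP => // Pi; apply: cvgD => //; exact: H.
Qed.

Section Calculus.
Context {R : realType} {n : nat}.
Implicit Types (U V : set 'rV[R]_n) (f g h : 'rV[R]_n -> R) (x y v : 'rV[R]_n).

(** The recursion strips the innermost derivative, whereas [iter_partial] recurses on the outermost
    one. In this form sums, products, inverses and composites follow by induction on [k], their
    derivatives being built from functions already known to be of class [k]. *)
Fixpoint Ck (k : nat) U f : Prop :=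
  if k is k'.+1 then
    (forall x, U x -> {for x, continuous f}) /\
    forall i, (forall x, U x -> derivable f x (bv i)) /\ Ck k' U ('D_(bv i) f)
  else forall x, U x -> {for x, continuous f}.

Lemma iter_partial_rcons s (i : 'I_n) f :
  iter_partial (rcons s i) f = iter_partial s ('D_(bv i) f).
Proof. by elim: s => [|j s IH] //=; rewrite IH. Qed.

Lemma smooth_onP U f : smooth_on U f <-> forall k, Ck k U f.
Proof.
split=> [sf k|sf].
  elim: k f sf => [|k IH] f sf; first by move=> x /(sf [::]) [].
  split=> [x /(sf [::]) []//|i]; split=> [x /(sf [::]) []//|].
  by apply: IH => s x Ux; have := sf (rcons s i) x Ux; rewrite iter_partial_rcons.
move=> s; elim/last_ind: s f sf => [|s i IH] f sf x Ux /=.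
  by split=> [|i]; [exact: (sf 0%N x Ux)|have [_ /(_ i)[d _]] := sf 1%N; exact: d].
rewrite iter_partial_rcons; apply: IH => // k.
by have [_ /(_ i)[_ d]] := sf k.+1.
Qed.

Lemma Ck_cont k U f x : Ck k U f -> U x -> {for x, continuous f}.
Proof. by case: k => [|k] /=; [apply|case=> + _; apply]. Qed.

Lemma CkW k U f : Ck k.+1 U f -> Ck k U f.
Proof.
elim: k f => [|k IH] f [cf df] //; split=> // i.
by have [dfi /IH] := df i.
Qed.

Lemma near_open U x (P : 'rV[R]_n -> Prop) :
  open U -> U x -> (forall y, U y -> P y) -> \forall y \near x, P y.
Proof. by move=> oU Ux UP; have : nbhs x U by [exact: open_nbhs_nbhs]; apply: filterS. Qed.

Lemma eq_cont_at (T : topologicalType) (f g : T -> R) (x : T) :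
  (\forall y \near x, f y = g y) -> {for x, continuous f} -> {for x, continuous g}.
Proof.
move=> e cf; rewrite /prop_for /continuous_at -(nbhs_singleton e).
by apply: cvg_trans cf; exact: near_eq_cvg.
Qed.

Lemma Ck_ext k U f g : open U -> (forall x, U x -> f x = g x) -> Ck k U f -> Ck k U g.
Proof.
move=> oU; elim: k f g => [|k IH] f g e.
  by move=> cf x Ux; apply: eq_cont_at (cf x Ux); exact: near_open e.
move=> [cf df]; split=> [x Ux|i].
  by apply: eq_cont_at (cf x Ux); exact: near_open e.
have [dfi sf] := df i; split=> [x Ux|].
  by apply: near_eq_derivable (dfi x Ux); exact: near_open e.
by apply: IH sf => x Ux; apply: near_eq_derive; exact: near_open e.
Qed.

Lemma Ck_cst k U c : Ck k U (fun=> c).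
Proof.
elim: k c => [|k IH] c; first by move=> x _; exact: cst_continuous.
split=> [x _|i]; first exact: cst_continuous.
split=> [x _|]; first exact: derivable_cst.
by have -> : 'D_(bv i) (fun=> c) = (fun=> 0) by apply/funext => x; exact: derive_cst.
Qed.

Lemma CkD k U f g : open U -> Ck k U f -> Ck k U g -> Ck k U (fun x => f x + g x).
Proof.
move=> oU; elim: k f g => [|k IH] f g.
  by move=> cf cg x Ux; have := cvgD (cf x Ux) (cg x Ux); apply.
move=> [cf df] [cg dg]; split=> [x Ux|i].
  by have := cvgD (cf x Ux) (cg x Ux); apply.
have [dfi sf] := df i; have [dgi sg] := dg i.
split=> [x Ux|]; first exact: derivableD (dfi _ Ux) (dgi _ Ux).
apply: (Ck_ext oU) (IH _ _ sf sg) => x Ux.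
by rewrite (_ : (fun x => f x + g x) = f + g) // deriveD; [|exact: dfi|exact: dgi].
Qed.

Lemma CkM k U f g : open U -> Ck k U f -> Ck k U g -> Ck k U (fun x => f x * g x).
Proof.
move=> oU; elim: k f g => [|k IH] f g.
  by move=> cf cg x Ux; have := cvgM (cf x Ux) (cg x Ux); apply.
move=> Cf Cg; have := Cf; have := Cg; move=> [cg dg] [cf df]; split=> [x Ux|i].
  by have := cvgM (cf x Ux) (cg x Ux); apply.
have [dfi sf] := df i; have [dgi sg] := dg i.
split=> [x Ux|]; first exact: derivableM (dfi _ Ux) (dgi _ Ux).
have := CkD oU (IH _ _ (CkW Cf) sg) (IH _ _ (CkW Cg) sf).
apply: (Ck_ext oU) => x Ux.
by rewrite (_ : (fun x => f x * g x) = f * g) // deriveM; [|exact: dfi|exact: dgi].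
Qed.

Lemma is_derive_coord (j : 'I_n) x v : is_derive x v (fun y => y 0 j) (v 0 j).
Proof.
have dj : derivable (fun y => y 0 j) x v.
  by have /derivable_mxP := @derivable_id R _ x v; apply.
apply: DeriveDef => //.
have := derive_id x v; rewrite derive_mx; last exact: derivable_id.
by move/matrixP => /(_ 0 j); rewrite mxE.
Qed.

Lemma Ck_coord k U (j : 'I_n) : Ck k U (fun x => x 0 j).
Proof.
case: k => [|k]; first by move=> x _; exact: coord_continuous.
split=> [x _|i]; first exact: coord_continuous.
split=> [x _|]; first by have := is_derive_coord j x (bv i); case.
have -> : 'D_(bv i) (fun x => x 0 j) = (fun=> bv i 0 j).
  by apply/funext => x; have := is_derive_coord j x (bv i); case.
exact: Ck_cst.
Qed.

Lemma CkV k U f : open U -> (forall x, U x -> f x != 0) ->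
  Ck k U f -> Ck k U (fun x => (f x)^-1).
Proof.
move=> oU f0; elim: k => [|k IH].
  by move=> cf x Ux; have := cvgV (f0 x Ux) (cf x Ux); apply.
move=> Cf; have := Cf; move=> [cf df]; split=> [x Ux|i].
  by have := cvgV (f0 x Ux) (cf x Ux); apply.
have [dfi sf] := df i.
split=> [x Ux|]; first exact: derivableV (f0 _ Ux) (dfi _ Ux).
have CV := IH (CkW Cf).
have := CkM oU (CkM oU CV CV) (CkM oU (Ck_cst k U (-1)) sf).
apply: (Ck_ext oU) => x Ux.
rewrite deriveV; [|exact: f0|exact: dfi].
by rewrite /GRing.scale/= expr2 invfM; ring.
Qed.

Lemma is_derive_line (V W : normedModType R) (f : V -> W) (x v : V) (s : R) :
  derivable f (x + s *: v) v ->
  is_derive s 1 (fun t : R => f (x + t *: v)) ('D_v f (x + s *: v)).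
Proof.
have e : (fun h : R => h^-1 *: (((fun t : R => f (x + t *: v)) \o shift s) (h *: 1) - f (x + s *: v)))
  = (fun h : R => h^-1 *: ((f \o shift (x + s *: v)) (h *: v) - f (x + s *: v))).
  apply/funext => h /=; congr (_ *: (f _ - _)).
  by rewrite [h *: 1]mulr1 scalerDl addrCA addrC.
by move=> df; apply: DeriveDef; rewrite /derivable /derive e.
Qed.

(** Both signs of [t] are allowed because difference quotients are taken from either side. *)
Lemma MVT_line (V : normedModType R) (f : V -> R) (x v : V) (t : R) :
  (forall s, `|s| <= `|t| -> derivable f (x + s *: v) v) ->
  exists2 s, `|s| <= `|t| & f (x + t *: v) - f x = t * 'D_v f (x + s *: v).
Proof.
move=> df.
have dl (s : R) : `|s| <= `|t| -> is_derive s 1 (fun t : R => f (x + t *: v)) ('D_v f (x + s *: v)).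
  by move=> /df; exact: is_derive_line.
have cl (s : R) : `|s| <= `|t| -> {for s, continuous (fun t : R => f (x + t *: v))}.
  by move=> /dl [d _]; apply: differentiable_continuous; exact/derivable1_diffP.
have [t0|t0] := leP 0 t.
  have [||s + e] := @MVT_segment _ (fun t : R => f (x + t *: v)) (fun s => 'D_v f (x + s *: v)) 0 t t0.
  - by move=> s; rewrite in_itv/= => /andP[s0 st]; apply: dl; rewrite !ger0_norm // ltW.
  - apply: continuous_in_subspaceT => s /set_mem; rewrite /= in_itv/= => /andP[s0 st].
    by apply: cl; rewrite !ger0_norm.
  rewrite in_itv/= => /andP[s0 st]; exists s; first by rewrite !ger0_norm.
  by move: e; rewrite /= scale0r addr0 subr0 mulrC.
have [||s + e] := @MVT_segment _ (fun t : R => f (x + t *: v)) (fun s => 'D_v f (x + s *: v)) t 0 (ltW t0).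
- by move=> s; rewrite in_itv/= => /andP[s0 st]; apply: dl; rewrite !ler0_norm ?lerN2 // ltW.
- apply: continuous_in_subspaceT => s /set_mem; rewrite /= in_itv/= => /andP[s0 st].
  by apply: cl; rewrite !ler0_norm ?lerN2 // ltW.
rewrite in_itv/= => /andP[s0 st]; exists s; first by rewrite !ler0_norm ?lerN2 // ltW.
move: e; rewrite /= scale0r addr0 sub0r => e.
by rewrite -opprB e mulrN opprK mulrC.
Qed.

Lemma rV_norm_le (x : 'rV[R]_n) r : 0 <= r -> (forall i, `|x 0 i| <= r) -> `|x| <= r.
Proof.
move=> r0 xr; rewrite /Num.norm/= mx_normrE; apply/bigmax_leP; split => //.
by case=> i j _ /=; rewrite ord1.
Qed.

Lemma coord_le_norm (x : 'rV[R]_n) i : `|x 0 i| <= `|x|.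
Proof. by rewrite [leRHS]/Num.norm/= mx_normrE; apply: (le_bigmax _ _ (0, i)). Qed.

Lemma rV_norm_lt (x : 'rV[R]_n) r : 0 < r -> (forall i, `|x 0 i| < r) -> `|x| < r.
Proof.
move=> r0 xr; rewrite /Num.norm/= mx_normrE; apply/bigmax_ltP; split => //.
by case=> i j _ /=; rewrite ord1.
Qed.

(** The segment from [a] to [z] is replaced by a path along the coordinate axes. Its points stay in
    the ball of radius |z - a| because the norm is the sup norm. *)
Lemma MVT_coord f (a z : 'rV[R]_n) :
  (forall x i, `|x - a| <= `|z - a| -> derivable f x (bv i)) ->
  exists xi : 'I_n -> 'rV[R]_n, (forall i, `|xi i - a| <= `|z - a|) /\
    f z - f a = \sum_i 'D_(bv i) f (xi i) * (z 0 i - a 0 i).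
Proof.
move=> df.
pose w (k : nat) : 'rV[R]_n := \row_j (if (j < k)%N then z 0 j else a 0 j).
have w0 : w 0%N = a by apply/rowP => j; rewrite mxE.
have wn : w n = z by apply/rowP => j; rewrite mxE ltn_ord.
have wS (k : 'I_n) : w k.+1 = w k + (z 0 k - a 0 k) *: bv k.
  apply/rowP => j; rewrite !mxE eqxx /= ltnS leq_eqVlt -val_eqE/= .
  have [jk|jk|jk] := ltngtP j k => /=; rewrite ?mulr0 ?addr0 // mulr1.
  by rewrite (val_inj jk) addrC subrK.
have za j : `|z 0 j - a 0 j| <= `|z - a|.
  by have := coord_le_norm (z - a) j; rewrite !mxE.
have H (k : 'I_n) : exists x, `|x - a| <= `|z - a| /\
   f (w k.+1) - f (w k) = 'D_(bv k) f x * (z 0 k - a 0 k).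
  have wb s : `|s| <= `|z 0 k - a 0 k| -> `|w k + s *: bv k - a| <= `|z - a|.
    move=> hs; apply: rV_norm_le => // j; rewrite !mxE eqxx /= -val_eqE /=.
    have [jk|jk|jk] := ltngtP j k => /=; rewrite ?mulr0 ?addr0 ?subrr ?normr0 //.
    by rewrite mulr1 (addrC (a 0 j)) addrK (le_trans hs) // za.
  have [s /wb hs e] := @MVT_line _ f (w k) (bv k) (z 0 k - a 0 k)
    (fun s hs => df _ _ (wb s hs)).
  by exists (w k + s *: bv k); rewrite wS e mulrC.
have [xi Hxi] := choice H.
exists xi; split=> [i|]; first by have [] := Hxi i.
under eq_bigr => i _ do rewrite -(proj2 (Hxi i)).
rewrite -{1}wn -w0 -(big_mkord xpredT (fun k => f (w k.+1) - f (w k))).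
by rewrite telescope_sumr.
Qed.

(** Only partial derivatives near [phi x], continuous at [phi x], are assumed. [MVT_coord] turns the
    increment of [f] into these partials at points squeezed towards [phi x], so no total
    differential is involved. *)
Lemma is_derive_comp_rV (V : normedModType R) (phi : V -> 'rV[R]_n) f (x v : V)
    (dphi : 'rV[R]_n) :
  is_derive x v phi dphi ->
  (\forall y \near phi x, forall i, derivable f y (bv i)) ->
  (forall i, {for phi x, continuous ('D_(bv i) f)}) ->
  is_derive x v (f \o phi) (\sum_i 'D_(bv i) f (phi x) * dphi 0 i).
Proof.
move=> [dx <-] df cf; set a := phi x.
pose z (h : R) := phi (h *: v + x).
have zc : z h @[h --> 0^'] --> a.
  have : {for 0, continuous z}.
    by have /derivable1P/derivable1_diffP/differentiable_continuous := dx.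
  rewrite /prop_for /continuous_at {2}/z scale0r add0r => zc.
  by apply: cvg_trans zc; apply: cvg_app; exact: cvg_within.
have [r r0 Br] : exists2 r : R, 0 < r & forall y, `|y - a| < r -> forall i, derivable f y (bv i).
  move/nbhs_ballP : df => [r r0 Br]; exists r; [exact: r0|move=> y ya].
  by apply: Br; rewrite -ball_normE /= distrC.
have near_r : \forall h \near 0^', `|z h - a| < r by by move/cvgrPdistC_lt : (zc); apply.
have H (h : R) : exists xi : 'I_n -> 'rV[R]_n, `|z h - a| < r ->
    (forall i, `|xi i - a| <= `|z h - a|) /\
    f (z h) - f a = \sum_i 'D_(bv i) f (xi i) * (z h 0 i - a 0 i).
  have [hr|hr] := ltP `|z h - a| r; last by exists (fun=> 0).
  have [|xi Hxi] := @MVT_coord f a (z h); last by exists xi.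
  by move=> y i yz; apply: Br; apply: le_lt_trans yz hr.
have [xi Hxi] := choice H.
have xic i : xi h i @[h --> 0^'] --> a.
  apply/cvgrPdist_lt => e e0; near=> h.
  have zr : `|z h - a| < r by near: h.
  have [hh _] := Hxi h zr; rewrite distrC; apply: le_lt_trans (hh i) _.
  by near: h; move/cvgrPdistC_lt : (zc); apply.
have qc i : h^-1 * (z h 0 i - a 0 i) @[h --> 0^'] --> 'D_v phi x 0 i.
  rewrite derive_mx // mxE.
  have /derivable_mxP/(_ 0 i) := dx; rewrite /derivable; apply.
have main : h^-1 *: (f (z h) - f a) @[h --> 0^'] -->
    \sum_i 'D_(bv i) f a * 'D_v phi x 0 i.
  have : \sum_i 'D_(bv i) f (xi h i) * (h^-1 * (z h 0 i - a 0 i)) @[h --> 0^'] -->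
      \sum_i 'D_(bv i) f a * 'D_v phi x 0 i.
    apply: cvg_sum => i _; apply: cvgM (qc i).
    exact: (cvg_comp _ _ (xic i) (cf i)).
  apply: cvg_trans; apply: near_eq_cvg; near=> h.
  have [|_ ->] := Hxi h _; first by near: h.
  by rewrite scaler_sumr; apply: eq_bigr => i _; rewrite /GRing.scale/= mulrCA.
apply: DeriveDef; first by apply: cvgP main.
exact: cvg_lim main.
Unshelve. all: by end_near. Qed.

End Calculus.

Section Compositions.
Context {R : realType}.

(** Restricted to the line through [x] in direction [v], this is the one-variable chain rule: the
    difference quotients coincide. *)
Lemma is_derive_comp1 (V : normedModType R) (f : V -> R) (g : R -> R) (x v : V) (a b : R) :
  is_derive x v f a -> is_derive (f x) 1 g b -> is_derive x v (g \o f) (b * a).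
Proof.
move=> [df <-] dg.
have dl : is_derive (0 : R) 1 (fun h : R => f (x + h *: v)) ('D_v f x).
  have /is_derive_line : derivable f (x + 0 *: v) v by rewrite scale0r addr0.
  by rewrite scale0r addr0.
have dg0 : is_derive (f (x + 0 *: v)) 1 g b by rewrite scale0r addr0.
have [dc ec] := is_derive1_comp dg0 dl.
have e : (fun h : R => h^-1 *: (((g \o f) \o shift x) (h *: v) - (g \o f) x)) =
  (fun h : R => h^-1 *: (((g \o (fun h : R => f (x + h *: v))) \o shift (0 : R)) (h *: 1)
   - (g \o (fun h : R => f (x + h *: v))) 0)).
  apply/funext => h /=; congr (_ *: (g (f _) - g (f _))).
    by rewrite addr0 [h *: 1]mulr1 addrC.
  by rewrite scale0r addr0.
apply: DeriveDef; first by rewrite /derivable e.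
by rewrite /derive e -[RHS]ec.
Qed.

Lemma Ck_sum n (I : Type) (r : seq I) (P : pred I) k (U : set 'rV[R]_n)
    (f : I -> 'rV[R]_n -> R) : open U -> (forall i, P i -> Ck k U (f i)) ->
  Ck k U (fun x => \sum_(i <- r | P i) f i x).
Proof.
move=> oU Hf; elim: r => [|i r IH].
  by apply: Ck_ext (Ck_cst k U 0) => // x _; rewrite big_nil.
have [Pi|Pi] := boolP (P i).
  by apply: Ck_ext (CkD oU (Hf i Pi) IH) => // x _; rewrite big_cons Pi.
by apply: Ck_ext IH => // x _; rewrite big_cons (negbTE Pi).
Qed.

Lemma Ck_prod n (I : Type) (r : seq I) (P : pred I) k (U : set 'rV[R]_n)
    (f : I -> 'rV[R]_n -> R) : open U -> (forall i, P i -> Ck k U (f i)) ->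
  Ck k U (fun x => \prod_(i <- r | P i) f i x).
Proof.
move=> oU Hf; elim: r => [|i r IH].
  by apply: Ck_ext (Ck_cst k U 1) => // x _; rewrite big_nil.
have [Pi|Pi] := boolP (P i).
  by apply: Ck_ext (CkM oU (Hf i Pi) IH) => // x _; rewrite big_cons Pi.
by apply: Ck_ext IH => // x _; rewrite big_cons (negbTE Pi).
Qed.

Lemma Ck_sqrt n k (U : set 'rV[R]_n) (f : 'rV[R]_n -> R) : open U ->
  (forall x, U x -> 0 < f x) -> Ck k U f -> Ck k U (fun x => Num.sqrt (f x)).
Proof.
move=> oU f0; elim: k => [|k IH] Cf.
  move=> x Ux; apply: (@continuous_comp _ _ _ f Num.sqrt); first exact: Cf.
  exact: sqrt_continuous.
have := Cf; move=> [cf df]; split=> [x Ux|i].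
  apply: (@continuous_comp _ _ _ f Num.sqrt); first exact: cf.
  exact: sqrt_continuous.
have [dfi sf] := df i.
have D x : U x -> is_derive x (bv i) (fun x => Num.sqrt (f x))
    ((2 * Num.sqrt (f x))^-1 * 'D_(bv i) f x).
  move=> Ux; apply: is_derive_comp1; last exact: is_derive1_sqrt (f0 _ Ux).
  exact/derivableP/dfi.
split=> [x Ux|]; first by have [] := D x Ux.
have C2 : Ck k U (fun x => (2 * Num.sqrt (f x))^-1).
  apply: CkV => //; last by apply: CkM => //; [exact: Ck_cst|exact: IH (CkW Cf)].
  by move=> x Ux; rewrite mulf_neq0 // gt_eqF // sqrtr_gt0 f0.
by apply: Ck_ext (CkM oU C2 sf) => // x Ux; have [_ ->] := D x Ux.
Qed.

Lemma Ck_comp m n k (U : set 'rV[R]_m) (V : set 'rV[R]_n)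
    (phi : 'rV[R]_m -> 'rV[R]_n) (f : 'rV[R]_n -> R) :
  open U -> open V -> (forall x, U x -> V (phi x)) ->
  (forall j, Ck k U (fun x => phi x 0 j)) -> Ck k V f -> Ck k U (f \o phi).
Proof.
move=> oU oV UV; elim: k f => [|k IH] f Cphi Cf.
  move=> x Ux; apply: continuous_comp; last exact/Cf/UV.
  rewrite /continuous_at; apply/(@cvgrPdist_lt _ _ _ (nbhs x) (nbhs_filter x)) => e e0.
  have H j : \forall y \near x, `|phi x 0 j - phi y 0 j| < e.
    by have := Cphi j x Ux; rewrite /prop_for /continuous_at => /cvgrPdist_lt; apply.
  have := filter_forall (nbhs_filter x) H.
  by apply: filterS => y Hy; apply: rV_norm_lt => // j; rewrite !mxE.
have IHk := IH _ (fun j => CkW (Cphi j)).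
split=> [x Ux|i].
  exact: (Ck_cont (IHk _ (CkW Cf)) Ux).
have D x : U x -> is_derive x (bv i) (f \o phi)
    (\sum_j 'D_(bv j) f (phi x) * 'D_(bv i) (fun x => phi x 0 j) x).
  move=> Ux.
  have dphi : derivable phi x (bv i).
    apply/derivable_mxP => a j; rewrite (ord1 a).
    by have [_ /(_ i)[+ _]] := Cphi j; apply.
  have -> : \sum_j 'D_(bv j) f (phi x) * 'D_(bv i) (fun x => phi x 0 j) x =
      \sum_j 'D_(bv j) f (phi x) * ('D_(bv i) phi x) 0 j.
    by apply: eq_bigr => j _; rewrite derive_mx // mxE.
  apply: is_derive_comp_rV; first exact/derivableP.
    apply: (near_open oV) => [|y Vy j]; first exact: UV.
    by have [_ /(_ j)[+ _]] := Cf; apply.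
  by move=> j; have [_ /(_ j)[_ /Ck_cont]] := Cf; apply; exact: UV.
split=> [x Ux|]; first by have [] := D x Ux.
have H : Ck k U (fun x => \sum_j 'D_(bv j) f (phi x) * 'D_(bv i) (fun x => phi x 0 j) x).
  apply: Ck_sum => // j _; apply: CkM => //.
    by have [_ /(_ j)[_ Hj]] := Cf; exact: IHk Hj.
  by have [_ /(_ i)[_ Hi]] := Cphi j.
by apply: Ck_ext H => // x Ux; have [_ ->] := D x Ux.
Qed.

Lemma is_derive_chain m n (U : set 'rV[R]_m) (V : set 'rV[R]_n)
    (phi : 'rV[R]_m -> 'rV[R]_n) (f : 'rV[R]_n -> R) x v :
  open U -> open V -> U x -> V (phi x) ->
  (forall j, derivable (fun x => phi x 0 j) x v) -> Ck 1 V f ->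
  is_derive x v (f \o phi)
    (\sum_j 'D_(bv j) f (phi x) * 'D_v (fun x => phi x 0 j) x).
Proof.
move=> oU oV Ux Vx dp Cf.
have dphi : derivable phi x v.
  by apply/derivable_mxP => a j; rewrite (ord1 a); exact: dp.
have -> : \sum_j 'D_(bv j) f (phi x) * 'D_v (fun x => phi x 0 j) x =
    \sum_j 'D_(bv j) f (phi x) * ('D_v phi x) 0 j.
  by apply: eq_bigr => j _; rewrite derive_mx // mxE.
apply: is_derive_comp_rV; first exact/derivableP.
  apply: (near_open oV) => [|y Vy j]; first exact: Vx.
  by have [_ /(_ j)[+ _]] := Cf; apply.
by move=> j; have [_ /(_ j)[_ c]] := Cf; exact: c.
Qed.

(** The second difference of [f] over a square of side d is symmetric in [i] and [j], and two uses
    of the mean value theorem make it d^2 times either mixed partial at a point near [x]. *)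
Lemma Schwarz n (U : set 'rV[R]_n) (f : 'rV[R]_n -> R) x (i j : 'I_n) :
  open U -> U x -> Ck 2 U f -> 'D_(bv i) ('D_(bv j) f) x = 'D_(bv j) ('D_(bv i) f) x.
Proof.
move=> oU Ux Cf.
have [r r0 Br] : exists2 r : R, 0 < r & forall y, `|y - x| < r -> U y.
  have /nbhs_ballP[r /= r0 Br] : nbhs x U by exact: open_nbhs_nbhs.
  by exists r => // y yx; apply: Br; rewrite -ball_normE /= distrC.
have d1 k y : `|y - x| < r -> derivable f y (bv k).
  by move=> /Br Uy; have [_ /(_ k)[+ _]] := Cf; apply.
have d2 k l y : `|y - x| < r -> derivable ('D_(bv k) f) y (bv l).
  by move=> /Br Uy; have [_ /(_ k)[_ [_ /(_ l)[+ _]]]] := Cf; apply.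
have c2 k l : {for x, continuous ('D_(bv k) ('D_(bv l) f))}.
  by have [_ /(_ l)[_ [_ /(_ k)[_ /(_ x Ux)]]]] := Cf.
have nb s t k l : `|s *: bv k + t *: bv l : 'rV[R]_n| <= `|s| + `|t|.
  apply: le_trans (ler_normD _ _) _; rewrite !normrZ lerD //.
    rewrite -[leRHS]mulr1 ler_wpM2l // rV_norm_le // => q.
    by rewrite mxE eqxx /=; case: eqP => _; rewrite ?normr1 ?normr0.
  rewrite -[leRHS]mulr1 ler_wpM2l // rV_norm_le // => q.
  by rewrite mxE eqxx /=; case: eqP => _; rewrite ?normr1 ?normr0.
have key k l (d : R) : 0 < d -> d + d < r -> exists xi, `|xi - x| <= d + d /\
   f (x + d *: bv k + d *: bv l) - f (x + d *: bv k) - (f (x + d *: bv l) - f x) =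
   d * d * 'D_(bv l) ('D_(bv k) f) xi.
  move=> d0 dr; pose g y := f (y + d *: bv l) - f y.
  have dd : `|d| = d by rewrite gtr0_norm.
  have sm s t : `|s| <= d -> `|t| <= d -> `|x + s *: bv k + t *: bv l - x| <= d + d.
    move=> sd td; rewrite -(addrA x) addrAC subrr add0r.
    exact: le_trans (nb _ _ _ _) (lerD sd td).
  have ds s : `|s| <= `|d| -> is_derive (x + s *: bv k) (bv k) g
      ('D_(bv k) f (x + s *: bv k + d *: bv l) - 'D_(bv k) f (x + s *: bv k)).
    rewrite dd => sd.
    have i1 : is_derive (x + s *: bv k) (bv k) (fun y => f (y + d *: bv l))
        ('D_(bv k) f (x + s *: bv k + d *: bv l)).
      have D1 : derivable f (x + s *: bv k + d *: bv l) (bv k).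
        by apply: d1; apply: le_lt_trans dr; apply: sm => //; rewrite dd.
      have e : (fun h : R => h^-1 *: (((fun y => f (y + d *: bv l)) \o shift (x + s *: bv k)) (h *: bv k)
         - f (x + s *: bv k + d *: bv l))) = (fun h : R => h^-1 *: ((f \o shift (x + s *: bv k + d *: bv l)) (h *: bv k)
         - f (x + s *: bv k + d *: bv l))).
        by apply/funext => h /=; rewrite -!addrA.
      by apply: DeriveDef; rewrite /derivable /derive e.
    apply: is_deriveB; apply: derivableP; apply: d1; apply: le_lt_trans dr.
    by have := sm s 0 sd; rewrite scale0r addr0; apply; rewrite normr0 ltW.
  have [|s sd e] := @MVT_line _ _ g x (bv k) d.
    by move=> s /ds [].
  have [|t td e2] := @MVT_line _ _ ('D_(bv k) f) (x + s *: bv k) (bv l) d.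
    by move=> t td; apply: d2; apply: le_lt_trans dr; apply: sm; rewrite -dd.
  exists (x + s *: bv k + t *: bv l); split; first by apply: sm; rewrite -dd.
  rewrite -/(g _) -/(g x) e; have [_ ->] := ds s sd.
  by rewrite e2 mulrA.
apply/eqP; rewrite -subr_eq0 -normr_le0; apply/ler_addgt0Pl => e e0; rewrite addr0.
have e20 : 0 < e / 2 by rewrite divr_gt0.
have /cvgrPdist_lt/(_ _ e20)/nbhs_ballP[r1 /= r10 B1] := c2 i j.
have /cvgrPdist_lt/(_ _ e20)/nbhs_ballP[r2 /= r20 B2] := c2 j i.
pose m := Num.min r (Num.min r1 r2); have m0 : 0 < m by rewrite !lt_min r0 r10 r20.
(* The intermediate points lie within 2d of [x], which has to stay below [m]. *)
pose d := m / 3.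
have d0 : 0 < d by rewrite divr_gt0.
have dm : d + d < m by rewrite /d; lra.
have mr : m <= r by rewrite ge_min lexx.
have mr1 : m <= r1 by rewrite !ge_min lexx orbT.
have mr2 : m <= r2 by rewrite !ge_min lexx !orbT.
have [a [ha ea]] := key i j d d0 (lt_le_trans dm mr).
have [b [hb eb]] := key j i d d0 (lt_le_trans dm mr).
have eab : 'D_(bv j) ('D_(bv i) f) a = 'D_(bv i) ('D_(bv j) f) b.
  have dd0 : d * d != 0 by rewrite mulf_neq0 // gt_eqF.
  move: ('D_(bv j) ('D_(bv i) f) a) ('D_(bv i) ('D_(bv j) f) b) ea eb => A B ea eb.
  apply: (mulfI dd0); rewrite -ea -eb.
  rewrite (addrAC x (d *: bv j)); ring.
have A1 : `|'D_(bv i) ('D_(bv j) f) x - 'D_(bv i) ('D_(bv j) f) b| < e / 2.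
  apply: B1; rewrite -ball_normE /= distrC; apply: le_lt_trans hb _.
  exact: lt_le_trans dm mr1.
have A2 : `|'D_(bv j) ('D_(bv i) f) x - 'D_(bv j) ('D_(bv i) f) a| < e / 2.
  apply: B2; rewrite -ball_normE /= distrC; apply: le_lt_trans ha _.
  exact: lt_le_trans dm mr2.
rewrite -eab in A1; rewrite -(subrKA ('D_(bv j) ('D_(bv i) f) a)).
apply: le_trans (ler_normD _ _) _; rewrite distrC in A2.
by rewrite (splitr e); apply: lerD; [exact: ltW A1|exact: ltW A2].
Qed.

End Compositions.

(** * Integrals over [0,1] depending on a parameter *)

Section Integrals.
Context {R : realType}.

Definition seg_int (g : R -> R) : R :=
  (\int[@lebesgue_measure R]_(t in `[0%R, 1%R]) g t)%R.

Definition seg_cont (g : R -> R) := forall t, 0 <= t <= 1 -> {for t, continuous g}.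

Lemma seg_cont_within (g : R -> R) : seg_cont g -> {within `[0%R, 1%R], continuous g}.
Proof.
by move=> cg; apply: continuous_in_subspaceT => t /set_mem; rewrite /= in_itv/= => /cg.
Qed.

Lemma seg_integrable (g : R -> R) : seg_cont g ->
  (@lebesgue_measure R).-integrable `[0%R, 1%R] (EFin \o g).
Proof.
move=> cg; apply: continuous_compact_integrable; first exact: segment_compact.
exact: seg_cont_within.
Qed.

Lemma seg_intB (f g : R -> R) : seg_cont f -> seg_cont g ->
  seg_int (fun t => f t - g t) = seg_int f - seg_int g.
Proof. by move=> cf cg; apply: RintegralB => //; exact: seg_integrable. Qed.

Lemma seg_intZ (f : R -> R) c : seg_cont f ->
  seg_int (fun t => c * f t) = c * seg_int f.
Proof. by move=> cf; apply: RintegralZl => //; exact: seg_integrable. Qed.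

Lemma seg_intD (f g : R -> R) : seg_cont f -> seg_cont g ->
  seg_int (fun t => f t + g t) = seg_int f + seg_int g.
Proof. by move=> cf cg; apply: RintegralD => //; exact: seg_integrable. Qed.

Lemma seg_int_FTC (G g : R -> R) : seg_cont g ->
  (forall t : R, 0 <= t <= 1 -> is_derive t 1 G (g t)) -> seg_int g = G 1 - G 0.
Proof.
move=> cg dG.
have cG : seg_cont G.
  by move=> t /dG [d _]; apply: differentiable_continuous; exact/derivable1_diffP.
rewrite /seg_int /Rintegral (@continuous_FTC2 _ g G 0 1) //.
- exact: seg_cont_within.
- split; [|apply: cvg_at_right_filter; apply: cG; lra
    |apply: cvg_at_left_filter; apply: cG; lra].
  by move=> t; rewrite in_itv/= => /andP[t0 t1]; have [] := dG t; rewrite ?ltW.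
- move=> t; rewrite in_itv/= => /andP[t0 t1]; rewrite derive1E.
  by have [|_ ->] := dG t; rewrite ?(ltW t0) ?(ltW t1).
Qed.

Lemma seg_cst (c : R) : seg_int (fun=> c) = c.
Proof.
have -> : seg_int (fun=> c) = (fun t : R => c * t) 1 - (fun t : R => c * t) 0.
  apply: seg_int_FTC => t _; first exact: cst_continuous.
  by have := is_deriveZ c (is_derive_id t 1); rewrite [c *: 1]mulr1.
by rewrite mulr1 mulr0 subr0.
Qed.

Lemma seg_int_le (f : R -> R) (e : R) : seg_cont f ->
  (forall t, 0 <= t <= 1 -> `|f t| <= e) -> `|seg_int f| <= e.
Proof.
move=> cf fe; apply: le_trans (le_normr_Rintegral _ (seg_integrable cf)) _ => //.
rewrite -[leRHS]seg_cst; apply: le_Rintegral => //.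
- apply: (@seg_integrable (fun t => `|f t|)) => t t01.
  by apply: continuous_comp; [exact: cf|exact: norm_continuous].
- by apply: seg_integrable => t _; exact: cst_continuous.
Qed.

(** A tube argument: compactness of [0,1] makes the neighbourhood of [x] independent of [t]. *)
Lemma seg_unif (T : topologicalType) (G : R -> T -> R) (x : T) :
  (forall t, 0 <= t <= 1 -> {for (t, x), continuous (fun p => G p.1 p.2)}) ->
  forall e, 0 < e -> \forall y \near x, forall t, 0 <= t <= 1 -> `|G t y - G t x| < e.
Proof.
move=> cG e e0.
have /compact_near_coveringP := @segment_compact R 0 1.
move=> /(_ _ (nbhs x) (fun y t => `|G t y - G t x| < e) _) H.
have : \forall y \near x, `[0%R, 1%R] `<=` (fun t => `|G t y - G t x| < e).
  apply: H => t; rewrite /= in_itv/= => t01.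
  have e20 : 0 < e / 2 by rewrite divr_gt0.
  have := cG t t01; rewrite /prop_for /continuous_at => /cvgrPdist_lt /(_ _ e20) [[A B] /= [nA nB] AB].
  exists (A, B) => // -[t' y] /= [At' By].
  have h1 := AB (t', y) (conj At' By); have h2 := AB (t', x) (conj At' (nbhs_singleton nB)).
  rewrite /= in h1 h2; rewrite -(subrKA (G t x)).
  by rewrite (le_lt_trans (ler_normD _ _)) // [ltRHS]splitr ltrD // distrC.
by apply: filterS => y Hy t t01; apply: Hy; rewrite /= in_itv.
Qed.

Definition jcont n (U : set 'rV[R]_n) (G : R -> 'rV[R]_n -> R) :=
  forall t x, 0 <= t <= 1 -> U x -> {for (t, x), continuous (fun p => G p.1 p.2)}.

Lemma jcont_seg n (U : set 'rV[R]_n) G x : jcont U G -> U x -> seg_cont (G^~ x).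
Proof.
move=> jG Ux t t01; apply: (@continuous_comp _ _ _ (fun t => (t, x)) (fun p => G p.1 p.2)).
  move=> A /= [[B C] /= [nB nC] BC]; apply: filterS nB => s Bs.
  by apply: BC; split => //=; exact: nbhs_singleton nC.
exact: jG.
Qed.

Lemma pint_cont n (U : set 'rV[R]_n) G x : open U -> jcont U G -> U x ->
  {for x, continuous (fun x => seg_int (G^~ x))}.
Proof.
move=> oU jG Ux.
rewrite /prop_for /continuous_at; apply/(@cvgrPdist_le _ _ _ (nbhs x) (nbhs_filter x)) => e e0.
have := seg_unif (fun t t01 => jG t x t01 Ux) e0.
have : \forall y \near x, U y by exact: open_nbhs_nbhs.
apply: filterS2 => y Uy Hy; rewrite distrC -seg_intB; [|exact: jcont_seg Uy|exact: jcont_seg Ux].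
apply: seg_int_le => [t t01|t /Hy/ltW //].
by have := cvgB (jcont_seg jG Uy t01) (jcont_seg jG Ux t01); apply.
Qed.

(** Differentiation under the integral sign. By the mean value theorem each difference quotient is a
    derivative at an intermediate point, close to the one at [x] uniformly in [t] by [seg_unif]. *)
Lemma pint_derive n (U : set 'rV[R]_n) G (i : 'I_n) x : open U -> jcont U G ->
  (forall t x, 0 <= t <= 1 -> U x -> derivable (G t) x (bv i)) ->
  jcont U (fun t => 'D_(bv i) (G t)) -> U x ->
  is_derive x (bv i) (fun x => seg_int (G^~ x)) (seg_int (fun t => 'D_(bv i) (G t) x)).
Proof.
move=> oU jG dG jdG Ux.
suff main : h^-1 *: (seg_int (G^~ (h *: bv i + x)) - seg_int (G^~ x)) @[h --> 0^'] -->
    seg_int (fun t => 'D_(bv i) (G t) x).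
  by apply: DeriveDef; [apply: cvgP main|exact: cvg_lim main].
apply/cvgrPdist_le => e e0.
have [r r0 Br] : exists2 r : R, 0 < r & forall y, `|y - x| < r -> U y /\
    forall t, 0 <= t <= 1 -> `|'D_(bv i) (G t) y - 'D_(bv i) (G t) x| < e.
  have oUx : \forall y \near x, U y by exact: open_nbhs_nbhs.
  have /nbhs_ballP[r /= r0 Br] : nbhs x (fun y => U y /\ forall t, 0 <= t <= 1 ->
      `|'D_(bv i) (G t) y - 'D_(bv i) (G t) x| < e).
    exact: filterI oUx (seg_unif (fun t t01 => jdG t x t01 Ux) e0).
  exists r => // y yx; apply: Br.
  by rewrite -ball_normE /= distrC.
have nb s : `|s *: bv i : 'rV[R]_n| <= `|s|.
  rewrite normrZ -[leRHS]mulr1 ler_wpM2l // rV_norm_le // => q.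
  by rewrite mxE eqxx /=; case: eqP => _; rewrite ?normr1 ?normr0.
near=> h.
have h0 : h != 0 by near: h; exact: nbhs_dnbhs_neq.
have hr : `|h| < r by near: h; apply: dnbhs0_lt.
have Uh : U (h *: bv i + x).
  by have [] := Br (h *: bv i + x); rewrite ?addrK // (le_lt_trans (nb _)).
have cB t : 0 <= t <= 1 -> {for t, continuous (fun t => G t (h *: bv i + x) - G t x)}.
  by move=> t01; have := cvgB (jcont_seg jG Uh t01) (jcont_seg jG Ux t01); apply.
rewrite -seg_intB; [|exact: jcont_seg Uh|exact: jcont_seg Ux].
rewrite /GRing.scale/= -seg_intZ // -seg_intB; first last.
- by move=> t t01; have := cvgM (cvg_cst h^-1) (cB t t01); apply.
- exact: (jcont_seg jdG Ux).
apply: seg_int_le => [t t01|t t01].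
  by have := cvgB (jcont_seg jdG Ux t01) (cvgM (cvg_cst h^-1) (cB t t01)); apply.
have [s sh|s sh e1] := @MVT_line _ _ (G t) x (bv i) h.
  apply: dG => //; have [] // := Br (x + s *: bv i).
  by rewrite addrC addKr (le_lt_trans (nb _)) // (le_lt_trans sh).
rewrite (addrC _ x) e1 mulKf // distrC.
have [|_ /(_ t t01)/ltW //] := Br (x + s *: bv i).
by rewrite addrC addKr (le_lt_trans (nb _)) // (le_lt_trans sh).
Unshelve. all: by end_near. Qed.

Lemma smooth_pint n (U : set 'rV[R]_n) (G : R -> 'rV[R]_n -> R) : open U ->
  (forall s, jcont U (fun t => iter_partial s (G t)) /\
     forall t x i, 0 <= t <= 1 -> U x -> derivable (iter_partial s (G t)) x (bv i)) ->
  smooth_on U (fun x => seg_int (G^~ x)).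
Proof.
move=> oU HG.
have E s x : U x -> iter_partial s (fun x => seg_int (G^~ x)) x =
    seg_int (fun t => iter_partial s (G t) x).
  elim: s x => [|i s IH] x Ux //=.
  have [jG dG] := HG s; have [jdG _] := HG (i :: s).
  have [_ <-] := pint_derive oU jG (fun t x t01 Ux => dG t x i t01 Ux) jdG Ux.
  by apply: near_eq_derive; exact: near_open IH.
move=> s x Ux; have [jG dG] := HG s.
have nE : \forall y \near x, seg_int (fun t => iter_partial s (G t) y) =
    iter_partial s (fun x => seg_int (G^~ x)) y.
  by apply: (near_open oU Ux) => y Uy; rewrite E.
split; first by apply: eq_cont_at nE _; exact: pint_cont oU jG Ux.
move=> i; have [jdG _] := HG (i :: s).
have [d _] := pint_derive oU jG (fun t x t01 Ux => dG t x i t01 Ux) jdG Ux.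
by apply: near_eq_derivable d.
Qed.

End Integrals.

Lemma near_mono (T : topologicalType) (x : T) (P Q : T -> Prop) :
  (forall y, P y -> Q y) -> (\forall y \near x, P y) -> \forall y \near x, Q y.
Proof. by move=> PQ; apply: filterS. Qed.

Lemma seg_int_sum (R : realType) (I : Type) (r : seq I) (g : I -> R -> R) :
  (forall i, seg_cont (g i)) ->
  seg_cont (fun t => \sum_(i <- r) g i t) /\
  seg_int (fun t => \sum_(i <- r) g i t) = \sum_(i <- r) seg_int (g i).
Proof.
move=> cg; elim: r => [|i r [cr IH]].
  under eq_fun do rewrite big_nil; rewrite big_nil seg_cst; split => // t _.
  exact: cst_continuous.
under eq_fun do rewrite big_cons; rewrite big_cons seg_intD // IH; split => // t t01.
by have := cvgD (cg i t t01) (cr t t01); apply.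
Qed.

(** * Hadamard's lemma: first-order expansion with smooth coefficients *)

Section Hadamard.
Context {R : realType} {n : nat}.
Implicit Types (a x y : 'rV[R]_n) (f g h : 'rV[R]_n -> R).

Definition nball a (r : R) : set 'rV[R]_n := [set x | `|x - a| < r].

Lemma nball_nbhs a (r : R) : 0 < r -> nbhs a (nball a r).
Proof.
move=> r0; apply/nbhs_ballP; exists r => //= x; rewrite -ball_normE /= distrC.
exact.
Qed.

Lemma nbhs_nball a (A : set 'rV[R]_n) : nbhs a A -> exists2 r : R, 0 < r & nball a r `<=` A.
Proof.
move=> /nbhs_ballP[r /= r0 rA]; exists r => // x; rewrite /nball /= => xa.
by apply: rA; rewrite -ball_normE /= distrC.
Qed.

Lemma nball_open a (r : R) : open (nball a r).
Proof.
rewrite openE => x; rewrite /nball /= => xr.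
have r0 : 0 < r - `|x - a| by rewrite subr_gt0.
apply: filterS (nball_nbhs x r0) => y; rewrite /nball /= ltrBrDl => yx.
rewrite -(subrKA x) addrC; apply: le_lt_trans yx.
by rewrite (le_trans (ler_normD _ _)).
Qed.

Let A a (t : R) x := a + t *: (x - a).

Let A_cont a (p : R * 'rV[R]_n) : {for p, continuous (fun p : R * 'rV[R]_n => A a p.1 p.2)}.
Proof.
apply: cvgD; first exact: cvg_cst.
apply: cvgZ; first exact: cvg_fst.
by apply: cvgB; [exact: cvg_snd|exact: cvg_cst].
Qed.

Let A_derive a t x i : is_derive x (bv i) (A a t) (t *: bv i).
Proof.
have := is_deriveD (is_derive_cst a x (bv i)) (is_deriveZ t (is_deriveB (is_derive_id x (bv i)) (is_derive_cst a x (bv i)))).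
by rewrite add0r subr0.
Qed.

Let A_near a t x U : open U -> U (A a t x) -> \forall y \near x, U (A a t y).
Proof.
move=> oU Ux; have cA := @A_cont a (t, x).
have [[B C] /= [nB nC] BC] := cA _ (open_nbhs_nbhs (conj oU Ux)).
apply: filterS nC => y Cy; apply: (BC (t, y)); split => //=; exact: nbhs_singleton nB.
Qed.

(** Each derivative of f(a + t (x - a)) in x releases one factor [t]. This exhibits all partials as
    jointly continuous in t and x, as [smooth_pint] requires. *)
Let iter_A a t x U f s : open U -> smooth_on U f -> U (A a t x) ->
  iter_partial s (f \o A a t) x = t ^+ size s * iter_partial s f (A a t x) /\
  forall i, derivable (iter_partial s (f \o A a t)) x (bv i).
Proof.
move=> oU sf.
have dA s' y i : U (A a t y) -> is_derive y (bv i) (fun y => t ^+ size s' * iter_partial s' f (A a t y))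
    (t ^+ (size s').+1 * 'D_(bv i) (iter_partial s' f) (A a t y)).
  move=> Uy.
  have -> : t ^+ (size s').+1 * 'D_(bv i) (iter_partial s' f) (A a t y) =
      t ^+ size s' *: (\sum_j 'D_(bv j) (iter_partial s' f) (A a t y) * (t *: bv i : 'rV[R]_n) 0 j).
    rewrite (bigD1 i) //= big1 => [|j ji]; last by rewrite !mxE eqxx (negbTE ji) !mulr0.
    by rewrite !mxE !eqxx /GRing.scale/= exprSr; ring.
  apply: (@is_deriveZ _ _ _ (iter_partial s' f \o A a t)).
  apply: is_derive_comp_rV; first exact: A_derive.
  - apply: (near_open oU) => [|z Uz j]; first exact: Uy.
    by have [_ /(_ j)] := sf s' z Uz.
  - by move=> j; have [+ _] := sf (j :: s') _ Uy.
move=> Ux; elim: s x Ux => [|k s IH] x Ux /=.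
  rewrite mul1r; split => // i; have [d _] := dA [::] x i Ux.
  by apply: near_eq_derivable d; apply: near_mono (A_near oU Ux) => y _ /=; rewrite mul1r.
have E : \forall y \near x, t ^+ size s * iter_partial s f (A a t y) = iter_partial s (f \o A a t) y.
  by apply: near_mono (A_near oU Ux) => y Uy; have [->] := IH y Uy.
have E' : forall y, U (A a t y) -> 'D_(bv k) (iter_partial s (f \o A a t)) y =
   t ^+ (size s).+1 * 'D_(bv k) (iter_partial s f) (A a t y).
  move=> y Uy; have [_ <-] := dA s y k Uy; apply/esym/near_eq_derive.
  by apply: near_mono (A_near oU Uy) => z Uz; have [->] := IH z Uz.
split=> [|i]; first exact: E'.
have [d _] := dA (k :: s) x i Ux.
by apply: near_eq_derivable d; apply: near_mono (A_near oU Ux) => y /E' ->.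
Qed.

(** h_i(x) is the integral over [0,1] of the i-th partial derivative at a + t (x - a), and the
    expansion is the fundamental theorem of calculus along the segment. It is what makes a
    derivation at a point a combination of partial derivatives. *)
Lemma Hadamard a (r : R) f : 0 < r -> smooth_on (nball a r) f ->
  exists h : 'I_n -> 'rV[R]_n -> R,
    [/\ forall i, smooth_on (nball a r) (h i),
        forall i, h i a = 'D_(bv i) f a &
        forall x, nball a r x -> f x = f a + \sum_i (x 0 i - a 0 i) * h i x].
Proof.
move=> r0 sf; set U := nball a r; have oU : open U by exact: nball_open.
pose h i x := seg_int (fun t => ('D_(bv i) f \o A a t) x).
have UA t x : 0 <= t <= 1 -> U x -> U (A a t x).
  move=> /andP[t0 t1]; rewrite /U /nball /A /= addrAC subrr add0r normrZ ger0_norm // => xr.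
  by apply: le_lt_trans xr; rewrite -[leRHS]mul1r ler_wpM2r.
have sdf i : smooth_on U ('D_(bv i) f).
  by move=> s x Ux; have := sf (rcons s i) x Ux; rewrite iter_partial_rcons.
have cf i s : jcont U (fun t => iter_partial s ('D_(bv i) f \o A a t)).
  move=> t x t01 Ux; have Ua := UA t x t01 Ux.
  refine (eq_cont_at (f := fun p : R * 'rV[R]_n => p.1 ^+ size s * iter_partial s ('D_(bv i) f) (A a p.1 p.2)) _ _).
    have : \forall p \near (t, x), U (A a p.1 p.2).
      by have := @A_cont a (t, x); apply; exact: open_nbhs_nbhs.
    by apply: near_mono => p Up; have [->] := iter_A s oU (sdf i) Up.
  apply: cvgM.
    by apply: (cvg_comp fst (fun t : R => t ^+ size s)); [exact: cvg_fst|exact: exprn_continuous].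
  apply: (cvg_comp (fun p : R * 'rV[R]_n => A a p.1 p.2) (iter_partial s ('D_(bv i) f))).
    exact: (@A_cont a (t, x)).
  by have [+ _] := sdf i s _ Ua.
exists h; split.
- move=> i; apply: smooth_pint => // s; split; first exact: cf.
  by move=> t x j t01 Ux; have [_] := iter_A s oU (sdf i) (UA t x t01 Ux).
- move=> i; rewrite -[RHS]seg_cst; congr seg_int; apply/funext => t.
  by rewrite /A /= subrr scaler0 addr0.
move=> x Ux.
have dG (t : R) : 0 <= t <= 1 -> is_derive t 1 (fun t => f (A a t x))
    (\sum_i 'D_(bv i) f (A a t x) * (x - a) 0 i).
  move=> t01; have Ua := UA t x t01 Ux.
  apply: (@is_derive_comp_rV _ _ _ (fun t => A a t x) f).
  - have := is_derive_line (@derivable_id R _ (a + t *: (x - a)) (x - a)).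
    by rewrite (@derive_id R).
  - apply: (near_open oU) => [|z Uz j]; first exact: Ua.
    by have [_ /(_ j)] := sf [::] z Uz.
  - by move=> j; have [+ _] := sf [:: j] _ Ua.
have cG i : seg_cont (fun t => 'D_(bv i) f (A a t x)).
  by move=> t t01; exact: (jcont_seg (cf i [::]) Ux t01).
have cg i : seg_cont (fun t => 'D_(bv i) f (A a t x) * (x - a) 0 i).
  by move=> t t01; have := cvgM (cG i t t01) (cvg_cst ((x - a) 0 i)); apply.
have [cs es] := seg_int_sum (index_enum 'I_n) cg.
have := seg_int_FTC cs dG; rewrite es /A scale0r addr0 scale1r (addrC a) subrK => FTC.
rewrite -[LHS](subrK (f a)) -FTC addrC; congr (_ + _); apply: eq_bigr => i _.
rewrite /h -seg_intZ; last exact: cG.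
by congr (seg_int _); apply/funext => t; rewrite !mxE mulrC.
Qed.

End Hadamard.

(** * Smooth cutoff functions on the line *)

Section Flat.
Context {R : realType}.

(* The exponent m makes the family closed under differentiation. *)
Definition flat (m : nat) (t : R) : R := if 0 < t then t^-1 ^+ m * expR (- t^-1) else 0.

Lemma flat_le0 m t : t <= 0 -> flat m t = 0.
Proof. by rewrite /flat leNgt; case: ifP. Qed.

Lemma flat_gt0 m t : 0 < t -> 0 < flat m t.
Proof. by move=> t0; rewrite /flat t0 mulr_gt0 ?expR_gt0 // exprn_gt0 // invr_gt0. Qed.

Lemma flat_ge0 m t : 0 <= flat m t.
Proof. by have [/flat_le0->//|/flat_gt0/ltW] := leP t 0; apply. Qed.

(** From exp(u) >= u^(m+2) / (m+2)! at u = 1/t. The quadratic factor forces the difference quotients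
    at 0 to tend to 0. *)
Lemma flat_bound m t : flat m t <= m.+2`!%:R * t ^+ 2.
Proof.
have [t0|t0] := leP t 0; first by rewrite flat_le0 // mulr_ge0 // sqr_ge0.
have i0 : 0 < t^-1 by rewrite invr_gt0.
rewrite /flat t0 expRN ler_pdivrMr ?expR_gt0 //.
have := expR_ge1Dxn m.+1 (ltW i0); set e := expR _ => he.
have f0 : 0 < m.+2`!%:R :> R by rewrite ltr0n fact_gt0.
have h1 : t^-1 ^+ m.+2 <= m.+2`!%:R * e.
  by rewrite mulrC -ler_pdivrMr //; apply: le_trans he; rewrite lerDr.
have -> : t^-1 ^+ m = t^-1 ^+ m.+2 * t ^+ 2.
  by rewrite -[m.+2]addn2 exprD -mulrA -exprMn mulVf ?gt_eqF // expr1n mulr1.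
by rewrite [leRHS]mulrAC; apply: ler_wpM2r => //; exact: sqr_ge0.
Qed.

Lemma is_derive_flat m (t : R) :
  is_derive t 1 (flat m) (flat m.+2 t - m%:R * flat m.+1 t).
Proof.
have [t0|t0|->] := ltgtP t 0.
- rewrite !flat_le0 ?(ltW t0) // mulr0 subrr.
  apply: near_eq_is_derive (is_derive_cst 0 t 1).
  by near=> s; rewrite flat_le0 //; apply: ltW; near: s; exact: lt_nbhsl.
- have dV : is_derive t 1 (fun s : R => s^-1) (- (t^-1 ^+ 2)).
    apply: DeriveDef; first by apply: derivableV; rewrite ?gt_eqF.
    by rewrite deriveV ?gt_eqF // derive_id [_ *: 1]mulr1 exprVn.
  have dX : is_derive t 1 (fun s : R => s^-1 ^+ m) (- (m%:R * t^-1 ^+ m.+1)).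
    have := is_deriveX m dV; rewrite (_ : _ ^+ m = (fun s : R => s^-1 ^+ m)); last first.
      by apply/funext => s; rewrite exprfctE.
    rewrite /GRing.scale/=; case: m => [|m] d.
      by apply: is_derive_eq d _; rewrite ?mulr0n ?mul0r oppr0.
    apply: is_derive_eq d _.
    by rewrite !exprS -[m.+1.-1]/m mulr_natl; ring.
  have dE : is_derive t 1 (fun s : R => expR (- s^-1)) (expR (- t^-1) * t^-1 ^+ 2).
    have dN := is_deriveN dV; rewrite opprK in dN.
    exact: (is_derive_comp1 dN (is_derive_expR _)).
  have d := is_deriveM dX dE.
  rewrite /flat t0; apply: near_eq_is_derive (is_derive_eq d _); last first.
    by rewrite /GRing.scale/= !exprS; ring.
  by near=> s; rewrite ifT //; near: s; exact: lt_nbhsr.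
- rewrite !flat_le0 // mulr0 subrr.
  suff main : h^-1 *: (flat m (h *: 1 + 0) - flat m 0) @[h --> 0^'] --> (0 : R).
    by apply: DeriveDef; [apply: cvgP main|exact: cvg_lim main].
  rewrite (flat_le0 _ (lexx 0)).
  apply/cvgr0Pnorm_le => e e0; near=> h.
  have h0 : h != 0 by near: h; exact: nbhs_dnbhs_neq.
  have f0 : 0 < m.+2`!%:R :> R by rewrite ltr0n fact_gt0.
  have hr : `|h| < e / m.+2`!%:R by near: h; apply: dnbhs0_lt; rewrite divr_gt0.
  rewrite addr0 [h *: 1]mulr1 subr0 /GRing.scale/= normrM normfV.
  rewrite ler_pdivrMl ?normr_gt0 // ger0_norm ?flat_ge0 // (le_trans (flat_bound _ _)) //.
  rewrite -real_normK ?num_real // expr2 mulrCA ler_wpM2l //.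
  by rewrite mulrC -ler_pdivlMr // ltW.
Unshelve. all: by end_near. Qed.

Lemma continuous_flat m : continuous (flat m).
Proof.
move=> t; have [d _] := is_derive_flat m t.
by apply: differentiable_continuous; exact/derivable1_diffP.
Qed.

Lemma Ck_flat n k m (U : set 'rV[R]_n) (f : 'rV[R]_n -> R) : open U ->
  Ck k U f -> Ck k U (flat m \o f).
Proof.
move=> oU; elim: k m => [|k IH] m Cf.
  by move=> x Ux; apply: continuous_comp; [exact: Cf|exact: continuous_flat].
have := Cf; move=> [cf df]; split=> [x Ux|i].
  by apply: continuous_comp; [exact: cf|exact: continuous_flat].
have [dfi sf] := df i.
have D x : U x -> is_derive x (bv i) (flat m \o f)
    ((flat m.+2 (f x) - m%:R * flat m.+1 (f x)) * 'D_(bv i) f x).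
  move=> Ux; apply: is_derive_comp1; last exact: is_derive_flat.
  exact/derivableP/dfi.
split=> [x Ux|]; first by have [] := D x Ux.
have H : Ck k U (fun x => ((flat m.+2 \o f) x + - m%:R * (flat m.+1 \o f) x) * 'D_(bv i) f x).
  apply: CkM => //; apply: CkD => //; first exact/IH/CkW.
  by apply: CkM => //; [exact: Ck_cst|exact/IH/CkW].
by apply: Ck_ext H => // x Ux; have [_ ->] := D x Ux; rewrite /= mulNr.
Qed.

(** A smooth transition from 0 on t <= 0 to 1 on t >= 1. The denominator is positive because t and 1
    - t are never both <= 0. *)
Definition step (t : R) := flat 0 t / (flat 0 t + flat 0 (1 - t)).

Lemma step_den t : 0 < flat 0 t + flat 0 (1 - t).
Proof.
have [t0|t0] := leP t 0.
  by rewrite ltr_wpDl ?flat_ge0 // flat_gt0 //; lra.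
by rewrite ltr_wpDr ?flat_ge0 // flat_gt0.
Qed.

Lemma step0 t : t <= 0 -> step t = 0.
Proof. by move=> t0; rewrite /step flat_le0 // mul0r. Qed.

Lemma step1 t : 1 <= t -> step t = 1.
Proof.
move=> t1; rewrite /step [flat 0 (1 - t)]flat_le0 ?subr_le0 // addr0 divff //.
by rewrite gt_eqF // flat_gt0 // (lt_le_trans _ t1).
Qed.

Lemma step_ge0 t : 0 <= step t.
Proof. by rewrite divr_ge0 ?flat_ge0 // ltW // step_den. Qed.

End Flat.

Section Smooth.
Context {R : realType} {n : nat}.
Implicit Types (U : set 'rV[R]_n) (f g : 'rV[R]_n -> R).

Lemma smooth_cst U (c : R) : smooth_on U (fun=> c).
Proof. by apply/smooth_onP => k; exact: Ck_cst. Qed.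

Lemma smooth_coord U (j : 'I_n) : smooth_on U (fun x => x 0 j).
Proof. by apply/smooth_onP => k; exact: Ck_coord. Qed.

Lemma smoothD U f g : open U -> smooth_on U f -> smooth_on U g ->
  smooth_on U (fun x => f x + g x).
Proof. by move=> oU /smooth_onP Cf /smooth_onP Cg; apply/smooth_onP => k; exact: CkD. Qed.

Lemma smoothM U f g : open U -> smooth_on U f -> smooth_on U g ->
  smooth_on U (fun x => f x * g x).
Proof. by move=> oU /smooth_onP Cf /smooth_onP Cg; apply/smooth_onP => k; exact: CkM. Qed.

Lemma smoothV U f : open U -> (forall x, U x -> f x != 0) -> smooth_on U f ->
  smooth_on U (fun x => (f x)^-1).
Proof. by move=> oU f0 /smooth_onP Cf; apply/smooth_onP => k; exact: CkV. Qed.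

Lemma smooth_sqrt U f : open U -> (forall x, U x -> 0 < f x) -> smooth_on U f ->
  smooth_on U (fun x => Num.sqrt (f x)).
Proof. by move=> oU f0 /smooth_onP Cf; apply/smooth_onP => k; exact: Ck_sqrt. Qed.

Lemma smooth_ext U f g : open U -> (forall x, U x -> f x = g x) ->
  smooth_on U f -> smooth_on U g.
Proof. by move=> oU fg /smooth_onP Cf; apply/smooth_onP => k; apply: Ck_ext (Cf k). Qed.

Lemma smooth_sub U V f : V `<=` U -> smooth_on U f -> smooth_on V f.
Proof. by move=> VU sf s x /VU; exact: sf. Qed.

Lemma smooth_local U f : (forall x, U x -> exists2 V, V x & smooth_on V f) -> smooth_on U f.
Proof. by move=> H s x /H[V Vx sf]; exact: sf. Qed.

Lemma smooth_sum (I : Type) (r : seq I) (P : pred I) U (f : I -> 'rV[R]_n -> R) :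
  open U -> (forall i, P i -> smooth_on U (f i)) ->
  smooth_on U (fun x => \sum_(i <- r | P i) f i x).
Proof.
move=> oU sf; apply/smooth_onP => k; apply: Ck_sum => // i Pi.
by move: k; apply/smooth_onP; exact: sf.
Qed.

Lemma smooth_prod (I : Type) (r : seq I) (P : pred I) U (f : I -> 'rV[R]_n -> R) :
  open U -> (forall i, P i -> smooth_on U (f i)) ->
  smooth_on U (fun x => \prod_(i <- r | P i) f i x).
Proof.
move=> oU sf; apply/smooth_onP => k; apply: Ck_prod => // i Pi.
by move: k; apply/smooth_onP; exact: sf.
Qed.

Lemma smooth_step U f : open U -> smooth_on U f -> smooth_on U (step \o f).
Proof.
move=> oU sf; have sflat m h : smooth_on U h -> smooth_on U (flat m \o h).
  by move=> /smooth_onP Ch; apply/smooth_onP => k; exact: Ck_flat.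
have s1 : smooth_on U (flat 0 \o (fun x => 1 + -1 * f x)) :=
  sflat 0 _ (smoothD oU (@smooth_cst U 1) (smoothM oU (@smooth_cst U (-1)) sf)).
have s2 : smooth_on U (fun x => flat 0 (f x) + flat 0 (1 + -1 * f x)) :=
  smoothD oU (sflat 0 f sf) s1.
have s3 : smooth_on U (fun x => (flat 0 (f x) + flat 0 (1 + -1 * f x))^-1).
  apply: smoothV => // x Ux.
  by have := step_den (f x); rewrite mulN1r => h; rewrite gt_eqF.
by apply: smooth_ext (smoothM oU (sflat 0%N f sf) s3) => // x Ux; rewrite mulN1r.
Qed.

Lemma smooth_derive U f i : smooth_on U f -> smooth_on U ('D_(bv i) f).
Proof. by move=> sf s x Ux; have := sf (rcons s i) x Ux; rewrite iter_partial_rcons. Qed.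

Lemma smooth_derivable U f x i : smooth_on U f -> U x -> derivable f x (bv i).
Proof. by move=> sf Ux; have [_] := sf [::] x Ux; apply. Qed.

Lemma smooth_cont U f x : smooth_on U f -> U x -> {for x, continuous f}.
Proof. by move=> sf Ux; have [] := sf [::] x Ux. Qed.

End Smooth.

Lemma smooth_comp (R : realType) m n (U : set 'rV[R]_m) (V : set 'rV[R]_n)
    (phi : 'rV[R]_m -> 'rV[R]_n) (f : 'rV[R]_n -> R) :
  open U -> open V -> (forall x, U x -> V (phi x)) ->
  (forall j, smooth_on U (fun x => phi x 0 j)) -> smooth_on V f -> smooth_on U (f \o phi).
Proof.
move=> oU oV UV sp /smooth_onP Cf; apply/smooth_onP => k.
apply: (Ck_comp oU oV UV _ (Cf k)) => j; move: k; apply/smooth_onP; exact: sp.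
Qed.

(** * Derivatives of determinants and Piola's identity *)

Section Determinant.
Context {R : realType}.

Lemma is_derive_prod (V : normedModType R) (I : eqType) (r : seq I) (f : I -> V -> R)
    (df : I -> R) (x v : V) :
  uniq r -> (forall i, is_derive x v (f i) (df i)) ->
  is_derive x v (fun y => \prod_(i <- r) f i y)
    (\sum_(i <- r) df i * \prod_(k <- r | k != i) f k x).
Proof.
move=> + Hf; elim: r => [|a r IH] /=.
  by move=> _; under eq_fun do rewrite big_nil; rewrite big_nil; exact: is_derive_cst.
move=> /andP[ar /IH{}IH]; under eq_fun do rewrite big_cons.
apply: is_derive_eq (is_deriveM (Hf a) IH) _.
rewrite big_cons big_cons eqxx /= addrC /GRing.scale/=; congr (_ + _).
  rewrite mulrC; congr (_ * _); rewrite [RHS]big_seq_cond [LHS]big_seq; apply: eq_bigl => i.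
  by case: (eqVneq i a) => [->|]; rewrite ?andbT //= (negbTE ar).
rewrite mulr_sumr [LHS]big_seq [RHS]big_seq; apply: eq_bigr => i ir.
rewrite big_cons ifT; first by rewrite mulrCA.
by apply: contraNneq ar => ->.
Qed.

Lemma is_derive_sumf (V : normedModType R) (I : Type) (r : seq I) (P : pred I)
    (f : I -> V -> R) (df : I -> R) (x v : V) :
  (forall i, P i -> is_derive x v (f i) (df i)) ->
  is_derive x v (fun y => \sum_(i <- r | P i) f i y) (\sum_(i <- r | P i) df i).
Proof.
move=> Hf; elim: r => [|a r IH].
  by under eq_fun do rewrite big_nil; rewrite big_nil; exact: is_derive_cst.
under eq_fun do rewrite big_cons; rewrite big_cons.
by case: ifP => // Pa; apply: is_deriveD => //; exact: Hf.
Qed.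

(** Jacobi's formula. By multilinearity the derivative is a sum over [i] of determinants with row
    [i] differentiated, each expanded along that row. *)
Lemma is_derive_det (V : normedModType R) n (A : V -> 'M[R]_n)
    (dA : 'I_n -> 'I_n -> R) (x v : V) :
  (forall i j, is_derive x v (fun y => A y i j) (dA i j)) ->
  is_derive x v (fun y => \det (A y)) (\sum_i \sum_j dA i j * cofactor (A x) i j).
Proof.
move=> HA.
have E i : \sum_j dA i j * cofactor (A x) i j =
    \sum_(s : 'S_n) (-1) ^+ s * (dA i (s i) * \prod_(k | k != i) A x k (s k)).
  pose B := \matrix_(k, j) (if k == i then dA i j else A x k j).
  transitivity (\det B).
    rewrite (expand_det_row _ i); apply: eq_bigr => j _; rewrite mxE eqxx; congr (_ * _).
    rewrite /cofactor; congr (_ * \det _); apply/matrixP => a b; rewrite !mxE.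
    by rewrite eq_sym (negbTE (neq_lift _ _)).
  apply: eq_bigr => s _; congr (_ * _); rewrite (bigD1 i) //= mxE eqxx; congr (_ * _).
  by apply: eq_bigr => k ki; rewrite mxE (negbTE ki).
rewrite (eq_bigr _ (fun i _ => E i)) exchange_big /=.
apply: is_derive_sumf => s _; rewrite -mulr_sumr.
apply: is_deriveZ.
apply: (is_derive_prod (f := fun i y => A y i (s i)) (index_enum_uniq _)) => i.
Qed.

Lemma smooth_det m n (U : set 'rV[R]_m) (A : 'rV[R]_m -> 'M[R]_n) : open U ->
  (forall i j, smooth_on U (fun x => A x i j)) -> smooth_on U (fun x => \det (A x)).
Proof.
move=> oU sA; apply: smooth_sum => // s _; apply: smoothM => //; first exact: smooth_cst.
exact: smooth_prod.
Qed.

Lemma smooth_cofactor m n (U : set 'rV[R]_m) (A : 'rV[R]_m -> 'M[R]_n) i j : open U ->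
  (forall i j, smooth_on U (fun x => A x i j)) -> smooth_on U (fun x => cofactor (A x) i j).
Proof.
move=> oU sA; apply: smoothM => //; first exact: smooth_cst.
apply: smooth_det => // a b.
by rewrite (_ : (fun x => _) = (fun x => A x (lift i a) (lift j b))) //; apply/funext => x; rewrite !mxE.
Qed.

(** Differentiating adj(A) A = det(A) and multiplying by the inverse expresses the derivatives of
    the cofactors through those of [A]. The divergence then splits into two sums exchanged by
    swapping [i] and [k], which is the symmetry assumed of the derivatives of [A]. *)
Lemma Piola n (U : set 'rV[R]_n) (A : 'rV[R]_n -> 'M[R]_n) (x : 'rV[R]_n) (j : 'I_n) :
  open U -> U x -> (forall i j, smooth_on U (fun x => A x i j)) ->
  (forall i k b, 'D_(bv i) (fun y => A y k b) x = 'D_(bv k) (fun y => A y i b) x) ->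
  \det (A x) != 0 ->
  \sum_i 'D_(bv i) (fun y => cofactor (A y) i j) x = 0.
Proof.
move=> oU Ux sA cA d0.
pose dA i k b := 'D_(bv i) (fun y => A y k b) x.
pose dC i l := 'D_(bv i) (fun y => cofactor (A y) l j) x.
pose W := invmx (A x).
have uA : A x \in unitmx by rewrite unitmxE unitfE.
have cofE k b : cofactor (A x) k b = \det (A x) * W b k.
  have := mul_mx_adj (A x) => /(congr1 (mulmx W)).
  rewrite mulmxA mulVmx // mul1mx => /matrixP/(_ b k).
  by rewrite mxE mul_mx_scalar mxE.
pose ddet i := \sum_k \sum_b dA i k b * cofactor (A x) k b.
have HdA i k b : is_derive x (bv i) (fun y => A y k b) (dA i k b).
  by apply: derivableP; exact: smooth_derivable (sA k b) Ux.
have HdC i l : is_derive x (bv i) (fun y => cofactor (A y) l j) (dC i l).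
  by apply: derivableP; exact: smooth_derivable (smooth_cofactor l j oU sA) Ux.
have eq1 i b : \sum_k (dC i k * A x k b + cofactor (A x) k j * dA i k b) = ddet i *+ (j == b).
  have D1 : is_derive x (bv i) (fun y => \sum_k cofactor (A y) k j * A y k b)
     (\sum_k (dC i k * A x k b + cofactor (A x) k j * dA i k b)).
    apply: is_derive_sumf => k _; apply: is_derive_eq (is_deriveM (HdC i k) (HdA i k b)) _.
    by rewrite /GRing.scale/= addrC [X in X + _ = _]mulrC.
  have D2 : is_derive x (bv i) (fun y => \sum_k cofactor (A y) k j * A y k b) (ddet i *+ (j == b)).
    have -> : (fun y => \sum_k cofactor (A y) k j * A y k b) = (fun y => \det (A y) *+ (j == b)).
      apply/funext => y; have := mul_adj_mx (A y) => /matrixP/(_ j b); rewrite !mxE => <-.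
      by apply: eq_bigr => k _; rewrite mxE.
    have Dd : is_derive x (bv i) (fun y => \det (A y)) (ddet i).
      by apply: is_derive_det => a c; exact: HdA.
    case: eqP => _; first exact: Dd.
    by rewrite mulr0n; under eq_fun do rewrite mulr0n; exact: is_derive_cst.
  by have [_ <-] := D1; have [_ <-] := D2.
(* Contracting [eq1] with column [i] of the inverse isolates the derivative of the cofactor of
   indices i, j. *)
have eq2 i : dC i i = \sum_b (ddet i *+ (j == b) - \sum_k cofactor (A x) k j * dA i k b) * W b i.
  under eq_bigr => b _ do rewrite -eq1 big_split /= addrK.
  under eq_bigr => b _ do rewrite mulr_suml.
  rewrite exchange_big /= (bigD1 i) //= [X in _ + X]big1 ?addr0 => [|k ki].
    under eq_bigr => b _ do rewrite -mulrA; rewrite -mulr_sumr.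
    have := mulmxV uA => /matrixP/(_ i i); rewrite !mxE eqxx => ->.
    by rewrite mulr1.
  under eq_bigr => b _ do rewrite -mulrA; rewrite -mulr_sumr.
  have := mulmxV uA => /matrixP/(_ k i); rewrite !mxE (negbTE ki) => ->.
  by rewrite mulr0.
transitivity (\sum_i dC i i) => //.
have eq3 i : dC i i = \sum_k \sum_b \det (A x) * (dA i k b * W b k * W j i) -
    \sum_k \sum_b \det (A x) * (W j k * dA i k b * W b i).
  rewrite eq2; under eq_bigr => b _ do rewrite mulrBl.
  rewrite sumrB; congr (_ - _).
    rewrite (bigD1 j) //= eqxx big1 ?addr0 => [|b bj]; last first.
      by rewrite eq_sym (negbTE bj) mulr0n mul0r.
    rewrite mulr1n mulr_suml; apply: eq_bigr => k _; rewrite mulr_suml; apply: eq_bigr => b _.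
    by rewrite cofE; ring.
  under eq_bigr => b _ do rewrite mulr_suml.
  rewrite [RHS]exchange_big /=; apply: eq_bigr => b _; apply: eq_bigr => k _.
  by rewrite cofE; ring.
rewrite (eq_bigr _ (fun i _ => eq3 i)) sumrB [X in _ - X]exchange_big /=.
apply/eqP; rewrite subr_eq0; apply/eqP; apply: eq_bigr => i _; apply: eq_bigr => k _.
apply: eq_bigr => b _; have -> : dA k i b = dA i k b by exact: cA.
by ring.
Qed.

End Determinant.

(** * Riemann sums *)

Section Lattice.
Context {R : realType} {n : nat}.
Implicit Types (F G : 'rV[R]_n -> R) (b N : nat).

Definition lpt N (k : {ffun 'I_n -> 'I_(2 * N ^ 2).+1}) : 'rV[R]_n :=
  \row_i ((k i)%:R / N%:R - N%:R).

(* Riemann sum over the points of (1/N)Z^n in the box [-N, N]^n. *)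
Definition lsum N F : R := (N%:R ^+ n)^-1 * \sum_k F (lpt (N := N) k).

Definition null F := lsum N F @[N --> \oo] --> 0.

Definition bsupp b F := forall x, b%:R < `|x| -> F x = 0.

Lemma lsumD N F G : lsum N (fun x => F x + G x) = lsum N F + lsum N G.
Proof. by rewrite /lsum big_split mulrDr. Qed.

Lemma lsumZ N c F : lsum N (fun x => c * F x) = c * lsum N F.
Proof. by rewrite /lsum -mulr_sumr mulrCA. Qed.

Lemma null_ext F G : (forall x, F x = G x) -> null F -> null G.
Proof. by move=> /funext ->. Qed.

Lemma nullD F G : null F -> null G -> null (fun x => F x + G x).
Proof.
move=> nF nG; rewrite /null; under eq_fun do rewrite lsumD.
by rewrite -[0](addr0 0); exact: cvgD.
Qed.

Lemma nullZ c F : null F -> null (fun x => c * F x).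
Proof.
move=> nF; rewrite /null; under eq_fun do rewrite lsumZ.
by rewrite -(mulr0 c); apply: cvgM => //; exact: cvg_cst.
Qed.

Lemma null0 : null (fun=> 0).
Proof.
rewrite /null; have -> : (fun N => lsum N (fun=> 0)) = fun=> 0.
  by apply/funext => N; rewrite /lsum big1 ?mulr0.
exact: cvg_cst.
Qed.

Lemma null_sum (I : Type) (r : seq I) (F : I -> 'rV[R]_n -> R) :
  (forall i, null (F i)) -> null (fun x => \sum_(i <- r) F i x).
Proof.
move=> nF; elim: r => [|i r IH].
  by apply: null_ext null0 => x; rewrite big_nil.
by apply: null_ext (nullD (nF i) IH) => x; rewrite big_cons.
Qed.

Lemma card_ord_itv (m lo d : nat) : (#|[pred i : 'I_m | lo <= i <= lo + d]| <= d.+1)%N.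
Proof.
pose A := [pred i : 'I_m | (lo <= i <= lo + d)%N].
have inj : {in A &, injective (fun i : 'I_m => inord (i - lo) : 'I_d.+1)}.
  move=> i j /andP[i1 i2] /andP[j1 j2] /(congr1 val); rewrite /= !inordK ?ltnS ?leq_subLR //.
  by move=> e; apply: val_inj; rewrite /= -(subnK i1) e subnK.
by rewrite -(card_in_imset inj) (leq_trans (max_card _)) // card_ord.
Qed.

(** The admissible indices fill a window of at most 2bN + 1 integers starting at N^2 - bN, which is
    0 by truncated subtraction when [b] exceeds [N]. *)
Lemma lpt_coord N b (q : nat) : (0 < N)%N -> `|q%:R / N%:R - N%:R| <= b%:R :> R ->
  (N ^ 2 - b * N <= q <= (N ^ 2 - b * N) + 2 * b * N)%N.
Proof.
move=> N0; have N0' : 0 < N%:R :> R by rewrite ltr0n.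
rewrite ler_norml => /andP[h1 h2].
have e : q%:R = q%:R / N%:R * N%:R :> R by rewrite divfK // gt_eqF.
have h3 : (N ^ 2 <= q + b * N)%N.
  by rewrite -(ler_nat R) natrD natrM natrX e; nra.
have h4 : (q <= N ^ 2 + b * N)%N.
  by rewrite -(ler_nat R) natrD natrM natrX e; nra.
rewrite leq_subLR addnC h3 /= (leq_trans h4) //.
have [|/ltnW] := leqP (b * N) (N ^ 2) => [h|h].
  by rewrite -{1}(subnK h) -!addnA leq_add2l -mulnA mul2n -addnn.
by rewrite (leq_trans _ (leq_addl _ _)) // -mulnA mul2n -addnn leq_add2r.
Qed.

Lemma lpt_norm N b (k : {ffun 'I_n -> 'I_(2 * N ^ 2).+1}) i : (0 < N)%N ->
  `|lpt k| <= b%:R -> (N ^ 2 - b * N <= k i <= (N ^ 2 - b * N) + 2 * b * N)%N.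
Proof.
move=> N0 kb; apply: lpt_coord => //.
by apply: le_trans kb; have := coord_le_norm (lpt k) i; rewrite mxE.
Qed.

(** At most (2bN + 1)^n lattice points meet the support, and 2bN + 1 <= (2b + 1) N; after division
    by N^n the bound no longer depends on [N]. *)
Lemma lsum_bound N b F c : (0 < N)%N -> bsupp b F -> 0 <= c -> (forall x, `|F x| <= c) ->
  `|lsum N F| <= (2 * b).+1%:R ^+ n * c.
Proof.
move=> N0 bF c0 Fc; have N0' : 0 < N%:R :> R by rewrite ltr0n.
pose A := [pred i : 'I_(2 * N ^ 2).+1 | (N ^ 2 - b * N <= i <= (N ^ 2 - b * N) + 2 * b * N)%N].
have cA : (#|A| <= (2 * b).+1 * N)%N.
  by apply: leq_trans (card_ord_itv _ _ _) _; rewrite mulSn -addn1 addnC leq_add2r.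
rewrite /lsum normrM normfV normrX normr_nat.
rewrite ler_pdivrMl ?exprn_gt0 //.
have -> : \sum_k F (lpt (N := N) k) = \sum_(k in ffun_on A) F (lpt (N := N) k).
  rewrite (bigID (mem (ffun_on A))) /= [X in _ + X]big1 ?addr0 // => k.
  move=> /ffun_onP kA; apply: bF; rewrite ltNge; apply/negP => kb; apply: kA => i.
  exact: lpt_norm kb.
apply: le_trans (ler_norm_sum _ _ _) _.
apply: (@le_trans _ _ (\sum_(k in ffun_on A : pred {ffun 'I_n -> 'I_(2 * N ^ 2).+1}) c)).
  by apply: ler_sum.
rewrite sumr_const card_ffun_on card_ord -[leLHS]mulr_natl mulrA -exprMn.
rewrite ler_wpM2r // natrX lerXn2r ?nnegrE ?mulr_ge0 //.
by rewrite -natrM ler_nat (leq_trans cA) // mulnC.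
Qed.

(** As [lsum_bound] is uniform in [N], uniform approximation within a common support passes to the
    limit of the sums. *)
Lemma null_unif b F : bsupp b F ->
  (forall e, 0 < e -> exists G, [/\ null G, bsupp b G & forall x, `|F x - G x| <= e]) ->
  null F.
Proof.
move=> bF H; apply/cvgr0Pnorm_le => e e0.
have c0 : 0 < (2 * b).+1%:R ^+ n :> R by rewrite exprn_gt0.
have e1 : 0 < e / 2 / (2 * b).+1%:R ^+ n by rewrite !divr_gt0.
have [G [nG bG FG]] := H _ e1.
have e20 : 0 < e / 2 by rewrite divr_gt0.
move/cvgr0Pnorm_le : nG => /(_ _ e20) nG.
near=> N.
have N0 : (0 < N)%N by near: N; exact: nbhs_infty_gt.
have -> : lsum N F = lsum N G + lsum N (fun x => F x - G x).
  by rewrite -lsumD; congr lsum; apply/funext => x; rewrite addrC subrK.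
rewrite (le_trans (ler_normD _ _)) // [leRHS]splitr lerD //; first by near: N.
have bFG : bsupp b (fun x => F x - G x).
  by move=> x bx; rewrite (bF x bx) (bG x bx) subrr.
apply: le_trans (lsum_bound N0 bFG (ltW e1) FG) _.
by rewrite [leLHS]mulrC divfK // gt_eqF.
Unshelve. all: by end_near. Qed.

(** The translation by one lattice step is realised as the cyclic shift of index [j], a bijection of
    the box. *)
Lemma lsum_shift N b F j : bsupp b F -> (b < N)%N ->
  lsum N (fun x => F (x + N%:R^-1 *: bv j)) = lsum N F.
Proof.
move=> bF bN; have N0 : (0 < N)%N by exact: leq_trans bN.
have N0' : N%:R != 0 :> R by rewrite pnatr_eq0 -lt0n.
rewrite /lsum; congr (_ * _).
pose m := (2 * N ^ 2)%N.
pose sh (f : 'I_m.+1 -> 'I_m.+1) (k : {ffun 'I_n -> 'I_m.+1}) : {ffun 'I_n -> 'I_m.+1} :=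
  [ffun i => if i == j then f (k i) else k i].
have shK : cancel (sh (@ordS m.+1)) (sh (@ord_pred m.+1)).
  by move=> k; apply/ffunP => i; rewrite !ffunE; case: eqP => // _; rewrite ordSK.
have shK' : cancel (sh (@ord_pred m.+1)) (sh (@ordS m.+1)).
  by move=> k; apply/ffunP => i; rewrite !ffunE; case: eqP => // _; rewrite ord_predK.
rewrite [RHS](reindex (sh (@ordS m.+1))); last by exists (sh (@ord_pred m.+1)) => k _.
apply: eq_bigr => k _.
have [km|km] := ltnP (k j) m.
  congr F; apply/rowP => i; rewrite !mxE eqxx !ffunE /=.
  case: (eqVneq i j) => [->|_]; last by rewrite mulr0 addr0.
  by rewrite /= modn_small ?ltnS // -[(k j).+1%:R]natr1 mulrDl mul1r mulr1 addrAC.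
(* The last index wraps around: the two values compared sit at coordinates N + 1/N and -N, both
   beyond the support because b < N. *)
have kjm : k j = m :> nat by apply/eqP; rewrite eqn_leq km -ltnS ltn_ord.
have bN' : b%:R < N%:R :> R by rewrite ltr_nat.
rewrite !bF //.
  apply: lt_le_trans (coord_le_norm _ j); rewrite !mxE !ffunE eqxx /= kjm modnn mul0r sub0r.
  by rewrite normrN ger0_norm.
apply: lt_le_trans (coord_le_norm _ j); rewrite !mxE !eqxx /= kjm mulr1.
have -> : m%:R / N%:R = N%:R + N%:R :> R by rewrite /m natrM natrX; field.
have iN : 0 < N%:R^-1 :> R by rewrite invr_gt0 ltr0n.
have N0r : 0 < N%:R :> R by rewrite ltr0n.
by rewrite ger0_norm; lra.
Qed.

End Lattice.

Section MatrixLimits.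
Context {R : realType} (T : Type) (F : set_system T) (FF : Filter F).

Lemma cvg_prodf (I : Type) (r : seq I) (f : I -> T -> R) (l : I -> R) :
  (forall i, f i x @[x --> F] --> l i) ->
  \prod_(i <- r) f i x @[x --> F] --> \prod_(i <- r) l i.
Proof.
move=> H; elim: r => [|i r IH].
  by rewrite big_nil; under eq_fun do rewrite big_nil; exact: cvg_cst.
by rewrite big_cons; under eq_fun do rewrite big_cons; apply: cvgM.
Qed.

Lemma cvg_det n (A : T -> 'M[R]_n) (L : 'M[R]_n) :
  (forall i j, A x i j @[x --> F] --> L i j) -> \det (A x) @[x --> F] --> \det L.
Proof.
move=> H; apply: cvg_sum => s _; apply: cvgM; first exact: cvg_cst.
exact: cvg_prodf.
Qed.

Lemma cvg_cofactor n (A : T -> 'M[R]_n) (L : 'M[R]_n) i j :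
  (forall i j, A x i j @[x --> F] --> L i j) ->
  cofactor (A x) i j @[x --> F] --> cofactor L i j.
Proof.
move=> H; apply: cvgM; first exact: cvg_cst.
apply: cvg_det => a b; rewrite !mxE.
by under eq_fun do rewrite !mxE; exact: H.
Qed.

End MatrixLimits.

Section DerivativesAreNull.
Context {R : realType} {n : nat}.
Implicit Types (F G : 'rV[R]_n -> R) (b N : nat).

Lemma rV_ball_compact (r : R) : compact [set x : 'rV[R]_n | `|x| <= r].
Proof.
apply: bounded_closed_compact.
  exists r; split; first exact: num_real.
  by move=> M rM x /= xr; exact: le_trans xr (ltW rM).
apply: (@preimage_closed _ _ (fun x : 'rV[R]_n => `|x|) [set y | y <= r]).
  by move=> x _; exact: norm_continuous.
exact: closed_le.
Qed.

(** Compactness gives uniformity on the ball of radius b + 1; outside it, a step shorter than 1 does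
    not reach the support. *)
Lemma unif_line F b (v : 'rV[R]_n) : continuous F -> bsupp b F -> `|v| <= 1 ->
  forall e, 0 < e -> exists2 d : R, 0 < d & forall x h, `|h| < d -> `|F (x + h *: v) - F x| <= e.
Proof.
move=> cF bF v1 e e0.
have /compact_near_coveringP := @rV_ball_compact b.+1%:R.
move=> /(_ _ (nbhs (0 : R)) (fun h x => `|F (x + h *: v) - F x| < e) _) H.
have /nbhs_ballP[d /= d0 Bd] : nbhs (0 : R) (fun h => [set x : 'rV[R]_n | `|x| <= b.+1%:R] `<=`
    (fun x => `|F (x + h *: v) - F x| < e)).
  apply: H => x _; have e20 : 0 < e / 2 by rewrite divr_gt0.
  have cl : {for (x, 0), continuous (fun p : 'rV[R]_n * R => F (p.1 + p.2 *: v))}.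
    apply: (cvg_comp (fun p : 'rV[R]_n * R => p.1 + p.2 *: v) F).
      apply: (@cvgD _ _ _ (nbhs (x, (0 : R))) _ fst (fun p : 'rV[R]_n * R => p.2 *: v) x (0 *: v)).
        exact: cvg_fst.
      by apply: cvgZr_tmp; exact: cvg_snd.
    by rewrite scale0r addr0; exact: cF.
  have := cl; rewrite /prop_for /continuous_at /= scale0r addr0.
  move=> /cvgrPdist_lt /(_ _ e20) [[A B] /= [nA nB] AB].
  exists (A, B) => // -[y h] /= [Ay Bh].
  have h1 := AB (y, h) (conj Ay Bh); have h2 := AB (y, 0) (conj Ay (nbhs_singleton nB)).
  rewrite /= in h1 h2; rewrite scale0r addr0 in h2; rewrite -(subrKA (F x)).
  by rewrite (le_lt_trans (ler_normD _ _)) // [ltRHS]splitr ltrD // distrC.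
exists (Num.min d 1); first by rewrite lt_min d0 ltr01.
move=> x h; rewrite lt_min => /andP[hd h1].
have [xb|xb] := leP `|x| b.+1%:R.
  by apply/ltW/Bd => //; rewrite -ball_normE /= sub0r normrN.
have hv : `|h *: v| <= 1.
  by rewrite normrZ -[leRHS]mulr1 ler_pM // ltW.
rewrite !bF ?subrr ?normr0 ?ltW //; first by apply: lt_trans xb; rewrite ltr_nat.
have := ler_normB (x + h *: v) (h *: v); rewrite addrK => hx.
move: xb hx hv; rewrite -natr1; lra.
Qed.

(** The difference quotient with step 1/N has Riemann sum exactly 0 by [lsum_shift], and it
    approximates the derivative uniformly, so the sums of the error [E] tend to 0. *)
Lemma null_derive b F j : smooth_on setT F -> bsupp b F -> null ('D_(bv j) F).
Proof.
move=> sF bF.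
have nbv : `|bv j : 'rV[R]_n| <= 1.
  by apply: rV_norm_le => // i; rewrite mxE eqxx /=; case: eqP; rewrite ?normr1 ?normr0.
have bD : bsupp b ('D_(bv j) F).
  move=> x bx; rewrite -[RHS](derive_cst 0 x (bv j)); apply: near_eq_derive.
  have : \forall y \near x, b%:R < `|y| by exact: (cvgr_gt _ (@norm_continuous _ _ x)).
  by apply: near_mono => y /bF.
have cD : continuous ('D_(bv j) F).
  by move=> x; apply: (smooth_cont (smooth_derive j sF)).
apply/cvgr0Pnorm_le => e e0.
have c0 : 0 < (2 * b.+1).+1%:R ^+ n :> R by rewrite exprn_gt0.
have e1 : 0 < e / (2 * b.+1).+1%:R ^+ n by rewrite divr_gt0.
have [d d0 Hd] := unif_line cD bD nbv e1.
near=> N.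
have N0 : (0 < N)%N by near: N; exact: nbhs_infty_gt.
have bN : (b < N)%N by near: N; exact: nbhs_infty_gt.
have N0' : 0 < N%:R :> R by rewrite ltr0n.
have Nd : N%:R^-1 < d.
  rewrite invf_plt ?posrE //; near: N; exact: nbhs_infty_gtr.
have N1 : N%:R^-1 <= 1 :> R by rewrite invf_le1 // ler1n.
pose E x := 'D_(bv j) F x - N%:R * (F (x + N%:R^-1 *: bv j) - F x).
have -> : lsum N ('D_(bv j) F) = lsum N E.
  rewrite /E; have -> : (fun x => 'D_(bv j) F x - N%:R * (F (x + N%:R^-1 *: bv j) - F x)) =
     (fun x => 'D_(bv j) F x + - N%:R * (F (x + N%:R^-1 *: bv j) + -1 * F x)).
    by apply/funext => x; rewrite mulN1r mulNr.
  rewrite lsumD lsumZ lsumD lsumZ (lsum_shift _ bF bN).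
  by rewrite mulN1r subrr mulr0 addr0.
have bE : bsupp b.+1 E.
  move=> x bx; rewrite /E bD; last by apply: lt_trans bx; rewrite ltr_nat.
  have hv : `|N%:R^-1 *: bv j : 'rV[R]_n| <= 1.
    by rewrite normrZ -[leRHS]mulr1 ler_pM // ger0_norm // invr_ge0 ltW.
  rewrite !bF ?subrr ?mulr0 ?subrr //; first by apply: lt_trans bx; rewrite ltr_nat.
  have := ler_normB (x + N%:R^-1 *: bv j) (N%:R^-1 *: bv j); rewrite addrK => hx.
  move: bx hx hv; rewrite -natr1; lra.
apply: le_trans (lsum_bound N0 bE (ltW e1) _) _; last first.
  by rewrite [leLHS]mulrC divfK // gt_eqF.
move=> x; rewrite /E.
have [s sN ->] := @MVT_line _ _ F x (bv j) N%:R^-1 (fun s _ => smooth_derivable sF I).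
rewrite mulVKf ?gt_eqF // distrC; apply: Hd.
by rewrite (le_lt_trans sN) // ger0_norm // invr_ge0 ltW.
Unshelve. all: by end_near. Qed.

End DerivativesAreNull.

Section PointwiseRules.
Context {R : realType} {V : normedModType R}.
Implicit Types (f g : V -> R).

Lemma is_derive_addf f g x v a b : is_derive x v f a -> is_derive x v g b ->
  is_derive x v (fun y => f y + g y) (a + b).
Proof. by move=> Df Dg; exact: is_deriveD. Qed.

Lemma is_derive_mulf f g x v a b : is_derive x v f a -> is_derive x v g b ->
  is_derive x v (fun y => f y * g y) (f x * b + g x * a).
Proof. by move=> Df Dg; exact: is_deriveM. Qed.

End PointwiseRules.

(** * Change of variables *)

Section Homotopy.
Context {R : realType} {n : nat}.

Definition jac (u : 'rV[R]_n -> 'rV[R]_n) (x : 'rV[R]_n) : 'M[R]_n :=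
  \matrix_(i, j) 'D_(bv i) (fun y => u y 0 j) x.

(** [u] is the displacement in the deformation x + t u(x). The closed set [C] carries [F], and the
    compact set [K] traps every preimage of [C] during the deformation, so [F] composed with the
    deformed map vanishes on [W] outside [K]. *)
Variables (W K C : set 'rV[R]_n) (u : 'rV[R]_n -> 'rV[R]_n) (F : 'rV[R]_n -> R) (b : nat).
Hypothesis oW : open W.
Hypothesis su : forall j, smooth_on W (fun x => u x 0 j).
Hypothesis sF : smooth_on setT F.
Hypothesis cC : closed C.
Hypothesis FC : forall y, ~ C y -> F y = 0.
Hypothesis cK : compact K.
Hypothesis KW : K `<=` W.
Hypothesis Kb : forall x, K x -> `|x| <= b%:R.
Hypothesis CK : forall x t, W x -> 0 <= t <= 1 -> C (x + t *: u x) -> K x.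
Hypothesis det0 : forall x t, W x -> 0 <= t <= 1 -> \det (1%:M + t *: jac u x) != 0.

Let phi t x := x + t *: u x.
Let A t x : 'M[R]_n := 1%:M + t *: jac u x.
(** The flux whose divergence is [dG], the derivative in [t] of F(phi) det(A). *)
Let V t i x := F (phi t x) * \sum_j u x 0 j * cofactor (A t x) i j.
Let dG t x := (\sum_j 'D_(bv j) F (phi t x) * u x 0 j) * \det (A t x) +
  F (phi t x) * \sum_i \sum_j jac u x i j * cofactor (A t x) i j.

Let smooth_phi t j : smooth_on W (fun x => phi t x 0 j).
Proof.
apply: (smooth_ext oW (f := fun x => x 0 j + t * u x 0 j)) => [x _|]; first by rewrite !mxE.
apply: smoothD => //; first exact: smooth_coord.
by apply: smoothM => //; exact: smooth_cst.
Qed.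

Let smooth_jac i j : smooth_on W (fun x => jac u x i j).
Proof.
by apply: (smooth_ext oW _ (smooth_derive i (su j))) => x _; rewrite mxE.
Qed.

Let smooth_A t i j : smooth_on W (fun x => A t x i j).
Proof.
apply: (smooth_ext oW (f := fun x => (i == j)%:R + t * jac u x i j)) => [x _|].
  by rewrite !mxE.
apply: smoothD => //; first exact: smooth_cst.
by apply: smoothM => //; exact: smooth_cst.
Qed.

Let smooth_Fphi t : smooth_on W (fun x => F (phi t x)).
Proof. exact: (smooth_comp oW openT _ (smooth_phi t) sF). Qed.

Let smooth_Q t i : smooth_on W (fun x => \sum_j u x 0 j * cofactor (A t x) i j).
Proof.
apply: smooth_sum oW _ => j _; apply: (smoothM oW (su j)).
exact: (smooth_cofactor i j oW (smooth_A t)).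
Qed.

Let smooth_V t i : smooth_on W (V t i).
Proof. by apply: smoothM. Qed.

Let Dju x i j : W x -> is_derive x (bv i) (fun y => u y 0 j) (jac u x i j).
Proof. by move=> Wx; rewrite mxE; apply: derivableP; exact: smooth_derivable (su j) Wx. Qed.

Let phi_jac t x i j : W x -> 'D_(bv i) (fun y => phi t y 0 j) x = A t x i j.
Proof.
move=> Wx; have D : is_derive x (bv i) (fun y => y 0 j + t * u y 0 j)
    (bv i 0 j + t * jac u x i j).
  apply: is_deriveD; first exact: is_derive_coord.
  by apply: is_deriveZ; exact: Dju.
have -> : (fun y => phi t y 0 j) = (fun y => y 0 j + t * u y 0 j).
  by apply/funext => y; rewrite !mxE.
by have [_ ->] := D; rewrite !mxE eqxx /= eq_sym.
Qed.

Let deriv_Fphi t x i : W x ->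
  is_derive x (bv i) (fun y => F (phi t y)) (\sum_j 'D_(bv j) F (phi t x) * A t x i j).
Proof.
move=> Wx; have /smooth_onP sF1 := sF.
have := @is_derive_chain _ n n W setT (phi t) F x (bv i) oW openT Wx I _ (sF1 1%N).
move=> H; have {}H := H (fun j => smooth_derivable (smooth_phi t j) Wx).
by apply: is_derive_eq H _; apply: eq_bigr => j _; rewrite phi_jac.
Qed.

(** The derivatives of the cofactors cancel by [Piola]; those of [F] combine with the cofactors into
    det(A), and those of [u] give the sum in Jacobi's formula. *)
Let div_V t x : W x -> 0 <= t <= 1 -> \sum_i 'D_(bv i) (V t i) x = dG t x.
Proof.
move=> Wx t01.
pose dQ i := \sum_j (u x 0 j * 'D_(bv i) (fun y => cofactor (A t y) i j) x +
    cofactor (A t x) i j * jac u x i j).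
have DQ i : is_derive x (bv i) (fun y => \sum_j u y 0 j * cofactor (A t y) i j) (dQ i).
  apply: is_derive_sumf => j _; apply: is_deriveM; last first.
    apply: derivableP; apply: smooth_derivable Wx.
    exact: (smooth_cofactor i j oW (smooth_A t)).
  exact: Dju.
have E i : 'D_(bv i) (V t i) x = F (phi t x) * dQ i +
   (\sum_j u x 0 j * cofactor (A t x) i j) * (\sum_j 'D_(bv j) F (phi t x) * A t x i j).
  by have [_ ->] := is_deriveM (deriv_Fphi t i Wx) (DQ i).
rewrite (eq_bigr _ (fun i _ => E i)) big_split /= -mulr_sumr addrC /dG; congr (_ + _ * _).
  rewrite mulr_suml.
  under eq_bigr => i _ do rewrite mulr_sumr.
  rewrite exchange_big /=; apply: eq_bigr => k _.
  under eq_bigr => i _ do rewrite mulr_suml.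
  rewrite exchange_big /=.
  transitivity (\sum_j u x 0 j * 'D_(bv k) F (phi t x) * (\det (A t x) *+ (j == k))).
    apply: eq_bigr => j _; have := mul_adj_mx (A t x) => /matrixP/(_ j k).
    rewrite !mxE => <-; rewrite mulr_sumr; apply: eq_bigr => i _.
    by rewrite !mxE; ring.
  rewrite (bigD1 k) //= eqxx big1 ?addr0 => [|j jk].
    by rewrite mulr1n; ring.
  by rewrite (negbTE jk) mulr0n mulr0.
rewrite /dQ; under eq_bigr => i _ do rewrite big_split /=.
rewrite big_split /= [X in X + _]exchange_big /= [X in X + _]big1 ?add0r => [|j _].
  by apply: eq_bigr => i _; apply: eq_bigr => j _; rewrite mulrC.
rewrite -mulr_sumr; apply/eqP; rewrite mulf_eq0; apply/orP; right; apply/eqP.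
apply: (@Piola _ _ W (A t) x j oW Wx (smooth_A t) _ (det0 Wx t01)) => i k c.
(* Up to the factor [t] these are second derivatives of [u], so the symmetry required by [Piola]
   comes from [Schwarz]. *)
have dA i' k' : 'D_(bv i') (fun y => A t y k' c) x = t * 'D_(bv i') ('D_(bv k') (fun y => u y 0 c)) x.
  have D : is_derive x (bv i') (fun y => (k' == c)%:R + t * jac u y k' c)
     (0 + t * 'D_(bv i') (fun y => jac u y k' c) x).
    apply: is_derive_addf.
    by apply: is_deriveZ; apply: derivableP; exact: smooth_derivable (smooth_jac k' c) Wx.
  have -> : (fun y => A t y k' c) = (fun y => (k' == c)%:R + t * jac u y k' c).
    by apply/funext => y; rewrite !mxE.
  have <- : (fun y => jac u y k' c) = 'D_(bv k') (fun y => u y 0 c).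
    by apply/funext => y; rewrite mxE.
  by have [_ ->] := D; rewrite add0r.
have /smooth_onP/(_ 2%N) S2 := su c.
by rewrite !dA (Schwarz i k oW Wx S2).
Qed.

Let time_derive (t : R) x : W x ->
  is_derive t 1 (fun t => F (phi t x) * \det (A t x)) (dG t x).
Proof.
move=> Wx.
have D1 : is_derive t 1 (fun t => F (phi t x)) (\sum_j 'D_(bv j) F (phi t x) * u x 0 j).
  apply: (@is_derive_comp_rV _ _ _ (fun t => phi t x) F).
  - have := is_derive_line (@derivable_id R _ (x + t *: u x) (u x)).
    by rewrite (@derive_id R).
  - by apply: (near_open openT) => // y _ j; exact: smooth_derivable sF I.
  - by move=> j; exact: smooth_cont (smooth_derive j sF) I.
have D2 : is_derive t 1 (fun t => \det (A t x)) (\sum_i \sum_j jac u x i j * cofactor (A t x) i j).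
  apply: is_derive_det => i j.
  have -> : (fun t => A t x i j) = (fun t : R => (i == j)%:R + jac u x i j * t).
    by apply/funext => s; rewrite !mxE mulrC.
  have D := is_deriveZ (jac u x i j) (is_derive_id t 1).
  apply: is_derive_eq (is_derive_addf (is_derive_cst ((i == j)%:R : R) t 1) D) _.
  by rewrite add0r [_ *: 1]mulr1.
apply: is_derive_eq (is_deriveM D1 D2) _.
by rewrite /GRing.scale/= /dG addrC; congr (_ + _); rewrite mulrC.
Qed.

Let dG_cont t x : W x -> {for (t, x), continuous (fun p => dG p.1 p.2)}.
Proof.
move=> Wx.
have cu j : (fun p : R * 'rV[R]_n => u p.2 0 j) p @[p --> (t, x)] --> u x 0 j.
  apply: (cvg_comp snd (fun x => u x 0 j)); first exact: cvg_snd.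
  exact: (smooth_cont (su j) Wx).
have cphi : phi p.1 p.2 @[p --> (t, x)] --> phi t x.
  have cj j : phi p.1 p.2 0 j @[p --> (t, x)] --> phi t x 0 j.
    have -> : (fun p : R * 'rV[R]_n => phi p.1 p.2 0 j) = (fun p => p.2 0 j + p.1 * u p.2 0 j).
      by apply/funext => p; rewrite !mxE.
    have -> : phi t x 0 j = x 0 j + t * u x 0 j by rewrite !mxE.
    apply: cvgD.
      apply: (cvg_comp snd (fun x : 'rV[R]_n => x 0 j)); first exact: cvg_snd.
      exact: coord_continuous.
    by apply: cvgM => //; exact: cvg_fst.
  apply/cvgrPdist_lt => e e0.
  have H j : \forall p \near (t, x), `|phi t x 0 j - phi p.1 p.2 0 j| < e.
    by have /cvgrPdist_lt := cj j; apply.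
  have := filter_forall (nbhs_filter (t, x)) H.
  by apply: near_mono => p Hp; apply: rV_norm_lt => // j; have := Hp j; rewrite !mxE.
have cjac i j : jac u p.2 i j @[p --> (t, x)] --> jac u x i j.
  apply: (cvg_comp snd (fun x => jac u x i j)); first exact: cvg_snd.
  exact: (smooth_cont (smooth_jac i j) Wx).
have cA i j : A p.1 p.2 i j @[p --> (t, x)] --> A t x i j.
  have -> : (fun p : R * 'rV[R]_n => A p.1 p.2 i j) = (fun p => (i == j)%:R + p.1 * jac u p.2 i j).
    by apply/funext => p; rewrite !mxE.
  have -> : A t x i j = (i == j)%:R + t * jac u x i j by rewrite !mxE.
  apply: cvgD; first exact: cvg_cst.
  by apply: cvgM => //; exact: cvg_fst.
apply: cvgD.
  apply: cvgM; last exact: cvg_det.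
  apply: cvg_sum => j _; apply: cvgM => //.
  apply: (cvg_comp (fun p => phi p.1 p.2) ('D_(bv j) F) cphi).
  by have := @smooth_cont _ _ setT _ (phi t x) (smooth_derive j sF) I; apply.
apply: cvgM.
  apply: (cvg_comp (fun p => phi p.1 p.2) F cphi).
  by have := @smooth_cont _ _ setT _ (phi t x) sF I; apply.
by apply: cvg_sum => i _; apply: cvg_sum => j _; apply: cvgM => //; exact: cvg_cofactor.
Qed.

Let F_out t x : W x -> ~ K x -> 0 <= t <= 1 -> \forall y \near phi t x, F y = 0.
Proof.
move=> Wx Kx t01; have nC : ~ C (phi t x) by move=> /(CK Wx t01).
have : open (~` C) by rewrite openC.
by move=> oC; apply: (near_open oC nC).
Qed.

Let F0 t x : W x -> ~ K x -> 0 <= t <= 1 -> F (phi t x) = 0.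
Proof. by move=> Wx Kx t01; have /nbhs_singleton := F_out Wx Kx t01. Qed.

Let dG0 t x : W x -> ~ K x -> 0 <= t <= 1 -> dG t x = 0.
Proof.
move=> Wx Kx t01; rewrite /dG F0 // mul0r addr0 big1 ?mul0r // => j _.
by rewrite (near_eq_derive _ (F_out Wx Kx t01)) derive_cst mul0r.
Qed.

Let ext (f : 'rV[R]_n -> R) x := if `[< W x >] then f x else 0.

Let extW f x : W x -> ext f x = f x.
Proof. by move=> Wx; rewrite /ext asboolT. Qed.

Let oKc : open (~` K).
Proof. by rewrite openC; apply: compact_closed => //; exact: norm_hausdorff. Qed.

Let ext_out f x : (forall x, W x -> ~ K x -> f x = 0) -> ~ K x -> ext f x = 0.
Proof. by move=> f0 Kx; rewrite /ext; case: asboolP => // Wx; exact: f0. Qed.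

Let null_dG t : 0 <= t <= 1 -> null (ext (dG t)).
Proof.
move=> t01.
have V0 i x : W x -> ~ K x -> V t i x = 0.
  by move=> Wx Kx; rewrite /V F0 // mul0r.
have sV i : smooth_on setT (ext (V t i)).
  apply: smooth_local => x _; have [Wx|Wx] := pselect (W x).
    exists W => //; apply: (smooth_ext oW _ (smooth_V t i)) => y Wy.
    by rewrite extW.
  exists (~` K); first by move=> /KW.
  apply: (smooth_ext oKc (f := fun=> 0)) => [y Ky|]; last exact: smooth_cst.
  by rewrite ext_out //; exact: V0.
have bV i : bsupp b (ext (V t i)).
  move=> x bx; apply: ext_out; first exact: V0.
  by move=> /Kb; rewrite leNgt bx.
apply: null_ext (null_sum (index_enum 'I_n) (fun i => null_derive i (sV i) (bV i))) => x.
have [Wx|Wx] := pselect (W x).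
  rewrite extW // -div_V //; apply: eq_bigr => i _; apply: near_eq_derive.
  by apply: (near_open oW Wx) => y Wy; rewrite extW.
rewrite /ext asboolF // big1 // => i _.
rewrite -[RHS](derive_cst 0 x (bv i)); apply: near_eq_derive.
have Kx : ~ K x by move=> /KW.
by apply: (near_open oKc Kx) => y Ky; apply: ext_out Ky; exact: V0.
Qed.

Let dG_unif e : 0 < e -> exists2 d : R, 0 < d &
  forall x t s, K x -> 0 <= t <= 1 -> 0 <= s <= 1 -> `|s - t| < d -> `|dG s x - dG t x| <= e.
Proof.
move=> e0.
have cA := compact_setX (@segment_compact R 0 1) cK.
have /compact_near_coveringP := cA.
move=> /(_ _ (nbhs (0 : R)) (fun d p => forall s, `|s - p.1| < d -> `|dG s p.2 - dG p.1 p.2| < e) _) H.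
have /nbhs_ballP[d /= d0 Bd] : nbhs (0 : R) (fun d => (`[0, 1] `*` K)%classic `<=`
    (fun p => forall s, `|s - p.1| < d -> `|dG s p.2 - dG p.1 p.2| < e)).
  apply: H => -[t x] [/= t01 Kx]; have e20 : 0 < e / 2 by rewrite divr_gt0.
  have := @dG_cont t x (KW Kx); rewrite /prop_for /continuous_at.
  move=> /cvgrPdist_lt /(_ _ e20) [[P Q] /= [/nbhs_ballP[r /= r0 rP] nQ] PQ].
  have r20 : 0 < r / 2 by rewrite divr_gt0.
  exists ([set p : R * 'rV[R]_n | ball t (r / 2) p.1 /\ Q p.2], ball (0 : R) (r / 2)).
    split; last exact: nbhsx_ballx.
    exists (ball t (r / 2), Q); first by split => //=; exact: nbhsx_ballx.
    by move=> -[t' x'] [].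
  move=> [[t' x'] d] /= [[tt' Qx'] dr] s st'.
  have dr' : d < r / 2.
    by move: dr; rewrite -ball_normE /= sub0r normrN => /(le_lt_trans (ler_norm _)).
  have Ps : P s.
    apply: rP; move: tt'; rewrite -!ball_normE /= => tt'.
    rewrite -(subrKA t') (le_lt_trans (ler_normD _ _)) // [ltRHS]splitr ltrD //.
    by rewrite distrC (lt_trans st').
  have Pt' : P t'.
    by apply: rP; move: tt'; rewrite -!ball_normE /= => /lt_trans; apply; lra.
  have h1 := PQ (s, x') (conj Ps Qx'); have h2 := PQ (t', x') (conj Pt' Qx').
  rewrite /= in h1 h2; rewrite -(subrKA (dG t x)).
  apply: le_lt_trans (ler_normD _ _) _; rewrite (splitr e); apply: ltrD; last exact: h2.
  rewrite distrC; exact: h1.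
exists (d / 2); first by rewrite divr_gt0.
move=> x t s Kx t01 s01 st; apply/ltW.
have db : ball (0 : R) d (d / 2) by rewrite -ball_normE /= sub0r normrN ger0_norm; lra.
have Atx : (`[0, 1] `*` K)%classic (t, x) by split.
exact: (Bd _ db _ Atx s st).
Qed.

(** The difference between times 1 and 0 is approximated uniformly by a Riemann sum in [t] of the
    null functions [dG t]. [null_unif] then concludes, without exchanging an integral in [t] with
    the lattice sums. *)
Lemma null_homotopy :
  null (fun x => if `[< W x >] then F (x + u x) * \det (1%:M + jac u x) - F x else 0).
Proof.
pose g t x := F (phi t x) * \det (A t x).
have g1 x : g 1 x = F (x + u x) * \det (1%:M + jac u x) by rewrite /g /phi /A !scale1r.
have g0 x : g 0 x = F x by rewrite /g /phi /A !scale0r !addr0 det1 mulr1.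
rewrite -/(ext _).
apply: (@null_unif _ _ b) => [x bx|e e0].
  have Kx : ~ K x by move=> /Kb; rewrite leNgt bx.
  apply: ext_out Kx => y Wy Ky; rewrite -g1 -g0 /g !F0 ?mul0r ?subrr //; lra.
have [d d0 Hd] := dG_unif e0.
(* The number of time steps: 1/m < d keeps [dG] within [e] of its value at the start of each
   step. *)
pose m := Num.bound d^-1.
have md : d^-1 < m%:R by apply: archi_boundP; rewrite invr_ge0 ltW.
have m0 : 0 < m%:R :> R by apply: lt_trans md; rewrite invr_gt0.
have mi : m%:R^-1 < d by rewrite invf_plt ?posrE.
have k01 (k : nat) : (k <= m)%N -> 0 <= (k%:R / m%:R : R) <= 1.
  by move=> km; rewrite divr_ge0 ?ler0n //= ler_pdivrMr // mul1r ler_nat.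
exists (fun x => \sum_(k < m) m%:R^-1 * ext (dG (k%:R / m%:R)) x); split.
- apply: null_sum => k; apply: nullZ; apply: null_dG; exact/k01/ltnW.
- move=> x bx; rewrite big1 // => k _; have Kx : ~ K x by move=> /Kb; rewrite leNgt bx.
  rewrite ext_out ?mulr0 // => y Wy Ky; apply: dG0 => //; exact/k01/ltnW.
- move=> x; have [Kx|Kx] := pselect (K x); last first.
    rewrite ext_out // => [|y Wy Ky]; last by rewrite -g1 -g0 /g !F0 ?mul0r ?subrr //; lra.
    rewrite big1 ?subr0 ?normr0 ?ltW // => k _.
    rewrite ext_out ?mulr0 // => y Wy Ky; apply: dG0 => //; exact/k01/ltnW.
  have Wx := KW Kx; rewrite extW // -g1 -g0.
  have -> : g 1 x - g 0 x = \sum_(k < m) (g (k.+1%:R / m%:R) x - g (k%:R / m%:R) x).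
    rewrite -(big_mkord xpredT (fun k => g (k.+1%:R / m%:R) x - g (k%:R / m%:R) x)).
    by rewrite (telescope_sumr (fun k => g (k%:R / m%:R) x)) // divff ?gt_eqF // mul0r.
  rewrite -sumrB; apply: le_trans (ler_norm_sum _ _ _) _.
  apply: (@le_trans _ _ (\sum_(k < m) m%:R^-1 * e)); last first.
    by rewrite sumr_const card_ord -[leLHS]mulr_natl mulrA divff ?mul1r // gt_eqF.
  apply: ler_sum => k _; rewrite extW //.
  have kk : k%:R / m%:R <= k.+1%:R / m%:R :> R by rewrite ler_pM2r ?invr_gt0 // ler_nat.
  have [||s + ->] := @MVT_segment _ (fun t => g t x) (fun t => dG t x) _ _ kk.
  - by move=> s _; exact: time_derive.
  - apply: continuous_subspaceT => s; apply: differentiable_continuous.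
    by have [D _] := @time_derive s x Wx; exact/derivable1_diffP.
  rewrite in_itv/= => /andP[s1 s2].
  have kd : k.+1%:R / m%:R - k%:R / m%:R = m%:R^-1 :> R.
    by rewrite -mulrBl -natrB // subSnn mul1r.
  rewrite kd mulrC -mulrBr normrM ger0_norm ?invr_ge0 ?(ltW m0) //.
  rewrite ler_wpM2l ?invr_ge0 ?(ltW m0) //; apply: Hd => //.
  - exact/k01/ltnW.
  - have /andP[a1 _] := k01 k (ltnW (ltn_ord k)); have /andP[_ a2] := k01 k.+1 (ltn_ord k).
    by rewrite (le_trans a1 s1) (le_trans s2 a2).
  rewrite ger0_norm ?subr_ge0 //; apply: le_lt_trans mi.
  by rewrite lerBlDr; apply: le_trans s2 _; rewrite -lerBlDr kd.
Qed.

End Homotopy.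

(** * Affine changes of variables *)

Section LinearChange.
Context {R : realType} {n : nat}.
Implicit Types (F : 'rV[R]_n -> R) (L : 'M[R]_n).

Definition smoothc F := smooth_on setT F /\ exists b, bsupp b F.

Lemma mulmx_norm_le (x : 'rV[R]_n) L : `|x *m L| <= `|x| * \sum_i \sum_j `|L i j|.
Proof.
apply: rV_norm_le => [|j].
  by rewrite mulr_ge0 // sumr_ge0 // => i _; rewrite sumr_ge0.
rewrite mxE; apply: le_trans (ler_norm_sum _ _ _) _; rewrite mulr_sumr.
apply: ler_sum => i _; rewrite normrM; apply: ler_pM => //; first exact: coord_le_norm.
by rewrite (bigD1 j) //= lerDl sumr_ge0.
Qed.

Lemma nat_bound (r : R) : exists b, r <= b%:R.
Proof.
exists (Num.bound `|r|); apply: le_trans (ler_norm _) _.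
by apply/ltW/archi_boundP.
Qed.

Lemma smooth_affine L (c : 'rV[R]_n) j : smooth_on setT (fun x : 'rV[R]_n => (x *m L + c) 0 j).
Proof.
apply: (smooth_ext openT (f := fun x => \sum_k x 0 k * L k j + c 0 j)) => [x _|].
  by rewrite !mxE.
apply: smoothD; [exact: openT| |exact: smooth_cst].
apply: smooth_sum; first exact: openT.
by move=> k _; apply: smoothM; [exact: openT|exact: smooth_coord|exact: smooth_cst].
Qed.

Lemma smoothc_affine F L c : L \in unitmx -> smoothc F -> smoothc (fun x => F (x *m L + c)).
Proof.
move=> uL [sF [b bF]]; split.
  apply: (@smooth_comp R n n setT setT (fun x : 'rV[R]_n => x *m L + c) F openT openT _ _ sF).
    by move=> x _; exact: I.
  by move=> j; exact: smooth_affine.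
have [b' hb'] := nat_bound ((b%:R + `|c|) * \sum_i \sum_j `|invmx L i j|).
exists b' => x bx; apply: bF; rewrite ltNge; apply/negP => hx.
suff : `|x| <= b'%:R by rewrite leNgt bx.
apply: le_trans hb'; rewrite -[in leLHS](mulmxK uL x).
apply: le_trans (mulmx_norm_le _ _) _; apply: ler_wpM2r.
  by rewrite sumr_ge0 // => i _; rewrite sumr_ge0.
by rewrite -[x *m L](addrK c) (le_trans (ler_normB _ _)) // lerD2r.
Qed.

Lemma closed_norm_ball (r : R) : closed [set x : 'rV[R]_n | `|x| <= r].
Proof.
apply: (@preimage_closed _ _ (fun x : 'rV[R]_n => `|x|) [set y | y <= r]).
  by move=> x _; exact: norm_continuous.
exact: closed_le.
Qed.

Lemma norm_ball_supp F b : bsupp b F -> forall y, ~ `|y| <= b%:R -> F y = 0.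
Proof. by move=> bF y /negP; rewrite -ltNge; exact: bF. Qed.

Lemma null_translate F c : smoothc F -> null (fun x => F (x + c) - F x).
Proof.
move=> [sF [b bF]].
have [b' hb'] := nat_bound (b%:R + `|c|).
have jac0 x : jac (fun=> c) x = 0.
  by apply/matrixP => i j; rewrite !mxE; exact: derive_cst.
have su j : smooth_on setT (fun x : 'rV[R]_n => c 0 j) by exact: smooth_cst.
have CK x t : setT x -> 0 <= t <= 1 -> `|x + t *: c| <= b%:R -> `|x| <= b'%:R.
  move=> _ /andP[t0 t1] /= hx; apply: le_trans hb'.
  rewrite -[x](addrK (t *: c)) (le_trans (ler_normB _ _)) // lerD //.
  by rewrite normrZ ger0_norm // -[leRHS]mul1r ler_wpM2r.
have dt x t : setT x -> 0 <= t <= 1 -> \det (1%:M + t *: jac (fun=> c) x) != 0.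
  by move=> _ _; rewrite jac0 scaler0 addr0 det1 oner_eq0.
apply: null_ext (@null_homotopy R n setT [set x | `|x| <= b'%:R] [set x | `|x| <= b%:R]
  (fun=> c) F b' openT su sF (@closed_norm_ball _) (norm_ball_supp bF) (@rV_ball_compact _ _ _)
  (@subsetT _ _) (fun x h => h) CK dt) => x.
by rewrite asboolT // jac0 addr0 det1 mulr1.
Qed.

Definition linear_cov L := forall F, smoothc F ->
  null (fun x => F (x *m L) * `|\det L| - F x).

Lemma linear_cov_mul L1 L2 : L2 \in unitmx -> linear_cov L1 -> linear_cov L2 ->
  linear_cov (L1 *m L2).
Proof.
move=> u2 c1 c2 F sF.
have := smoothc_affine 0 u2 sF; set G := fun x => _ => sG.
apply: null_ext (nullD (nullZ `|\det L2| (c1 G sG)) (c2 F sF)) => x.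
rewrite /G !addr0 mulmxA det_mulmx normrM; ring.
Qed.

(** Homotopy along the segment from the identity to [L]. The radius of the compact set of preimages
    comes from a bound on the inverses met on the segment, which is finite by compactness of
    [0,1]. *)
Lemma linear_cov_path L : \det L > 0 ->
  (forall t, 0 <= t <= 1 -> \det (1%:M + t *: (L - 1%:M)) != 0) -> linear_cov L.
Proof.
move=> dL dt F [sF [b bF]].
pose u (x : 'rV[R]_n) := x *m (L - 1%:M).
pose A (t : R) : 'M[R]_n := 1%:M + t *: (L - 1%:M).
have jacE x : jac u x = L - 1%:M.
  apply/matrixP => i j; rewrite mxE.
  have D : is_derive x (bv i) (fun y : 'rV[R]_n => \sum_k y 0 k * (L - 1%:M) k j)
      (\sum_k (x 0 k * 0 + (L - 1%:M) k j * bv i 0 k)).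
    apply: is_derive_sumf => k _; apply: is_derive_mulf.
    exact: is_derive_coord.
  have -> : (fun y => u y 0 j) = (fun y : 'rV[R]_n => \sum_k y 0 k * (L - 1%:M) k j).
    by apply/funext => y; rewrite mxE.
  have [_ ->] := D; rewrite (bigD1 i) //= big1 => [|k ki].
    by rewrite mulr0 add0r addr0 [bv i 0 i]mxE !eqxx mulr1.
  by rewrite mulr0 add0r [bv i 0 k]mxE (negbTE ki) andbF mulr0.
have cA i j : continuous (fun t => A t i j).
  move=> t; have -> : (fun t => A t i j) = (fun t => (i == j)%:R + t * (L - 1%:M) i j).
    by apply/funext => s; rewrite !mxE.
  by apply: cvgD; [exact: cvg_cst|apply: cvgM; [exact: cvg_id|exact: cvg_cst]].
have [c cP] : exists c : R, 0 <= c /\ forall t, 0 <= t <= 1 -> \sum_i \sum_j `|invmx (A t) i j| <= c.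
  have cf : {within `[0%R, 1%R], continuous (fun t => \sum_i \sum_j `|cofactor (A t) j i / \det (A t)|)}.
    apply: continuous_in_subspaceT => t /set_mem; rewrite /= in_itv/= => t01.
    apply: cvg_sum => i _; apply: cvg_sum => j _.
    apply: (cvg_comp (fun t => cofactor (A t) j i / \det (A t)) (fun x => `|x|)); last exact: norm_continuous.
    apply: cvgM; first by apply: cvg_cofactor => k l; exact: cA.
    by apply: cvgV; [exact: dt|apply: cvg_det => k l; exact: cA].
  have [t0 t01 Ht] := EVT_max ler01 cf.
  exists (\sum_i \sum_j `|cofactor (A t0) j i / \det (A t0)|); split.
    by rewrite sumr_ge0 // => i _; rewrite sumr_ge0.
  move=> t t01'; apply: le_trans (Ht t _); last by rewrite in_itv.
  apply: ler_sum => i _; apply: ler_sum => j _.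
  by rewrite /invmx unitmxE unitfE dt // !mxE mulrC.
have [b' hb'] := nat_bound (b%:R * c).
have su j : smooth_on setT (fun x => u x 0 j).
  apply: (smooth_ext openT _ (smooth_affine (L - 1%:M) 0 j)) => x _.
  by rewrite addr0.
have CK x t : setT x -> 0 <= t <= 1 -> `|x + t *: u x| <= b%:R -> `|x| <= b'%:R.
  move=> _ t01 hx; apply: le_trans hb'.
  have e : x + t *: u x = x *m A t by rewrite /A mulmxDr mulmx1 -scalemxAr.
  have uA : A t \in unitmx by rewrite unitmxE unitfE dt.
  rewrite e in hx; rewrite -[in leLHS](mulmxK uA x).
  apply: le_trans (mulmx_norm_le _ _) _; apply: ler_pM; [by []| |by []|exact: (proj2 cP)].
  by rewrite sumr_ge0 // => i _; rewrite sumr_ge0.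
have dt' x t : setT x -> 0 <= t <= 1 -> \det (1%:M + t *: jac u x) != 0.
  by move=> _ t01; rewrite jacE; exact: dt.
apply: null_ext (@null_homotopy R n setT [set x | `|x| <= b'%:R] [set x | `|x| <= b%:R]
  u F b' openT su sF (@closed_norm_ball _) (norm_ball_supp bF) (@rV_ball_compact _ _ _)
  (@subsetT _ _) (fun x h => h) CK dt') => x.
rewrite asboolT // jacE (addrC 1%:M) subrK gtr0_norm // /u.
by rewrite mulmxBr mulmx1 (addrC x) subrK.
Qed.

(** Permuting coordinates permutes the lattice points of the box, so the two sums are equal for
    every [N]. *)
Lemma linear_cov_perm (s : 'S_n) : linear_cov (perm_mx s).
Proof.
move=> F _; rewrite det_perm normr_sign.
apply: (null_ext (F := fun x => F (x *m perm_mx s) + -1 * F x)) => [x|].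
  by rewrite mulr1 mulN1r.
rewrite /null; under eq_fun do rewrite lsumD lsumZ.
suff E N : lsum N (fun x => F (x *m perm_mx s)) = lsum N F.
  by under eq_fun do rewrite E mulN1r subrr; exact: cvg_cst.
rewrite /lsum; congr (_ * _).
pose sh (t : 'S_n) (k : {ffun 'I_n -> 'I_(2 * N ^ 2).+1}) := [ffun i => k (t i)].
rewrite [RHS](reindex (sh s^-1%g)); last first.
  by exists (sh s) => k _; apply/ffunP => i; rewrite !ffunE ?permK ?permKV.
apply: eq_bigr => k _; congr F; apply/rowP => i.
rewrite -[X in _ *m perm_mx X]invgK -col_permE !mxE ffunE //.
Qed.

(** The box is symmetric about 0: replacing an index k by 2 N^2 - k changes the sign of the
    coordinate. *)
Lemma linear_cov_sign (e : 'I_n -> bool) : linear_cov (diag_mx (\row_i (-1) ^+ e i)).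
Proof.
move=> F _.
have -> : `|\det (diag_mx (\row_i (-1 : R) ^+ e i))| = 1.
  by rewrite det_diag normr_prod big1 // => i _; rewrite mxE normr_sign.
apply: (null_ext (F := fun x => F (x *m diag_mx (\row_i (-1) ^+ e i)) + -1 * F x)) => [x|].
  by rewrite mulr1 mulN1r.
rewrite /null; under eq_fun do rewrite lsumD lsumZ.
suff E N : (0 < N)%N -> lsum N (fun x => F (x *m diag_mx (\row_i (-1) ^+ e i))) = lsum N F.
  apply: cvg_near_cst; near=> N; rewrite E ?mulN1r ?subrr //.
  by near: N; exact: nbhs_infty_gt.
move=> N0; have N0' : N%:R != 0 :> R by rewrite pnatr_eq0 -lt0n.
rewrite /lsum; congr (_ * _).
pose sh (k : {ffun 'I_n -> 'I_(2 * N ^ 2).+1}) := [ffun i => if e i then rev_ord (k i) else k i].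
have shK : involutive sh.
  by move=> k; apply/ffunP => i; rewrite !ffunE; case: (e i) => //; rewrite rev_ordK.
rewrite [RHS](reindex_inj (inv_inj shK)).
apply: eq_bigr => k _; congr F; apply/rowP => i.
rewrite mul_mx_diag !mxE ffunE; case: (e i); last by rewrite expr0 mulr1.
rewrite expr1 mulrN1 /= subSS natrB; last by rewrite -ltnS ltn_ord.
by rewrite natrM natrX; field.
Unshelve. all: by end_near. Qed.

(** The segment stays triangular, with diagonal entries (1 - t) + t L_ii, all positive. *)
Lemma det_lower_path L : is_trig_mx L -> (forall i, 0 < L i i) ->
  forall t, 0 <= t <= 1 -> 0 < \det (1%:M + t *: (L - 1%:M)).
Proof.
move=> /is_trig_mxP tL pL t /andP[t0 t1]; rewrite det_trig.
  apply: prodr_gt0 => i _; rewrite !mxE eqxx /=.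
  have -> : 1%:R + t * (L i i - 1%:R) = (1 - t) + t * L i i by ring.
  have [->|t1'] := eqVneq t 1; first by rewrite subrr add0r mul1r.
  have t1'' : t < 1 by rewrite lt_neqAle t1'.
  by rewrite ltr_pwDl ?subr_gt0 // mulr_ge0 // ltW.
apply/is_trig_mxP => i j ij; rewrite !mxE tL // -val_eqE /= (ltn_eqF ij).
by rewrite subr0 mulr0 addr0.
Qed.

Lemma linear_cov_lower L : is_trig_mx L -> (forall i, 0 < L i i) -> linear_cov L.
Proof.
move=> tL pL; apply: linear_cov_path => [|t t01]; last by rewrite gt_eqF // det_lower_path.
by rewrite det_trig //; apply: prodr_gt0.
Qed.

Lemma linear_cov_upper L : is_trig_mx L^T -> (forall i, 0 < L i i) -> linear_cov L.
Proof.
move=> tL pL; have pL' i : 0 < L^T i i by rewrite mxE.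
apply: linear_cov_path => [|t t01].
  by rewrite -det_tr det_trig //; apply: prodr_gt0.
rewrite -det_tr linearD linearZ linearB /= trmx1.
by rewrite gt_eqF // det_lower_path.
Qed.

End LinearChange.

(** By the LUP decomposition [L] is a permutation times Lo U, and the signs of the diagonal of [U]
    are split off as [S]. Each factor is a lattice symmetry or is joined to the identity by a
    segment of invertible matrices. *)
Lemma linear_cov_unit (R : realType) n (L : 'M[R]_n.+1) : L \in unitmx -> linear_cov L.
Proof.
move=> uL.
have := cormen_lup_correct L; have := cormen_lup_perm L; have := cormen_lup_lower L.
have := cormen_lup_upper L; have := cormen_lup_detL L.
case: (cormen_lup L) => [[P Lo] U] /= dLo upU loL /is_perm_mxP[s ->] e.
have {}e : perm_mx s *m L = Lo *m U := e.
have -> : L = perm_mx s^-1%g *m (Lo *m U).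
  by rewrite -e mulmxA -perm_mxM mulVg perm_mx1 mul1mx.
have uLo : Lo \in unitmx by rewrite unitmxE dLo unitr1.
have uU : U \in unitmx.
  have : Lo *m U \in unitmx by rewrite -e unitmx_mul unitmx_perm uL.
  by rewrite unitmx_mul => /andP[].
apply: linear_cov_mul; [by rewrite unitmx_mul uLo|exact: linear_cov_perm|].
apply: linear_cov_mul => //.
  apply: linear_cov_lower => [|i]; last by rewrite loL // eqxx.
  by apply/is_trig_mxP => i j ij; rewrite loL ?(ltnW ij) // -val_eqE /= (ltn_eqF ij).
have tU : is_trig_mx U^T by apply/is_trig_mxP => i j ij; rewrite mxE upU.
have U0 i : U i i != 0.
  move: uU; rewrite unitmxE unitfE -det_tr det_trig // => /prodf_neq0 /(_ i isT).
  by rewrite mxE.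
pose sg i := U i i < 0.
pose S : 'M[R]_n.+1 := diag_mx (\row_i (-1) ^+ sg i).
have SS : S *m S = 1%:M.
  rewrite /S mulmx_diag; apply/matrixP => i j; rewrite !mxE -signr_addb addbb expr0.
  by [].
have uS : S \in unitmx by rewrite unitmxE det_diag unitfE; apply/prodf_neq0 => i _; rewrite mxE signr_eq0.
have -> : U = S *m (S *m U) by rewrite mulmxA SS mul1mx.
apply: linear_cov_mul; [by rewrite unitmx_mul uS|exact: linear_cov_sign|].
apply: linear_cov_upper => [|i].
  apply/is_trig_mxP => i j ij; rewrite mxE /S mul_diag_mx mxE upU // mulr0 //.
rewrite mul_diag_mx !mxE /sg; have := U0 i; case: (ltgtP (U i i) 0) => //= h _.
  by rewrite expr1 mulN1r oppr_gt0.
by rewrite expr0 mul1r.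
Qed.

(** * Change of variables for a local diffeomorphism *)

Section LocalChange.
Context {R : realType} {n : nat}.
Local Notation N := (n.+1).

(** A nonzero v with v = - v B would have |v| at most |v| times the sum of the |B_ij|. *)
Lemma det_near1_neq0 (B : 'M[R]_N) : \sum_i \sum_j `|B i j| < 1 -> \det (1%:M + B) != 0.
Proof.
move=> hB; apply/negP => /det0P[v v0 /eqP]; rewrite mulmxDr mulmx1 addr_eq0 => /eqP e.
have := mulmx_norm_le v B; rewrite -[v *m B]opprK -e normrN.
by rewrite -[leLHS]mulr1 ler_pM2l ?normr_gt0 // leNgt hB.
Qed.

Lemma det_near1_gt0 (B : 'M[R]_N) : \sum_i \sum_j `|B i j| < 1 -> 0 < \det (1%:M + B).
Proof.
move=> hB; rewrite ltNge; apply/negP => d0.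
have ht (t : R) : 0 <= t <= 1 -> \det (1%:M + t *: B) != 0.
  move=> /andP[t0 t1]; apply: det_near1_neq0; apply: le_lt_trans hB.
  apply: ler_sum => i _; apply: ler_sum => j _; rewrite mxE normrM ger0_norm //.
  by rewrite -[leRHS]mul1r ler_wpM2r.
have cf : {within `[0%R, 1%R], continuous (fun t : R => \det (1%:M + t *: B))}.
  apply: continuous_subspaceT => t; apply: cvg_det => i j.
  have -> : (fun t : R => (1%:M + t *: B) i j) = (fun t : R => (i == j)%:R + t * B i j).
    by apply/funext => s; rewrite !mxE.
  have -> : (1%:M + t *: B) i j = (i == j)%:R + t * B i j by rewrite !mxE.
  by apply: cvgD; [exact: cvg_cst|apply: cvgM; [exact: cvg_id|exact: cvg_cst]].
have [|t + e] := @IVT _ (fun t : R => \det (1%:M + t *: B)) 0 1 0 ler01 cf.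
  rewrite scale1r scale0r addr0 det1 minEle maxEle.
  have nd : (1 <= \det (1%:M + B)) = false by apply/negP => h; move: h d0; lra.
  by rewrite nd d0 ler01.
by rewrite in_itv/= => /ht; rewrite e eqxx.
Qed.

Variables (U : set 'rV[R]_N) (phi : 'rV[R]_N -> 'rV[R]_N) (a : 'rV[R]_N).
Hypothesis oU : open U.
Hypothesis Ua : U a.
Hypothesis sphi : forall j, smooth_on U (fun x => phi x 0 j).
Hypothesis uL : jac phi a \in unitmx.

Let L := jac phi a.
(** Displacement of [phi] followed by the inverse of its affine part at [a]; it vanishes at [a]
    together with its differential. *)
Let u x : 'rV[R]_N := a + (phi x - phi a) *m invmx L - x.

Let su j : smooth_on U (fun x => u x 0 j).
Proof.
apply: (smooth_ext oU (f := fun x => a 0 j + (\sum_k (phi x 0 k + - phi a 0 k) * invmx L k j + -1 * x 0 j))) => [x _|].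
  rewrite !mxE mulN1r addrA; congr (_ + _ - _); apply: eq_bigr => k _; congr (_ * _).
  by rewrite !mxE.
apply: (smoothD oU); first exact: smooth_cst.
apply: (smoothD oU); last by apply: (smoothM oU); [exact: smooth_cst|exact: smooth_coord].
apply: smooth_sum; first exact: oU.
move=> k _; apply: (smoothM oU); last exact: smooth_cst.
by apply: (smoothD oU); [exact: sphi|exact: smooth_cst].
Qed.

Let jac_u x : U x -> 1%:M + jac u x = jac phi x *m invmx L.
Proof.
move=> Ux; apply/matrixP => i j; rewrite [LHS]mxE [jac u x i j]mxE [1%:M i j]mxE [RHS]mxE.
have D : is_derive x (bv i) (fun x => a 0 j + (\sum_k (phi x 0 k + - phi a 0 k) * invmx L k j + -1 * x 0 j))
    (0 + (\sum_k ((phi x 0 k + - phi a 0 k) * 0 + invmx L k j * (jac phi x i k + 0)) + -1 * bv i 0 j)).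
  apply: is_derive_addf; apply: is_derive_addf.
    apply: is_derive_sumf => k _; apply: is_derive_mulf; apply: is_derive_addf.
    by rewrite mxE; apply: derivableP; exact: smooth_derivable (sphi k) Ux.
  by apply: is_deriveZ; exact: is_derive_coord.
have -> : (fun y => u y 0 j) = (fun x => a 0 j + (\sum_k (phi x 0 k + - phi a 0 k) * invmx L k j + -1 * x 0 j)).
  apply/funext => y; rewrite !mxE mulN1r addrA; congr (_ + _ - _); apply: eq_bigr => k _; congr (_ * _).
  by rewrite !mxE.
have [_ ->] := D; rewrite add0r mulN1r.
have -> : bv i 0 j = (i == j)%:R :> R by rewrite mxE eqxx eq_sym.
rewrite addrC subrK; apply: eq_bigr => k _; ring.
Qed.

Let u_a : u a = 0.
Proof. by rewrite /u subrr mul0mx addr0 subrr. Qed.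

Let jac_u_a : jac u a = 0.
Proof. by apply: (addrI 1%:M); rewrite jac_u // addr0 mulmxV. Qed.

Let small : exists2 r : R, 0 < r & forall x, nball a (2 * r) x ->
  [/\ U x, \sum_i \sum_j `|jac u x i j| < 1 & `|u x| <= `|x - a| / 2].
Proof.
(* With each of the N^2 entries below 1/(2 N^2), their sum is at most 1/2, and the N of them
   entering one component of [u] move points by at most |x - a| / 2. *)
pose d : R := (2 * (N * N)%:R)^-1.
have d0 : 0 < d by rewrite invr_gt0 mulr_gt0 // ltr0n.
have H i j : \forall x \near a, `|jac u x i j| < d.
  have sj : smooth_on U (fun x => jac u x i j).
    by apply: (smooth_ext oU _ (smooth_derive i (su j))) => x _; rewrite mxE.
  have := smooth_cont sj Ua; rewrite /prop_for /continuous_at => /cvgrPdist_lt /(_ _ d0).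
  by apply: near_mono => x; rewrite jac_u_a mxE sub0r normrN.
have H1 : \forall x \near a, forall i j, `|jac u x i j| < d.
  apply: (filter_forall (nbhs_filter a)) => i.
  exact: (filter_forall (nbhs_filter a)) (H i).
have oUa : nbhs a U by exact: open_nbhs_nbhs.
have [r r0 Br] := nbhs_nball (filterI oUa H1).
exists (r / 2); first by rewrite divr_gt0.
have -> : 2 * (r / 2) = r by rewrite mulrC divfK.
move=> x xr; have [Ux Hx] := Br x xr; split=> //.
  apply: (@le_lt_trans _ _ (\sum_(i < N) \sum_(j < N) d)).
    by apply: ler_sum => i _; apply: ler_sum => j _; exact/ltW/Hx.
  rewrite !sumr_const !card_ord -mulrnA -[ltLHS]mulr_natl /d invfM mulrCA.
  by rewrite divff ?mulr1 ?invf_lt1 ?ltr1n // pnatr_eq0.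
have xa0 : 0 <= `|x - a| / 2 by rewrite divr_ge0.
apply: rV_norm_le => // j.
have dj y i : `|y - a| <= `|x - a| -> derivable (fun x => u x 0 j) y (bv i).
  move=> yx; have [Uy _] := Br y (le_lt_trans yx xr).
  exact: smooth_derivable (su j) Uy.
have ua0 : u a 0 j = 0 by rewrite u_a mxE.
have [xi [xia]] := MVT_coord dj; rewrite ua0 subr0 => ->.
apply: le_trans (ler_norm_sum _ _ _) _.
apply: (@le_trans _ _ (\sum_(i < N) d * `|x - a|)).
  apply: ler_sum => i _; rewrite normrM; apply: ler_pM => //.
    have [_ /(_ i j)] := Br _ (le_lt_trans (xia i) xr).
    by rewrite mxE => /ltW.
  by have := coord_le_norm (x - a) i; rewrite !mxE.
rewrite sumr_const card_ord -[leLHS]mulr_natl mulrA mulrC ler_wpM2l //.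
rewrite /d natrM !invfM mulrCA ler_piMr ?invr_ge0 // mulrA divff ?mul1r ?invf_le1 ?ler1n //.
Qed.

(** [phi] is a map near the identity followed by a linear map and a translation, and the three
    comparisons add up. [F] has to live close to [phi a], so that its pullbacks stay in the ball
    where the displacement is controlled. *)
Lemma local_cov : exists r rho : R, [/\ 0 < r, 0 < rho, nball a r `<=` U &
  forall F, smoothc F -> (forall y, rho <= `|y - phi a| -> F y = 0) ->
  null (fun x => (if `[< nball a r x >] then F (phi x) * `|\det (jac phi x)| else 0) - F x)].
Proof.
have [r r0 Hr] := small.
pose c := \sum_i \sum_j `|invmx L i j|.
have c0 : 0 <= c by rewrite sumr_ge0 // => i _; rewrite sumr_ge0.
have c1 : 0 < c + 1 by rewrite ltr_wpDl.
(* [rho] is such that the pullback of [F] by the affine part lives in |x - a| <= r/2. As |u x| <= |x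
   - a| / 2, points deformed into that ball started within distance [r]. The summand 1 makes the
   denominator positive. *)
exists (2 * r), (r / 2 / (c + 1)); split; [by rewrite mulr_gt0|by rewrite !divr_gt0| |].
  by move=> x /Hr[].
move=> F sF F0.
pose H y := F (y + (phi a - a *m L)).
have uLm : L \in unitmx by exact: uL.
have sH : smoothc H.
  have := smoothc_affine (phi a - a *m L) (unitmx1 R N) sF.
  by rewrite /H; under eq_fun do rewrite mulmx1.
pose F1 x := H (x *m L).
have sF1 : smoothc F1.
  by have := smoothc_affine 0 uLm sH; rewrite /F1; under eq_fun do rewrite addr0.
have F1E x : F1 x = F (phi a + (x - a) *m L).
  by rewrite /F1 /H; congr F; rewrite mulmxBl addrCA.
have F1supp x : ~ `|x - a| <= r / 2 -> F1 x = 0.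
  move=> /negP; rewrite -ltNge => xr; rewrite F1E F0 //.
  rewrite addrAC subrr add0r; have := mulmx_norm_le ((x - a) *m L) (invmx L).
  rewrite mulmxK // -/c => h.
  rewrite ler_pdivrMr //; apply: le_trans (ltW xr) _; apply: le_trans h _.
  by rewrite ler_wpM2l // lerDl.
have [b hb] := nat_bound (r + `|a|).
have KW : [set x | `|x - a| <= r] `<=` nball a (2 * r).
  by move=> x /= xr; rewrite /nball /=; lra.
have oW : open (nball a (2 * r)) by exact: nball_open.
have suW j : smooth_on (nball a (2 * r)) (fun x => u x 0 j).
  by apply: smooth_sub (su j) => x /Hr[].
have cball (s : R) : closed [set x : 'rV[R]_N | `|x - a| <= s].
  apply: (@preimage_closed _ _ (fun x : 'rV[R]_N => `|x - a|) [set y | y <= s]); last exact: closed_le.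
  move=> x _; apply: (cvg_comp (fun x => x - a) (fun x => `|x|)); last exact: norm_continuous.
  by apply: (@cvgB _ _ _ (nbhs x) _ id (fun=> a) x a); [exact: cvg_id|exact: cvg_cst].
have Kb x : `|x - a| <= r -> `|x| <= b%:R.
  by move=> xr; apply: le_trans hb; rewrite -[x](subrK a) (le_trans (ler_normD _ _)) // lerD2r.
have cK : compact [set x : 'rV[R]_N | `|x - a| <= r].
  by apply: subclosed_compact (@rV_ball_compact R N b%:R) _ => // x; exact: Kb.
have CK x t : nball a (2 * r) x -> 0 <= t <= 1 -> `|x + t *: u x - a| <= r / 2 -> `|x - a| <= r.
  move=> /Hr[_ _ ux] /andP[t0 t1] h.
  have tu : `|t *: u x| <= `|x - a| / 2.
    apply: le_trans ux; rewrite normrZ ger0_norm // -[leRHS]mul1r ler_wpM2r //.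
  have := ler_normB (x + t *: u x - a) (t *: u x).
  have -> : x + t *: u x - a - t *: u x = x - a by rewrite addrAC addrK.
  by move: h tu; lra.
have dt x t : nball a (2 * r) x -> 0 <= t <= 1 -> \det (1%:M + t *: jac u x) != 0.
  move=> /Hr[_ h _] /andP[t0 t1]; apply: det_near1_neq0; apply: le_lt_trans h.
  apply: ler_sum => i _; apply: ler_sum => j _; rewrite [X in `|X| <= _]mxE normrM ger0_norm //.
  by rewrite -[leRHS]mul1r ler_wpM2r.
have n1 := @null_homotopy R N (nball a (2 * r)) [set x | `|x - a| <= r] [set x | `|x - a| <= r / 2]
  u F1 b oW suW (proj1 sF1) (cball _) F1supp cK KW Kb CK dt.
have n2 := linear_cov_unit uLm sH.
have n3 := null_translate (phi a - a *m L) sF.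
apply: null_ext (nullD (nullD (nullZ `|\det L| n1) n2) n3) => x.
rewrite -/(F1 x) -/(H x); case: asboolP => [Wx|Wx]; last first.
  rewrite mulr0 F1supp ?mul0r ?sub0r ?add0r 1?addrA ?addNr ?add0r //.
  by move=> h; apply: Wx; apply: KW => /=; move: h; lra.
have [Ux h _] := Hr x Wx.
have e1 : F1 (x + u x) = F (phi x).
  rewrite F1E /u (addrC x) subrK (addrC a) addrK mulmxKV //.
  by rewrite addrC subrK.
have e2 : \det (1%:M + jac u x) * `|\det L| = `|\det (jac phi x)|.
  rewrite -[X in X * _](gtr0_norm (det_near1_gt0 h)) jac_u // det_mulmx normrM -mulrA -normrM.
  by rewrite -det_mulmx mulVmx // det1 normr1 mulr1.
by rewrite e1 -e2; ring.
Qed.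

End LocalChange.

(** * Functions, tangent vectors and vector fields on a manifold *)

Section ManifoldFunctions.
Context {R : realType} {n : nat} (M : smoothManifold R n).
Implicit Types (p q : M) (f h : M -> R) (c : @chart R n M).

Definition img c : set 'rV[R]_n := chart_map c @` chart_dom c.

Lemma img_open c : open (img c).
Proof. exact: chart_img_open. Qed.

Lemma img_in c p : chart_dom c p -> img c (chart_map c p).
Proof. by move=> cp; exists p. Qed.

Lemma img_inv c x : img c x -> chart_dom c (chart_inv c x) /\ chart_map c (chart_inv c x) = x.
Proof. by case=> p cp <-; rewrite chart_mapK. Qed.

Lemma near_inv c x (P : M -> Prop) : img c x ->
  (\forall q \near chart_inv c x, P q) -> \forall y \near x, P (chart_inv c y).
Proof. by move=> cx nP; have := chart_inv_cont cx; apply. Qed.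

Lemma near_chart c p (P : 'rV[R]_n -> Prop) : chart_dom c p ->
  (\forall y \near chart_map c p, P y) -> \forall q \near p, P (chart_map c q).
Proof. by move=> cp nP; have := chart_map_cont cp; apply. Qed.

Lemma near_dom c p : chart_dom c p -> \forall q \near p, chart_dom c q.
Proof. by move=> cp; apply: open_nbhs_nbhs; split => //; exact: chart_dom_open. Qed.

Lemma image_open c (A : set M) : open A -> A `<=` chart_dom c -> open (chart_map c @` A).
Proof.
move=> oA AD; rewrite openE => _ [p Ap <-].
have cp := AD _ Ap; have ip := img_in cp.
have nA : \forall q \near chart_inv c (chart_map c p), A q.
  by rewrite chart_mapK //; exact: open_nbhs_nbhs.
have := near_inv ip nA.
have : \forall y \near chart_map c p, img c y by apply: open_nbhs_nbhs; split; [exact: img_open|].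
apply: filterS2 => y /img_inv[_ e] Ay; exists (chart_inv c y) => //.
Qed.

Definition smooth_near p f := exists2 h, smooth_fun h & \forall q \near p, f q = h q.

Lemma smooth_fun_local f : (forall p, smooth_near p f) -> smooth_fun f.
Proof.
move=> Hf c ac; apply: smooth_local => x cx.
have [h sh fh] := Hf (chart_inv c x).
have oi : \forall y \near x, img c y by apply: open_nbhs_nbhs; split; [exact: img_open|].
have [r r0 Br] := nbhs_nball (filterI oi (near_inv cx fh)).
exists (nball x r); first by rewrite /nball /= subrr normr0.
apply: (smooth_ext (@nball_open R n x r) (f := h \o chart_inv c)).
  by move=> y /Br[_ /= ->].
by apply: smooth_sub (sh c ac) => y /Br[].
Qed.

Lemma smooth_fun_cst (k : R) : smooth_fun (fun _ : M => k).
Proof. by move=> c ac; exact: smooth_cst. Qed.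

Lemma smooth_funD f h : smooth_fun f -> smooth_fun h -> smooth_fun (fun p => f p + h p).
Proof. by move=> sf sh c ac; apply: smoothD (sf c ac) (sh c ac); exact: img_open. Qed.

Lemma smooth_funM f h : smooth_fun f -> smooth_fun h -> smooth_fun (fun p => f p * h p).
Proof. by move=> sf sh c ac; apply: smoothM (sf c ac) (sh c ac); exact: img_open. Qed.

Lemma smooth_funN f : smooth_fun f -> smooth_fun (fun p => - f p).
Proof.
move=> sf; have -> : (fun p => - f p) = (fun p => -1 * f p) by apply/funext => p; rewrite mulN1r.
exact: (smooth_funM (@smooth_fun_cst (-1)) sf).
Qed.

Lemma smooth_funB f h : smooth_fun f -> smooth_fun h -> smooth_fun (fun p => f p - h p).
Proof. by move=> sf sh; exact: (smooth_funD sf (smooth_funN sh)). Qed.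

Lemma smooth_fun_sum (I : Type) (r : seq I) (P : pred I) (f : I -> M -> R) :
  (forall i, P i -> smooth_fun (f i)) -> smooth_fun (fun p => \sum_(i <- r | P i) f i p).
Proof. by move=> sf c ac; apply: smooth_sum => [|i Pi]; [exact: img_open|exact: sf]. Qed.

Lemma smooth_funV f : (forall p, f p != 0) -> smooth_fun f -> smooth_fun (fun p => (f p)^-1).
Proof. by move=> f0 sf c ac; apply: smoothV (sf c ac) => [|x _]; [exact: img_open|exact: f0]. Qed.

Lemma smooth_fun_cont f : smooth_fun f -> continuous f.
Proof.
move=> sf p; have [c ac cp] := atlas_cover p.
have ip := img_in cp.
have cf := smooth_cont (sf c ac) ip.
apply: (@eq_cont_at _ _ ((f \o chart_inv c) \o chart_map c)).
  by apply: near_mono (near_dom cp) => q cq /=; rewrite chart_mapK.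
by apply: continuous_comp; [exact: chart_map_cont|exact: cf].
Qed.

Lemma transition_smooth c c' j : atlas c -> atlas c' ->
  smooth_on (chart_map c @` (chart_dom c `&` chart_dom c'))
            (fun x => chart_map c' (chart_inv c x) 0 j).
Proof. by move=> ac ac'; exact: atlas_compatible. Qed.

Lemma overlap_open c c' : open (chart_map c @` (chart_dom c `&` chart_dom c')).
Proof. by apply: image_open => [|x []//]; apply: openI; exact: chart_dom_open. Qed.

Definition pull0 c (h : 'rV[R]_n -> R) p : R :=
  if `[< chart_dom c p >] then h (chart_map c p) else 0.

Lemma pull0E c (h : 'rV[R]_n -> R) p : chart_dom c p -> pull0 c h p = h (chart_map c p).
Proof. by move=> cp; rewrite /pull0 asboolT. Qed.

(** Near a point off [K] the function is 0, since compact sets are closed in a Hausdorff space; near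
    a point of [K] it is a composite with a transition map. *)
Lemma smooth_pull0 c (h : 'rV[R]_n -> R) (K : set M) (U : set 'rV[R]_n) : atlas c -> compact K -> K `<=` chart_dom c ->
  open U -> U `<=` img c -> smooth_on U h ->
  (forall p, K p -> U (chart_map c p)) ->
  (forall p, chart_dom c p -> ~ K p -> h (chart_map c p) = 0) -> smooth_fun (pull0 c h).
Proof.
move=> ac cK KD oU UI sh KU hK c' ac'; apply: smooth_local => x cx.
have [cp' e] := img_inv cx.
have [Kp|Kp] := pselect (K (chart_inv c' x)); last first.
  have oK : open (~` K) by rewrite openC; apply: compact_closed => //; exact: manifold_hausdorff.
  have nK : \forall q \near chart_inv c' x, ~ K q by exact: open_nbhs_nbhs.
  have [r r0 Br] := nbhs_nball (near_inv cx nK).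
  exists (nball x r); first by rewrite /nball /= subrr normr0.
  apply: (smooth_ext (@nball_open R n x r) (f := fun=> 0)); last exact: smooth_cst.
  move=> y /Br Ky; rewrite /= /pull0; case: asboolP => // cy.
  by rewrite hK.
have cp := KD _ Kp.
have nU : \forall q \near chart_inv c' x, [/\ chart_dom c q, chart_dom c' q & U (chart_map c q)].
  have h1 := near_dom cp; have h2 := near_dom cp'.
  have h3 : \forall q \near chart_inv c' x, U (chart_map c q).
    by apply: (near_chart cp); apply: open_nbhs_nbhs; split => //; exact: KU.
  by apply: filterS3 h1 h2 h3 => q ? ? ?; split.
have ix : \forall y \near x, img c' y by apply: open_nbhs_nbhs; split => //; exact: img_open.
have [r r0 Br] := nbhs_nball (filterI ix (near_inv cx nU)).
exists (nball x r); first by rewrite /nball /= subrr normr0.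
apply: (smooth_ext (@nball_open R n x r) (f := h \o (fun y => chart_map c (chart_inv c' y)))).
  by move=> y /Br[_ [cy _ _]]; rewrite /= pull0E.
apply: (smooth_comp (@nball_open R n x r) oU _ _ sh) => [y /Br[_ [_ _ //]]|j].
apply: smooth_sub (transition_smooth j ac' ac) => y /Br[iy [cy cy' _]].
by exists (chart_inv c' y) => //; have [] := img_inv iy.
Qed.

(** The Euclidean square serves for cutoffs because the sup norm is not smooth. *)
Definition sqd (a x : 'rV[R]_n) : R := \sum_i (x 0 i - a 0 i) ^+ 2.

Lemma sqd_ge (a x : 'rV[R]_n) : `|x - a| ^+ 2 <= sqd a x.
Proof.
rewrite -[leRHS]sqr_sqrtr; last by apply: sumr_ge0 => i _; exact: sqr_ge0.
rewrite lerXn2r ?nnegrE ?sqrtr_ge0 //; apply: rV_norm_le => [|i]; first exact: sqrtr_ge0.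
rewrite !mxE -sqrtr_sqr ler_wsqrtr // /sqd (bigD1 i) //= lerDl.
by apply: sumr_ge0 => j _; exact: sqr_ge0.
Qed.

Lemma sqd_le (a x : 'rV[R]_n) : sqd a x <= n%:R * `|x - a| ^+ 2.
Proof.
apply: (@le_trans _ _ (\sum_(i < n) `|x - a| ^+ 2)); last first.
  by rewrite sumr_const card_ord mulr_natl.
apply: ler_sum => i _; rewrite -real_normK ?num_real // lerXn2r ?nnegrE //.
by have := coord_le_norm (x - a) i; rewrite !mxE.
Qed.

Lemma bump_function p (O : set M) : nbhs p O -> exists chi : M -> R, exists K : set M,
  [/\ smooth_fun chi, forall q, 0 <= chi q, \forall q \near p, chi q = 1,
      compact K /\ K `<=` O & forall q, ~ K q -> chi q = 0].
Proof.
move=> pO; have [c ac cp] := atlas_cover p.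
set a := chart_map c p; have ia : img c a by exact: img_in.
have nO : \forall y \near a, img c y /\ O (chart_inv c y).
  apply: filterI; first by apply: open_nbhs_nbhs; split => //; exact: img_open.
  by apply: near_inv => //; rewrite chart_mapK.
have [r r0 Br] := nbhs_nball nO.
pose s := r / 2; have s0 : 0 < s by rewrite divr_gt0.
(* The argument of [step] is <= 0 once sqd >= s^2, and >= 1 once sqd <= s^2 / 2. *)
pose h x := step (2 - sqd a x / s ^+ 2 * 2).
pose B := [set x : 'rV[R]_n | `|x - a| <= s].
have BI x : B x -> img c x /\ O (chart_inv c x).
  by move=> xs; apply: Br; rewrite /nball /=; move: xs; rewrite /B /= /s; lra.
have cB : compact B.
  have [b hb] := nat_bound (s + `|a|).
  apply: (subclosed_compact _ (@rV_ball_compact R n b%:R)) => [|x xs].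
    apply: (@preimage_closed _ _ (fun x : 'rV[R]_n => `|x - a|) [set y | y <= s]); last exact: closed_le.
    move=> x _; apply: (cvg_comp (fun x => x - a) (fun x => `|x|)); last exact: norm_continuous.
    by apply: (@cvgB _ _ _ (nbhs x) _ id (fun=> a) x a); [exact: cvg_id|exact: cvg_cst].
  by rewrite /= (le_trans _ hb) // -[x in leLHS](subrK a) (le_trans (ler_normD _ _)) // lerD2r.
pose K := chart_inv c @` B.
have KD q : K q -> chart_dom c q by case=> x /BI[/img_inv[]] + _ _ <-.
exists (pull0 c h), K; split.
- apply: (smooth_pull0 (K := K) (U := img c) ac _ KD (@img_open c) (@subset_refl _ _)).
  + apply: continuous_compact cB; apply: continuous_in_subspaceT => x /set_mem /BI[ix _].
    exact: chart_inv_cont.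
  + apply: smooth_step; first exact: img_open.
    apply: (smooth_ext (@img_open c) (f := fun x => 2 + - 2 / s ^+ 2 * sqd a x)) => [x _|]; first by ring.
    apply: smoothD; [exact: img_open|exact: smooth_cst|].
    apply: smoothM; [exact: img_open|exact: smooth_cst|].
    apply: smooth_sum; first exact: img_open.
    move=> i _; apply: (smoothM (f := fun x => x 0 i - a 0 i) (g := fun x => x 0 i - a 0 i)); first exact: img_open.
      by apply: smoothD; [exact: img_open|exact: smooth_coord|exact: smooth_cst].
    by apply: smoothD; [exact: img_open|exact: smooth_coord|exact: smooth_cst].
  + by move=> q /KD; exact: img_in.
  + move=> q cq Kq; apply: step0; have : ~ B (chart_map c q).
      by move=> Bq; apply: Kq; exists (chart_map c q) => //; rewrite chart_mapK.
    move=> /negP; rewrite -ltNge => sq.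
    have : s ^+ 2 <= sqd a (chart_map c q).
      by apply: le_trans (sqd_ge _ _); rewrite lerXn2r ?nnegrE ?(ltW s0) // ltW.
    rewrite -[leLHS]mul1r -ler_pdivlMr ?exprn_gt0 //; lra.
- by move=> q; rewrite /pull0; case: ifP => // _; exact: step_ge0.
- have n0 : 0 < (2 * n%:R + 1 : R) by rewrite ltr_wpDl // mulr_ge0.
  (* Within this radius |x - a|^2 <= |x - a| <= s^2 / (2n + 1), and [sqd_le] gives sqd <= s^2 /
     2. *)
  have e0 : 0 < Num.min 1 (s ^+ 2 / (2 * n%:R + 1)).
    by rewrite lt_min ltr01 divr_gt0 // exprn_gt0.
  have nb : \forall q \near p, nball a (Num.min 1 (s ^+ 2 / (2 * n%:R + 1))) (chart_map c q).
    by apply: near_chart => //; exact: nball_nbhs.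
  apply: filterS2 (near_dom cp) nb => q cq; rewrite /nball /= lt_min => /andP[q1 q2].
  rewrite pull0E // /h step1 //.
  have h1 := sqd_le a (chart_map c q).
  have h2 : `|chart_map c q - a| ^+ 2 <= s ^+ 2 / (2 * n%:R + 1).
    by apply: le_trans (ltW q2); rewrite expr2 -[leRHS]mulr1 ler_wpM2l // ltW.
  have h3 : sqd a (chart_map c q) / s ^+ 2 * 2 <= 1.
    rewrite -ler_pdivlMr // div1r ler_pdivrMr ?exprn_gt0 //.
    apply: le_trans h1 _; apply: (le_trans (ler_wpM2l _ h2)); first by [].
    rewrite mulrCA mulrC ler_wpM2r ?sqr_ge0 // ler_pdivrMr //.
    by rewrite mulrDr mulKf // ?pnatr_eq0 // mulr1 lerDl invr_ge0.
  lra.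
- split; last by move=> q [x /BI[_]] + <-.
  apply: continuous_compact cB; apply: continuous_in_subspaceT => x /set_mem /BI[ix _].
  exact: chart_inv_cont.
- move=> q Kq; rewrite /pull0; case: asboolP => // cq; apply: step0.
  have : ~ B (chart_map c q).
    by move=> Bq; apply: Kq; exists (chart_map c q) => //; rewrite chart_mapK.
  move=> /negP; rewrite -ltNge => sq.
  have : s ^+ 2 <= sqd a (chart_map c q).
    by apply: le_trans (sqd_ge _ _); rewrite lerXn2r ?nnegrE ?(ltW s0) // ltW.
  rewrite -[leLHS]mul1r -ler_pdivlMr ?exprn_gt0 //; lra.
Qed.

End ManifoldFunctions.

(** * Tangent vectors in coordinates *)

Section TangentVectors.
Context {R : realType} {n : nat} (M : smoothManifold R n).
Implicit Types (p q : M) (f h : M -> R) (c : @chart R n M).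
Local Notation tvec := ((M -> R) -> R^o).
Implicit Types (u v w : tvec).

Lemma tan_lin p v (a : R) f h : tangent p v -> smooth_fun f -> smooth_fun h ->
  v (fun x => a * f x + h x) = a * v f + v h.
Proof. by case=> _ H _; exact: H. Qed.

Lemma tanM p v f h : tangent p v -> smooth_fun f -> smooth_fun h ->
  v (fun x => f x * h x) = f p * v h + v f * h p.
Proof. by case=> _ _; apply. Qed.

Lemma tan_cst p v (k : R) : tangent p v -> v (fun=> k) = 0.
Proof.
move=> tv; have s1 := @smooth_fun_cst R n M.
have h1 : v (fun=> 1) = 0.
  have := tanM tv (s1 1) (s1 1); under eq_fun do rewrite mulr1.
  by rewrite mul1r mulr1 => e; apply/(addrI (v (fun=> 1))); rewrite addr0 -e.
have h0 : v (fun=> 0) = 0.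
  have := tan_lin (-1) tv (s1 1) (s1 1); under eq_fun do rewrite mulr1 addNr.
  by rewrite h1 mulr0 addr0.
have := tan_lin k tv (s1 1) (s1 0); under eq_fun do rewrite mulr1 addr0.
by rewrite h1 h0 mulr0 addr0.
Qed.

Lemma tanD p v f h : tangent p v -> smooth_fun f -> smooth_fun h ->
  v (fun x => f x + h x) = v f + v h.
Proof.
by move=> tv sf sh; have := tan_lin 1 tv sf sh; under eq_fun do rewrite mul1r; rewrite mul1r.
Qed.

Lemma tanZ p v (a : R) f : tangent p v -> smooth_fun f -> v (fun x => a * f x) = a * v f.
Proof.
move=> tv sf; have := tan_lin a tv sf (@smooth_fun_cst R n M 0).
by under eq_fun do rewrite addr0; rewrite (tan_cst _ tv) addr0.
Qed.

Lemma tanN p v f : tangent p v -> smooth_fun f -> v (fun x => - f x) = - v f.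
Proof.
by move=> tv sf; have := tanZ (-1) tv sf; under eq_fun do rewrite mulN1r; rewrite mulN1r.
Qed.

Lemma tanB p v f h : tangent p v -> smooth_fun f -> smooth_fun h ->
  v (fun x => f x - h x) = v f - v h.
Proof.
by move=> tv sf sh; rewrite -(tanN tv sh); apply: tanD tv sf _; exact: smooth_funN.
Qed.

Lemma tan_sum p v (I : Type) (r : seq I) (f : I -> M -> R) : tangent p v ->
  (forall i, smooth_fun (f i)) ->
  v (fun x => \sum_(i <- r) f i x) = \sum_(i <- r) v (f i).
Proof.
move=> tv sf; elim: r => [|i r IH].
  by rewrite big_nil; under eq_fun do rewrite big_nil; exact: (tan_cst 0 tv).
rewrite big_cons -IH -(tanD tv) //; last exact: smooth_fun_sum.
by congr v; apply/funext => x; rewrite big_cons.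
Qed.

(** Locality of derivations: a bump function supported where f = h annihilates f - h, and the
    Leibniz rule at a point where the bump is 1 and f - h is 0 leaves v(f - h). *)
Lemma tan_ext p v f h : tangent p v -> smooth_fun f -> smooth_fun h ->
  (\forall q \near p, f q = h q) -> v f = v h.
Proof.
move=> tv sf sh fh; apply/eqP; rewrite -subr_eq0 -(tanB tv) //; apply/eqP.
have [chi [K [schi _ chi1 [_ KO] chi0]]] := bump_function fh.
have sg : smooth_fun (fun x => f x - h x) by exact: smooth_funB.
have := tanM tv schi sg; have -> : (fun x => chi x * (f x - h x)) = fun=> 0.
  apply/funext => x; have [/KO/= ->|/chi0->] := pselect (K x); last by rewrite mul0r.
  by rewrite subrr mulr0.
rewrite (tan_cst _ tv) (nbhs_singleton chi1) (nbhs_singleton fh) subrr mulr0 mul1r addr0.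
by [].
Qed.

Lemma tangent0 p : tangent p (0 : tvec).
Proof. by split=> // *; rewrite /= ?mulr0 ?mul0r ?addr0. Qed.

Lemma tangent_lin p (a : R) u v : tangent p u -> tangent p v -> tangent p (a *: u + v).
Proof.
move=> tu tv; split=> [f sf|k f h sf sh|f h sf sh].
- by have [u0 _ _] := tu; have [v0 _ _] := tv; rewrite /= !fctE u0 // v0 // scaler0 addr0.
- by rewrite !fctE /GRing.scale/= (tan_lin _ tu) // (tan_lin _ tv) //; ring.
- by rewrite !fctE /GRing.scale/= (tanM tu) // (tanM tv) //; ring.
Qed.

Lemma tangentZ p (a : R) u : tangent p u -> tangent p (a *: u).
Proof. by move=> tu; rewrite -[a *: u]addr0; apply: tangent_lin tu (tangent0 p). Qed.

Lemma tangentD p u v : tangent p u -> tangent p v -> tangent p (u + v).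
Proof. by move=> tu tv; rewrite -[u]scale1r; exact: tangent_lin. Qed.

Lemma tangentN p u : tangent p u -> tangent p (- u).
Proof. by move=> tu; rewrite -scaleN1r; exact: tangentZ. Qed.

Lemma tangent_sum p (I : Type) (r : seq I) (P : pred I) (a : I -> R) (u : I -> tvec) :
  (forall i, tangent p (u i)) -> tangent p (\sum_(i <- r | P i) a i *: u i).
Proof.
move=> tu; apply: (big_ind (tangent p)); [exact: tangent0|exact: tangentD|].
by move=> i _; exact: tangentZ.
Qed.

Lemma tangent_eq p u v : tangent p u -> tangent p v ->
  (forall f, smooth_fun f -> u f = v f) -> u = v.
Proof.
move=> [u0 _ _] [v0 _ _] uv; apply/funext => f.
by have [/uv//|sf] := pselect (smooth_fun f); rewrite u0 // v0.
Qed.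

Lemma ext_near c p (r : R) (h : 'rV[R]_n -> R) : atlas c -> chart_dom c p -> 0 < r ->
  nball (chart_map c p) r `<=` img c -> smooth_on (nball (chart_map c p) r) h ->
  exists2 f, smooth_fun f & \forall q \near p, f q = h (chart_map c q).
Proof.
move=> ac cp r0 Br sh; set a := chart_map c p.
have nO : nbhs p (chart_dom c `&` [set q | nball a r (chart_map c q)]).
  by apply: filterI; [exact: near_dom|exact: (near_chart (P := nball a r) cp (nball_nbhs a r0))].
have [chi [K [schi _ chi1 [cK KO] chi0]]] := bump_function nO.
have oB : open (nball a r) by exact: nball_open.
exists (pull0 c (fun x => chi (chart_inv c x) * h x)).
  apply: (smooth_pull0 (K := K) ac cK _ oB Br); first by move=> q /KO[].
  - by apply: (smoothM oB) sh; apply: smooth_sub (schi c ac).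
  - by move=> q /KO[].
  - by move=> q cq Kq; rewrite chart_mapK // chi0 // mul0r.
apply: filterS2 (near_dom cp) chi1 => q cq q1.
by rewrite pull0E // chart_mapK // q1 mul1r.
Qed.

(** Tangent vectors act on global smooth functions only, so the chart coordinates are replaced by
    global functions with the same germ at [p]. *)
Definition coords c p (X : 'I_n -> M -> R) :=
  forall i, smooth_fun (X i) /\ \forall q \near p, X i q = chart_map c q 0 i.

Lemma coords_exist c p : atlas c -> chart_dom c p -> exists X, coords c p X.
Proof.
move=> ac cp; have nI : \forall y \near chart_map c p, img c y.
  by apply: open_nbhs_nbhs; split; [exact: img_open|exact: img_in].
have [r r0 Br] := nbhs_nball nI.
have H i : exists f, smooth_fun f /\ \forall q \near p, f q = chart_map c q 0 i.
  have [|f sf fe] := ext_near (h := fun x => x 0 i) ac cp r0 Br; first exact: smooth_coord.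
  by exists f.
by have [X HX] := choice H; exists X.
Qed.

Lemma coords_near c p X : coords c p X -> \forall q \near p, coords c q X.
Proof.
move=> HX; have H i : \forall q \near p, \forall q' \near q, X i q' = chart_map c q' 0 i.
  by have [_] := HX i; move=> /nbhs_interior.
have := filter_forall (nbhs_filter p) H.
by apply: near_mono => q Hq i; split; [have [] := HX i|exact: Hq].
Qed.

(** [Hadamard] writes [f] near [p] as a constant plus the sum of (x_i - a_i) h_i, with h_i(a) the
    partial derivative; the Leibniz rule keeps only the terms v(x_i) h_i(a). *)
Lemma tan_coord c p X v f : atlas c -> chart_dom c p -> coords c p X -> tangent p v ->
  smooth_fun f ->
  v f = \sum_i v (X i) * 'D_(bv i) (f \o chart_inv c) (chart_map c p).
Proof.
move=> ac cp HX tv sf; set a := chart_map c p; set F := f \o chart_inv c.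
have nI : \forall y \near a, img c y.
  by apply: open_nbhs_nbhs; split; [exact: img_open|exact: img_in].
have [r r0 Br] := nbhs_nball nI.
have sF : smooth_on (nball a r) F by apply: smooth_sub (sf c ac).
have [hh [shh hha hhF]] := Hadamard r0 sF.
have HH i : exists Hi, smooth_fun Hi /\ \forall q \near p, Hi q = hh i (chart_map c q).
  by have [Hi ? ?] := ext_near ac cp r0 Br (shh i); exists Hi.
have [H HHi] := choice HH.
have sX i : smooth_fun (X i) by have [] := HX i.
have sH i : smooth_fun (H i) by have [] := HHi i.
have sC k := @smooth_fun_cst R n M k.
have sXB i : smooth_fun (fun q => X i q - a 0 i) by exact: (smooth_funB (sX i) (sC _)).
have sXH i : smooth_fun (fun q => (X i q - a 0 i) * H i q) by exact: (smooth_funM (sXB i) (sH i)).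
have e : \forall q \near p, f q = F a + \sum_i (X i q - a 0 i) * H i q.
  have h1 : \forall q \near p, forall i, X i q = chart_map c q 0 i /\ H i q = hh i (chart_map c q).
    apply: (filter_forall (nbhs_filter p)) => i; apply: filterI; first by have [] := HX i.
    by have [] := HHi i.
  have h2 : \forall q \near p, nball a r (chart_map c q) by apply: near_chart => //; exact: nball_nbhs.
  apply: filterS3 (near_dom cp) h1 h2 => q cq q1 q2.
  have := hhF _ q2; rewrite /F /= chart_mapK // => ->; congr (_ + _).
  by apply: eq_bigr => i _; have [-> ->] := q1 i.
have sSum : smooth_fun (fun q => \sum_i (X i q - a 0 i) * H i q).
  by apply: smooth_fun_sum => i _; exact: sXH.
have sS : smooth_fun (fun q => F a + \sum_i (X i q - a 0 i) * H i q).
  exact: (smooth_funD (sC _) sSum).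
rewrite (tan_ext tv sf sS e) (tanD tv (sC _) sSum) (tan_cst _ tv) add0r (tan_sum _ tv sXH).
apply: eq_bigr => i _.
rewrite (tanM tv (sXB i) (sH i)) (tanB tv (sX i) (sC _)) (tan_cst _ tv) subr0.
have [_ /nbhs_singleton ->] := HX i; have [_ /nbhs_singleton ->] := HHi i.
by rewrite -/a subrr mul0r add0r hha.
Qed.

(** The coordinate vector at [p], with the value 0 on non-smooth functions that [tangent]
    prescribes. *)
Definition dtan c p (i : 'I_n) : tvec := fun f =>
  if `[< smooth_fun f >] then 'D_(bv i) (f \o chart_inv c) (chart_map c p) else 0.

Lemma dtanE c p i f : smooth_fun f -> dtan c p i f = 'D_(bv i) (f \o chart_inv c) (chart_map c p).
Proof. by move=> sf; rewrite /dtan asboolT. Qed.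

Lemma tangent_dtan c p i : atlas c -> chart_dom c p -> tangent p (dtan c p i).
Proof.
move=> ac cp; have ip := img_in cp.
have D f : smooth_fun f -> derivable (f \o chart_inv c) (chart_map c p) (bv i).
  by move=> sf; exact: smooth_derivable (sf c ac) ip.
split=> [f sf|k f h sf sh|f h sf sh]; first by rewrite /dtan asboolF.
  have sc := smooth_funD (smooth_funM (@smooth_fun_cst R n M k) sf) sh.
  rewrite (dtanE c p i sc) (dtanE c p i sf) (dtanE c p i sh).
  have := is_derive_addf (is_deriveZ k (derivableP (D f sf))) (derivableP (D h sh)).
  by case=> _ <-.
rewrite (dtanE c p i (smooth_funM sf sh)) (dtanE c p i sf) (dtanE c p i sh).
have := is_derive_mulf (derivableP (D f sf)) (derivableP (D h sh)).
by case=> _ /= e; rewrite [LHS]e chart_mapK // [X in _ + X]mulrC.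
Qed.

Lemma dtan_coords c p X i j : chart_dom c p -> coords c p X -> dtan c p i (X j) = (i == j)%:R.
Proof.
move=> cp HX; have [sX Xe] := HX j; rewrite dtanE //.
have ip := img_in cp.
have := is_derive_coord j (chart_map c p) (bv i); case=> _.
rewrite [bv i 0 j]mxE eqxx /= eq_sym => <-; apply: near_eq_derive.
have oi : \forall y \near chart_map c p, img c y by apply: open_nbhs_nbhs; split; [exact: img_open|].
have Xe' : \forall q \near chart_inv c (chart_map c p), X j q = chart_map c q 0 j by rewrite chart_mapK.
by apply: filterS2 oi (near_inv ip Xe') => y /img_inv[_ iy] /= ->; rewrite iy.
Qed.

Lemma tangent_coords_eq c p X u v : atlas c -> chart_dom c p -> coords c p X ->
  tangent p u -> tangent p v -> (forall i, u (X i) = v (X i)) -> u = v.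
Proof.
move=> ac cp HX tu tv uv; apply: (tangent_eq tu tv) => f sf.
rewrite (tan_coord ac cp HX tu sf) (tan_coord ac cp HX tv sf).
by apply: eq_bigr => i _; rewrite uv.
Qed.

Definition indep r (v : 'I_r -> tvec) := forall a : 'I_r -> R,
  \sum_i a i *: v i = 0 -> forall i, a i = 0.

Lemma tvec_sumE (I : Type) (r : seq I) (P : pred I) (a : I -> R) (v : I -> tvec) f :
  (\sum_(i <- r | P i) a i *: v i) f = \sum_(i <- r | P i) a i * v i f.
Proof. by elim/big_rec2: _ => // i y1 y2 _ <-. Qed.

Lemma frame_coords_unit r (v : 'I_r -> tvec) c p X : atlas c -> chart_dom c p -> coords c p X ->
  (forall i, tangent p (v i)) -> indep v -> row_free (\matrix_(a < r, i < n) v a (X i)).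
Proof.
move=> ac cp HX tv iv; rewrite -kermx_eq0; apply/eqP/row_matrixP => i; rewrite row0.
set E := \matrix_(_, _) _.
have k0 : row i (kermx E) *m E = 0 by apply/sub_kermxP; exact: row_sub.
have : \sum_a (row i (kermx E)) 0 a *: v a = 0.
  apply: (tangent_coords_eq ac cp HX); [exact: tangent_sum|exact: tangent0|] => j.
  rewrite tvec_sumE; have /rowP/(_ j) := k0; rewrite !mxE => k0j.
  by rewrite -[RHS]k0j; apply: eq_bigr => a _; rewrite !mxE.
by move=> /iv H; apply/rowP => a; rewrite H mxE.
Qed.

(** The component matrix of the frame has independent rows, whence r <= n. It has a left inverse,
    since the coordinate vectors are combinations of the frame, whence n <= r. *)
Lemma frame_card r (v : 'I_r -> tvec) p : (forall i, tangent p (v i)) -> indep v ->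
  (forall w, tangent p w -> exists a : 'I_r -> R, w = \sum_i a i *: v i) -> r = n.
Proof.
move=> tv iv sv; have [c ac cp] := atlas_cover p; have [X HX] := coords_exist ac cp.
have := frame_coords_unit ac cp HX tv iv; set E := \matrix_(_, _) _ => rE.
apply/eqP; rewrite eqn_leq; apply/andP; split.
  by rewrite -(eqP rE) rank_leq_col.
have H i : exists a : 'I_r -> R, dtan c p i = \sum_k a k *: v k by apply: sv; exact: tangent_dtan.
have [a Ha] := choice H.
have BE : (\matrix_(i < n, k < r) a i k) *m E = 1%:M.
  apply/matrixP => i j; rewrite !mxE -(dtan_coords i j cp HX) Ha tvec_sumE.
  by apply: eq_bigr => k _; rewrite !mxE.
have := mxrankM_maxr (\matrix_(i < n, k < r) a i k) E; rewrite BE mxrank1.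
by move=> /leq_trans; apply; exact: rank_leq_row.
Qed.

End TangentVectors.

(** If [g2] were positive, [dg] would be positive just to the right of 0, and the mean value theorem
    would produce a value above g(0). *)
Lemma second_derivative_max (R : realType) (g dg : R -> R) (d g2 : R) : 0 < d ->
  (forall s : R, `|s| < d -> g s <= g 0) ->
  (forall s : R, `|s| < d -> is_derive s 1 g (dg s)) ->
  is_derive (0 : R) 1 dg g2 -> dg 0 = 0 /\ g2 <= 0.
Proof.
move=> d0 gmax Dg [D2 E2].
have dg0 : dg 0 = 0.
  have n0 : `|0 : R| < d by rewrite normr0.
  have [_ <-] := Dg 0 n0.
  have a1 : - d <= d by lra.
  have a2 t : t \in `]- d, d[ -> derivable g t 1.
    rewrite in_itv/= => /andP[t1 t2].
    have td : `|t| < d by rewrite ltr_norml t1 t2.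
    by have [] := Dg t td.
  have a3 : 0 \in `]- d, d[ by rewrite in_itv/=; apply/andP; split; lra.
  have a4 t : t \in `]- d, d[ -> g t <= g 0.
    by rewrite in_itv/= => /andP[t1 t2]; apply: gmax; rewrite ltr_norml t1 t2.
  by have [_ ->] := derive1_at_max a1 a2 a3 a4.
split => //; rewrite leNgt; apply/negP => g20.
have cv : h^-1 *: (dg (h *: 1 + 0) - dg 0) @[h --> 0^'] --> g2.
  by move: D2; rewrite /derivable => /cvg_ex[l hl]; move: E2; rewrite /derive (cvg_lim _ hl) // => <-.
have : \forall h \near 0^', 0 < h^-1 *: (dg (h *: 1 + 0) - dg 0) by exact: (cvgr_gt _ cv).
move=> /nbhs_ballP[e /= e0 He].
pose m := Num.min d e; have m0 : 0 < m by rewrite lt_min d0 e0.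
have pos s : 0 < s < m -> 0 < dg s.
  move=> /andP[s0 sm]; have := He s; rewrite -ball_normE /= sub0r normrN gtr0_norm //.
  have me : m <= e by rewrite ge_min lexx orbT.
  move=> /(_ (lt_le_trans sm me) (lt0r_neq0 s0)).
  by rewrite addr0 [s *: 1]mulr1 dg0 subr0 /GRing.scale/= pmulr_rgt0 // invr_gt0.
have m2 : 0 < m / 2 by rewrite divr_gt0.
have md : m <= d by rewrite ge_min lexx.
have in_d t : 0 <= t <= m / 2 -> `|t| < d.
  by move=> /andP[t0 t1]; rewrite ger0_norm //; apply: lt_le_trans md; lra.
have [||t tin e1] := @MVT _ g dg 0 (m / 2) m2.
- by move=> t; rewrite in_itv/= => /andP[t0 t1]; apply: Dg; apply: in_d; rewrite !ltW.
- apply: continuous_in_subspaceT => t /set_mem; rewrite /= in_itv/= => /in_d/Dg[Dt _].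
  by apply: differentiable_continuous; exact/derivable1_diffP.
move: tin; rewrite in_itv/= => /andP[t0 t1].
have h1 : g (m / 2) <= g 0 by apply: gmax; apply: in_d; rewrite (ltW m2) lexx.
have h2 : 0 < dg t by apply: pos; rewrite t0; lra.
have : 0 < g (m / 2) - g 0 by rewrite e1 subr0 mulr_gt0.
by rewrite subr_gt0 ltNge h1.
Qed.

(** * Vector fields and the conditions at a maximum *)

Section VectorFields.
Context {R : realType} {n : nat} (M : smoothManifold R n).
Implicit Types (p q : M) (f h : M -> R) (c : @chart R n M).
Local Notation tvec := ((M -> R) -> R^o).
Implicit Types (u v w : tvec) (X Y Z : M -> tvec).

Lemma vf_tan X p : vector_field X -> tangent p (X p).
Proof. by case. Qed.

Lemma vf_smooth X f : vector_field X -> smooth_fun f -> smooth_fun (fun p => X p f).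
Proof. by case=> _; apply. Qed.

Lemma vf0 : vector_field (0 : M -> tvec).
Proof. by split=> [p|f sf]; [exact: tangent0|exact: smooth_fun_cst]. Qed.

Lemma vfD X Y : vector_field X -> vector_field Y -> vector_field (X + Y).
Proof.
move=> vX vY; split=> [p|f sf]; first by apply: tangentD; exact: vf_tan.
exact: (smooth_funD (vf_smooth vX sf) (vf_smooth vY sf)).
Qed.

Lemma vfZ f X : smooth_fun f -> vector_field X -> vector_field (scale_field f X).
Proof.
move=> sf vX; split=> [p|h sh]; first by apply: tangentZ; exact: vf_tan.
exact: (smooth_funM sf (vf_smooth vX sh)).
Qed.

Lemma vfN X : vector_field X -> vector_field (- X).
Proof.
move=> vX; split=> [p|h sh]; first by apply: tangentN; exact: vf_tan.
exact: (smooth_funN (vf_smooth vX sh)).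
Qed.

Lemma vfB X Y : vector_field X -> vector_field Y -> vector_field (X - Y).
Proof. by move=> vX vY; apply: vfD vX _; exact: vfN. Qed.

Lemma vf_sum (I : Type) (r : seq I) (P : pred I) (f : I -> M -> R) (X : I -> M -> tvec) :
  (forall i, smooth_fun (f i)) -> (forall i, vector_field (X i)) ->
  vector_field (fun p => \sum_(i <- r | P i) f i p *: X i p).
Proof.
move=> sf vX; split=> [p|h sh]; first by apply: tangent_sum => i; exact: vf_tan.
have -> : lie_derivative (fun p => \sum_(i <- r | P i) f i p *: X i p) h =
    (fun p => \sum_(i <- r | P i) f i p * X i p h).
  by apply/funext => p; rewrite /lie_derivative tvec_sumE.
apply: smooth_fun_sum => i _; exact: (smooth_funM (sf i) (vf_smooth (vX i) sh)).
Qed.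

Lemma vf_local X : (forall p, exists2 Y, vector_field Y & \forall q \near p, X q = Y q) ->
  vector_field X.
Proof.
move=> HX; split=> [p|f sf].
  by have [Y vY /nbhs_singleton ->] := HX p; exact: vf_tan.
apply: smooth_fun_local => p; have [Y vY XY] := HX p.
exists (fun p => Y p f); first exact: vf_smooth.
by apply: near_mono XY => q; rewrite /lie_derivative => ->.
Qed.

Lemma critical_point q v f : smooth_fun f -> (forall p, f p <= f q) -> tangent q v -> v f = 0.
Proof.
move=> sf fmax tv; have [c ac cq] := atlas_cover q; have [X HX] := coords_exist ac cq.
rewrite (tan_coord ac cq HX tv sf) big1 // => i _; set F := f \o chart_inv c.
have iq := img_in cq; set a := chart_map c q.
have nI : \forall y \near a, img c y by apply: open_nbhs_nbhs; split; [exact: img_open|].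
have [r r0 Br] := nbhs_nball nI.
have DF y : img c y -> derivable F y (bv i) by exact: smooth_derivable (sf c ac).
have nb (s : R) : `|s| < r -> img c (a + s *: bv i).
  move=> sr; apply: Br; rewrite /nball /= addrAC subrr add0r normrZ.
  rewrite (le_lt_trans _ sr) // -[leRHS]mulr1 ler_wpM2l //.
  by apply: rV_norm_le => // j; rewrite mxE eqxx /=; case: eqP; rewrite ?normr1 ?normr0.
have Dg (s : R) : `|s| < r -> is_derive s 1 (fun s => F (a + s *: bv i)) ('D_(bv i) F (a + s *: bv i)).
  by move=> sr; apply: is_derive_line; apply: DF; exact: nb.
have n0 : `|0 : R| < r by rewrite normr0.
have [_ E] := Dg 0 n0.
rewrite scale0r addr0 in E; rewrite -E.
have a1 : - r <= r by lra.
have a2 t : t \in `]- r, r[ -> derivable (fun s : R => F (a + s *: bv i)) t 1.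
  rewrite in_itv/= => /andP[t1 t2].
  have td : `|t| < r by rewrite ltr_norml t1 t2.
  by have [] := Dg t td.
have a3 : 0 \in `]- r, r[ by rewrite in_itv/=; apply/andP; split; lra.
have a4 t : t \in `]- r, r[ -> F (a + t *: bv i) <= F (a + 0 *: bv i).
  by rewrite scale0r addr0 /F /= chart_mapK.
by have [_ ->] := derive1_at_max a1 a2 a3 a4; rewrite mulr0.
Qed.

(** At a critical point the first-order terms of X(X f) vanish. What remains is the Hessian of the
    coordinate expression on the value of [X], a second derivative along a straight line in the
    chart. *)
Lemma second_order_max q X f : smooth_fun f -> (forall p, f p <= f q) -> vector_field X ->
  X q (lie_derivative X f) <= 0.
Proof.
move=> sf fmax vX; have [c ac cq] := atlas_cover q; have [x Hx] := coords_exist ac cq.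
set F := f \o chart_inv c; set a := chart_map c q.
have iq := img_in cq.
have nI : \forall y \near a, img c y by apply: open_nbhs_nbhs; split; [exact: img_open|].
have [r r0 Br] := nbhs_nball nI.
have sF : smooth_on (img c) F by exact: sf.
(* The partial derivatives of [f] exist only in the chart; the [G i] are global functions with the
   same germs, to which [X q] can be applied. *)
have HG i : exists G, smooth_fun G /\ \forall p \near q, G p = 'D_(bv i) F (chart_map c p).
  have sFi : smooth_on (nball a r) ('D_(bv i) F) by apply: smooth_sub (smooth_derive i sF).
  by have [G ? ?] := ext_near ac cq r0 Br sFi; exists G.
have [G HG'] := choice HG.
have sx i : smooth_fun (x i) by have [] := Hx i.
have sG i : smooth_fun (G i) by have [] := HG' i.
have sXx i : smooth_fun (fun p => X p (x i)) := vf_smooth vX (sx i).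
have tX := vf_tan q vX.
have e : \forall p \near q, lie_derivative X f p = \sum_i X p (x i) * G i p.
  have h1 : \forall p \near q, forall i, G i p = 'D_(bv i) F (chart_map c p).
    by apply: (filter_forall (nbhs_filter q)) => i; have [] := HG' i.
  apply: filterS3 (near_dom cq) h1 (coords_near Hx) => p cp Gp xp.
  rewrite /lie_derivative (tan_coord ac cp xp (vf_tan p vX) sf).
  by apply: eq_bigr => i _; rewrite Gp.
have crit i : G i q = 0.
  have [_ /nbhs_singleton ->] := HG' i.
  by rewrite -(dtanE _ _ _ sf); apply: critical_point sf fmax _; exact: tangent_dtan.
have sS : smooth_fun (fun p => \sum_i X p (x i) * G i p).
  by apply: smooth_fun_sum => i _; exact: (smooth_funM (sXx i) (sG i)).
rewrite (tan_ext tX (vf_smooth vX sf) sS e) (tan_sum _ tX); last first.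
  by move=> i; exact: (smooth_funM (sXx i) (sG i)).
pose w i := X q (x i).
have eqG i : X q (G i) = \sum_j w j * 'D_(bv j) ('D_(bv i) F) a.
  rewrite (tan_coord ac cq Hx tX (sG i)); apply: eq_bigr => j _; congr (_ * _).
  apply: near_eq_derive.
  have Ge : \forall p \near chart_inv c a, G i p = 'D_(bv i) F (chart_map c p).
    by rewrite chart_mapK //; have [] := HG' i.
  by apply: filterS2 nI (near_inv iq Ge) => y /img_inv[_ iy] /= ->; rewrite iy.
under eq_bigr => i _ do rewrite (tanM tX (sXx i) (sG i)) crit mulr0 addr0 -/(w i) eqG.
pose W : 'rV[R]_n := \row_i w i.
have nW0 : 0 < `|W| + 1 by rewrite ltr_wpDl.
pose d := r / (`|W| + 1); have d0 : 0 < d by rewrite divr_gt0.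
have nb (s : R) : `|s| < d -> nball a r (a + s *: W).
  move=> sd; rewrite /nball /= addrAC subrr add0r normrZ.
  have [->|s0] := eqVneq s 0; first by rewrite normr0 mul0r.
  have sp : 0 < `|s| by rewrite normr_gt0.
  rewrite -(divfK (lt0r_neq0 nW0) r) -/d; apply: (@lt_trans _ _ (`|s| * (`|W| + 1))).
    by rewrite ltr_pM2l // ltrDl.
  by rewrite ltr_pM2r.
have oB : open (nball a r) by exact: nball_open.
have DL (G0 : 'rV[R]_n -> R) (s : R) : smooth_on (img c) G0 -> `|s| < d ->
    is_derive s 1 (fun s => G0 (a + s *: W)) (\sum_i w i * 'D_(bv i) G0 (a + s *: W)).
  move=> sG0 sd; have Is := Br _ (nb s sd).
  have -> : \sum_i w i * 'D_(bv i) G0 (a + s *: W) = \sum_i 'D_(bv i) G0 (a + s *: W) * W 0 i.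
    by apply: eq_bigr => i _; rewrite mxE mulrC.
  have := @is_derive_comp_rV _ _ _ (fun s : R => a + s *: W) G0 s 1 W; apply.
  - have := is_derive_line (@derivable_id R _ (a + s *: W) W).
    by rewrite (@derive_id R).
  - apply: (near_open oB) => [|y yB i]; first exact: nb.
    by apply: smooth_derivable sG0 _; exact: Br.
  - by move=> i; exact: smooth_cont (smooth_derive i sG0) Is.
have [|||_ //] := @second_derivative_max R (fun s => F (a + s *: W))
  (fun s => \sum_i w i * 'D_(bv i) F (a + s *: W)) d
  (\sum_i w i * \sum_j w j * 'D_(bv j) ('D_(bv i) F) a) d0.
- by move=> s sd; rewrite scale0r addr0 /F /= chart_mapK.
- by move=> s sd; exact: DL.
apply: is_derive_sumf => i _.
have n0 : `|0 : R| < d by rewrite normr0.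
have := is_deriveZ (w i) (DL _ 0 (smooth_derive i sF) n0).
by rewrite scale0r addr0.
Qed.

End VectorFields.

(** * Connections and orthonormal frames *)

Lemma subDD (V : zmodType) (a b c d : V) : (a + b) - (c + d) = (a - c) + (b - d).
Proof. by rewrite opprD addrACA. Qed.

Section Connections.
Context {R : realType} {n : nat} (M : smoothManifold R n).
Local Notation tvec := ((M -> R) -> R^o).
Implicit Types (p q : M) (f h : M -> R) (u v w : tvec) (X Y Z : M -> tvec).
Variable g : riemannianMetric M.

Lemma gDl p u v w : tangent p u -> tangent p v -> tangent p w ->
  g p (u + v) w = g p u w + g p v w.
Proof. by move=> tu tv tw; have := metric_linear g 1 tu tv tw; rewrite scale1r mul1r. Qed.

Lemma g0l p w : tangent p w -> g p 0 w = 0.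
Proof.
move=> tw; have := gDl (@tangent0 R n M p) (@tangent0 R n M p) tw.
by rewrite addr0 => e; apply: (addrI (g p 0 w)); rewrite addr0 -e.
Qed.

Lemma gZl p a u w : tangent p u -> tangent p w -> g p (a *: u) w = a * g p u w.
Proof.
by move=> tu tw; have := metric_linear g a tu (@tangent0 R n M p) tw; rewrite addr0 g0l // addr0.
Qed.

Lemma gNl p u w : tangent p u -> tangent p w -> g p (- u) w = - g p u w.
Proof. by move=> tu tw; rewrite -scaleN1r gZl // mulN1r. Qed.

Lemma gBl p u v w : tangent p u -> tangent p v -> tangent p w ->
  g p (u - v) w = g p u w - g p v w.
Proof. by move=> tu tv tw; rewrite (gDl tu (tangentN tv) tw) (gNl tv tw). Qed.

Lemma gC p u v : tangent p u -> tangent p v -> g p u v = g p v u.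
Proof. by move=> tu tv; exact: (Defs.metric_sym g tu tv). Qed.

Lemma gDr p u v w : tangent p u -> tangent p v -> tangent p w ->
  g p w (u + v) = g p w u + g p w v.
Proof.
by move=> tu tv tw; rewrite gC ?gDl //; [rewrite !(gC tw)|exact: tangentD].
Qed.

Lemma gZr p a u w : tangent p u -> tangent p w -> g p w (a *: u) = a * g p w u.
Proof. by move=> tu tw; rewrite gC ?gZl //; [rewrite (gC tw)|exact: tangentZ]. Qed.

Lemma gNr p u w : tangent p u -> tangent p w -> g p w (- u) = - g p w u.
Proof. by move=> tu tw; rewrite -scaleN1r gZr // mulN1r. Qed.

Lemma gBr p u v w : tangent p u -> tangent p v -> tangent p w ->
  g p w (u - v) = g p w u - g p w v.
Proof. by move=> tu tv tw; rewrite (gDr tu (tangentN tv) tw) (gNr tv tw). Qed.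

Lemma g_suml p (I : Type) (r : seq I) (P : pred I) (a : I -> R) (u : I -> tvec) w :
  (forall i, tangent p (u i)) -> tangent p w ->
  g p (\sum_(i <- r | P i) a i *: u i) w = \sum_(i <- r | P i) a i * g p (u i) w.
Proof.
move=> tu tw; elim: r => [|i r IH]; first by rewrite !big_nil g0l.
rewrite !big_cons; case: ifP => // _; rewrite gDl ?IH ?gZl //; first exact: tangentZ.
exact: tangent_sum.
Qed.

Lemma g_sumr p (I : Type) (r : seq I) (P : pred I) (a : I -> R) (u : I -> tvec) w :
  (forall i, tangent p (u i)) -> tangent p w ->
  g p w (\sum_(i <- r | P i) a i *: u i) = \sum_(i <- r | P i) a i * g p w (u i).
Proof.
move=> tu tw; rewrite gC //; last exact: tangent_sum.
by rewrite g_suml //; apply: eq_bigr => i _; rewrite gC.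
Qed.

Lemma g_ge0 p u : tangent p u -> 0 <= g p u u.
Proof.
move=> tu; have [->|/eqP u0] := eqVneq u 0; first by rewrite g0l //; exact: tangent0.
by apply/ltW/Defs.metric_pos.
Qed.

Lemma g_eq0 p u : tangent p u -> g p u u = 0 -> u = 0.
Proof.
move=> tu e; have [//|/eqP u0] := eqVneq u 0.
by have := Defs.metric_pos g tu u0; rewrite e ltxx.
Qed.

Definition ip X Y : M -> R := fun p => g p (X p) (Y p).

Lemma ip_smooth X Y : vector_field X -> vector_field Y -> smooth_fun (ip X Y).
Proof. exact: Defs.metric_smooth. Qed.

Lemma ipC X Y : vector_field X -> vector_field Y -> ip X Y = ip Y X.
Proof. by move=> vX vY; apply/funext => p; apply: gC; exact: vf_tan. Qed.

Section LinearConnection.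
Variable D : (M -> tvec) -> (M -> tvec) -> (M -> tvec).
Hypothesis cD : linear_connection D.
Hypothesis tD : torsion_free D.

Lemma conn_vf X Y : vector_field X -> vector_field Y -> vector_field (D X Y).
Proof. by case: cD => H _ _ _; exact: H. Qed.

Lemma connDl X X' Y : vector_field X -> vector_field X' -> vector_field Y ->
  D (X + X') Y = D X Y + D X' Y.
Proof.
move=> vX vX' vY; have [_ H _ _] := cD.
have s1 := @smooth_fun_cst R n M 1.
have E Z : scale_field (fun=> 1) Z = Z by apply/funext => p; rewrite /scale_field scale1r.
by have := H _ _ _ _ s1 vX vX' vY; rewrite !E.
Qed.

Lemma connNl X Y : vector_field X -> vector_field Y -> D (- X) Y = - D X Y.
Proof.
move=> vX vY; have H0 : D 0 Y = 0.
  have := connDl (@vf0 R n M) (@vf0 R n M) vY; rewrite addr0 => e.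
  by apply: (addrI (D 0 Y)); rewrite addr0 -e.
have := connDl vX (vfN vX) vY; rewrite subrr H0 => e.
by apply: (addrI (D X Y)); rewrite subrr -e.
Qed.

Lemma connDr X Y Y' : vector_field X -> vector_field Y -> vector_field Y' ->
  D X (Y + Y') = D X Y + D X Y'.
Proof. by case: cD => _ _ H _; exact: H. Qed.

Lemma connNr X Y : vector_field X -> vector_field Y -> D X (- Y) = - D X Y.
Proof.
move=> vX vY; have H0 : D X 0 = 0.
  have := connDr vX (@vf0 R n M) (@vf0 R n M); rewrite addr0 => e.
  by apply: (addrI (D X 0)); rewrite addr0 -e.
have := connDr vX vY (vfN vY); rewrite subrr H0 => e.
by apply: (addrI (D X Y)); rewrite subrr -e.
Qed.

Lemma connBr X Y Y' : vector_field X -> vector_field Y -> vector_field Y' ->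
  D X (Y - Y') = D X Y - D X Y'.
Proof. by move=> vX vY vY'; rewrite (connDr vX vY (vfN vY')) (connNr vX vY'). Qed.

Lemma bracketE X Y : vector_field X -> vector_field Y -> lie_bracket X Y = D X Y - D Y X.
Proof. by move=> vX vY; rewrite (tD vX vY). Qed.

Lemma bracket_vf X Y : vector_field X -> vector_field Y -> vector_field (lie_bracket X Y).
Proof.
move=> vX vY; rewrite (bracketE vX vY).
exact: (vfB (conn_vf vX vY) (conn_vf vY vX)).
Qed.

Lemma curvature_vf X Y Z : vector_field X -> vector_field Y -> vector_field Z ->
  vector_field (curvature D X Y Z).
Proof.
move=> vX vY vZ; have h1 := conn_vf vX (conn_vf vY vZ); have h2 := conn_vf vY (conn_vf vX vZ).
exact: (vfB (vfB h1 h2) (conn_vf (bracket_vf vX vY) vZ)).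
Qed.

Lemma curvatureDm X Y Y' Z : vector_field X -> vector_field Y -> vector_field Y' ->
  vector_field Z -> curvature D X (Y + Y') Z = curvature D X Y Z + curvature D X Y' Z.
Proof.
move=> vX vY vY' vZ; have vYY := vfD vY vY'.
have vb := bracket_vf vX vY; have vb' := bracket_vf vX vY'.
have e : lie_bracket X (Y + Y') = lie_bracket X Y + lie_bracket X Y'.
  rewrite (bracketE vX vYY) (bracketE vX vY) (bracketE vX vY') (connDr vX vY vY').
  by rewrite (connDl vY vY' vX) opprD addrACA.
have v1 := conn_vf vY vZ; have v2 := conn_vf vY' vZ; have v3 := conn_vf vX vZ.
rewrite /curvature e (connDl vb vb' vZ) (connDl vY vY' vZ) (connDr vX v1 v2) (connDl vY vY' v3).
by rewrite [X in X - _ = _]subDD subDD.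
Qed.

Lemma curvatureDr X Y Z Z' : vector_field X -> vector_field Y -> vector_field Z ->
  vector_field Z' -> curvature D X Y (Z + Z') = curvature D X Y Z + curvature D X Y Z'.
Proof.
move=> vX vY vZ vZ'; have vb := bracket_vf vX vY.
have vXZ := conn_vf vX vZ; have vXZ' := conn_vf vX vZ'.
have vYZ := conn_vf vY vZ; have vYZ' := conn_vf vY vZ'.
rewrite /curvature (connDr vb vZ vZ') (connDr vX vZ vZ') (connDr vY vZ vZ').
rewrite (connDr vX vYZ vYZ') (connDr vY vXZ vXZ').
by rewrite [X in X - _ = _]subDD subDD.
Qed.

Lemma curvatureN X Y Z : vector_field X -> vector_field Y -> vector_field Z ->
  curvature D Y X Z = - curvature D X Y Z.
Proof.
move=> vX vY vZ; rewrite /curvature.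
have -> : lie_bracket Y X = - lie_bracket X Y.
  by rewrite (bracketE vX vY) (bracketE vY vX) opprB.
by rewrite (connNl (bracket_vf vX vY) vZ) opprK !opprB addrC.
Qed.

Lemma jacobi X Y Z : vector_field X -> vector_field Y -> vector_field Z ->
  lie_bracket X (lie_bracket Y Z) + lie_bracket Y (lie_bracket Z X) +
  lie_bracket Z (lie_bracket X Y) = 0.
Proof.
move=> vX vY vZ; apply/funext => p.
have vYZ := bracket_vf vY vZ; have vZX := bracket_vf vZ vX; have vXY := bracket_vf vX vY.
apply: tangent_eq => [||f sf].
- exact: (tangentD (tangentD (vf_tan p (bracket_vf vX vYZ)) (vf_tan p (bracket_vf vY vZX))) (vf_tan p (bracket_vf vZ vXY))).
- exact: tangent0.
have sb U V : vector_field U -> vector_field V -> smooth_fun (fun q => U q (fun q => V q f)).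
  by move=> vU vV; exact: (vf_smooth vU (vf_smooth vV sf)).
have E U V W : vector_field U -> vector_field V -> vector_field W ->
  lie_bracket U (lie_bracket V W) p f =
  U p (fun q => V q (fun r => W r f)) - U p (fun q => W q (fun r => V r f)) -
  (V p (fun q => W q (fun r => U r f)) - W p (fun q => V q (fun r => U r f))).
  move=> vU vV vW; rewrite {1}/lie_bracket /lie_derivative.
  rewrite -(tanB (vf_tan p vU) (sb V W vV vW) (sb W V vW vV)).
  by rewrite {2}/lie_bracket /lie_derivative.
rewrite !fctE (E X Y Z vX vY vZ) (E Y Z X vY vZ vX) (E Z X Y vZ vX vY).
have J (a b c d e1 e2 : R) :
  a - b - (c - e1) + (c - d - (e2 - b)) + (e2 - e1 - (a - d)) = 0 by ring.
exact: J.
Qed.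

Lemma bianchi X Y Z : vector_field X -> vector_field Y -> vector_field Z ->
  curvature D X Y Z + curvature D Y Z X + curvature D Z X Y = 0.
Proof.
move=> vX vY vZ; rewrite -(jacobi vX vY vZ) /curvature.
have vXY := bracket_vf vX vY; have vYZ := bracket_vf vY vZ; have vZX := bracket_vf vZ vX.
rewrite (bracketE vX vYZ) (bracketE vY vZX) (bracketE vZ vXY).
have e1 : D X (lie_bracket Y Z) = D X (D Y Z) - D X (D Z Y).
  by rewrite (bracketE vY vZ) (connBr vX (conn_vf vY vZ) (conn_vf vZ vY)).
have e2 : D Y (lie_bracket Z X) = D Y (D Z X) - D Y (D X Z).
  by rewrite (bracketE vZ vX) (connBr vY (conn_vf vZ vX) (conn_vf vX vZ)).
have e3 : D Z (lie_bracket X Y) = D Z (D X Y) - D Z (D Y X).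
  by rewrite (bracketE vX vY) (connBr vZ (conn_vf vX vY) (conn_vf vY vX)).
rewrite e1 e2 e3; apply/funext => p; apply/funext => f; rewrite !fctE.
ring.
Qed.

End LinearConnection.

Lemma lc_metric D X Y Z p : levi_civita g D -> vector_field X -> vector_field Y ->
  vector_field Z -> X p (ip Y Z) = ip (D X Y) Z p + ip Y (D X Z) p.
Proof.
case=> _ _ H vX vY vZ; have := H X Y Z vX vY vZ p; rewrite /cov_metric /lie_derivative.
by rewrite -/(ip Y Z) -/(ip (D X Y) Z p) -/(ip Y (D X Z) p) => /eqP; rewrite subr_eq0 subr_eq addrC => /eqP.
Qed.

(** Koszul's argument on the difference of the two connections: [S] says that it is symmetric in its
    two arguments, [E] gives its symmetrisation in the last two slots, and cyclic permutations solve
    for it. *)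
Lemma weyl_nabla D nab theta X Y Z p : weyl_connection g D -> levi_civita g nab ->
  lee_form g D theta -> vector_field X -> vector_field Y -> vector_field Z ->
  ip (D X Y) Z p = ip (nab X Y) Z p + theta p (X p) * ip Y Z p +
    theta p (Y p) * ip X Z p - theta p (Z p) * ip X Y p.
Proof.
move=> [cD tD _] LC [_ HL]; have [cN tN _] := LC.
have S U V W : vector_field U -> vector_field V -> vector_field W ->
  ip (D U V) W p - ip (D V U) W p = ip (nab U V) W p - ip (nab V U) W p.
  move=> vU vV vW; have tW := vf_tan p vW.
  rewrite /ip -(gBl (vf_tan p (conn_vf cD vU vV)) (vf_tan p (conn_vf cD vV vU)) tW).
  rewrite -(gBl (vf_tan p (conn_vf cN vU vV)) (vf_tan p (conn_vf cN vV vU)) tW).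
  by have := tD U V vU vV; rewrite -(tN U V vU vV) => /(congr1 (fun F => F p)); rewrite !fctE => ->.
have E U V W : vector_field U -> vector_field V -> vector_field W ->
  (ip (D U V) W p - ip (nab U V) W p) + (ip (D U W) V p - ip (nab U W) V p) =
  2 * theta p (U p) * ip V W p.
  move=> vU vV vW; have := HL U V W vU vV vW p.
  rewrite /cov_metric /lie_derivative -/(ip V W) (lc_metric p LC vU vV vW).
  rewrite -/(ip (D U V) W p) -/(ip V (D U W) p) -/(ip V W p).
  rewrite (ipC vV (conn_vf cN vU vW)) (ipC vV (conn_vf cD vU vW)); lra.
move=> vX vY vZ.
have s1 := S X Y Z vX vY vZ; have s2 := S Y Z X vY vZ vX; have s3 := S Z X Y vZ vX vY.
have e1 := E X Y Z vX vY vZ; have e2 := E Y Z X vY vZ vX; have e3 := E Z X Y vZ vX vY.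
rewrite (ipC vZ vX) in e2; lra.
Qed.

End Connections.

(** * Local orthonormal frames of distributions *)

Section Frames.
Context {R : realType} {n : nat} (M : smoothManifold R n).
Local Notation tvec := ((M -> R) -> R^o).
Implicit Types (p q : M) (f h : M -> R) (u v w : tvec) (X Y Z : M -> tvec).
Variable g : riemannianMetric M.

(** Square roots are smooth only where the function is positive, so a function positive at [p] is
    first modified away from [p]. *)
Lemma positive_extension f p : smooth_fun f -> 0 < f p ->
  exists h, [/\ smooth_fun h, forall q, 0 < h q & \forall q \near p, h q = f q].
Proof.
move=> sf fp.
have nO : nbhs p [set q | 0 < f q] by exact: (cvgr_gt _ (smooth_fun_cont sf (x := p))).
have [chi [K [schi _ chi1 [_ KO] chi0]]] := bump_function nO.
have s1 := @smooth_fun_cst R n M 1.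
have sd : smooth_fun (fun q => 1 - chi q) := smooth_funB s1 schi.
(* The squares make the second term nonnegative and the weight of [f] nonnegative with no upper
   bound on [chi]; wherever [chi] is nonzero, [f] is positive. *)
exists (fun q => chi q * chi q * f q + (1 - chi q) * (1 - chi q)); split.
- exact: (smooth_funD (smooth_funM (smooth_funM schi schi) sf) (smooth_funM sd sd)).
- move=> q; have [/KO/= fq|/chi0 ->] := pselect (K q); last first.
    by rewrite !mul0r add0r subr0 mulr1.
  have [c0|c0] := eqVneq (chi q) 0; first by rewrite c0 !mul0r add0r subr0 mulr1.
  rewrite ltr_pwDl // -expr2 ?sqr_ge0 // mulr_gt0 // lt_neqAle eq_sym sqrf_eq0 c0.
  exact: sqr_ge0.
- by apply: near_mono chi1 => q ->; rewrite subrr mulr0 addr0 !mul1r.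
Qed.

Lemma smooth_fun_rsqrt f p : smooth_fun f -> 0 < f p ->
  exists2 h, smooth_fun h & \forall q \near p, 0 < f q /\ h q = (Num.sqrt (f q))^-1.
Proof.
move=> sf fp; have [h [sh h0 hf]] := positive_extension sf fp.
exists (fun q => (Num.sqrt (h q))^-1).
  apply: smooth_funV => [q|]; first by rewrite gt_eqF // sqrtr_gt0.
  move=> c ac; apply: smooth_sqrt (sh c ac); first exact: img_open.
  by move=> x _; exact: h0.
by apply: near_mono hf => q <-.
Qed.

Definition lspan (k : nat) (X : nat -> M -> tvec) q (v : tvec) :=
  exists a : nat -> R, v = \sum_(i < k) a i *: X i q.

Lemma lspan_in k (X : nat -> M -> tvec) q i : (i < k)%N -> lspan k X q (X i q).
Proof.
move=> ik; exists (fun j => (j == i)%:R); rewrite (bigD1 (Ordinal ik)) //= eqxx scale1r.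
rewrite big1 ?addr0 // => j; rewrite -val_eqE /= => /negbTE ->.
by rewrite scale0r.
Qed.

Lemma lspan_comb k (X : nat -> M -> tvec) q (r : nat) (a : 'I_r -> R) (v : 'I_r -> tvec) :
  (forall i, lspan k X q (v i)) -> lspan k X q (\sum_i a i *: v i).
Proof.
move=> /choice [b Hb]; exists (fun j => \sum_i a i * b i j).
under eq_bigr => i _ do rewrite Hb scaler_sumr.
rewrite exchange_big /=; apply: eq_bigr => j _.
by rewrite scaler_suml; apply: eq_bigr => i _; rewrite scalerA.
Qed.

Lemma lspan_lin k (X : nat -> M -> tvec) q (a : R) u v : lspan k X q u -> lspan k X q v -> lspan k X q (a *: u + v).
Proof.
move=> [b ->] [d ->]; exists (fun j => a * b j + d j).
rewrite scaler_sumr -big_split /=; apply: eq_bigr => i _.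
by rewrite scalerDl scalerA.
Qed.

Lemma lspan_mono k (X : nat -> M -> tvec) q v : lspan k X q v -> lspan k.+1 X q v.
Proof.
move=> [a ->]; exists (fun i => if i == k then 0 else a i).
rewrite big_ord_recr /= eqxx scale0r addr0; apply: eq_bigr => i _.
by rewrite ltn_eqF.
Qed.

(** The fields are global, while orthonormality holds on a neighbourhood that shrinks at each step.
    Both inclusions of spans are carried along, so that the final frame spans the same subspaces as
    the given one. *)
Lemma gram_schmidt r p (X : nat -> M -> tvec) : (forall i, vector_field (X i)) ->
  (\forall q \near p, forall a : nat -> R, \sum_(i < r) a i *: X i q = 0 ->
     forall i, (i < r)%N -> a i = 0) ->
  forall k, (k <= r)%N -> exists e : nat -> M -> tvec, (forall i, vector_field (e i)) /\
   \forall q \near p, [/\ forall i j, (i < k)%N -> (j < k)%N -> g q (e i q) (e j q) = (i == j)%:R,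
     forall i, (i < k)%N -> lspan k X q (e i q) &
     forall i, (i < k)%N -> lspan k e q (X i q)].
Proof.
move=> vX iX; elim=> [|k IH] kr.
  by exists X; split => //; apply: near_mono iX => q _; split.
have [e [ve He]] := IH (ltnW kr).
pose y := X k - (fun q => \sum_(i < k) g q (X k q) (e i q) *: e i q).
have vs : vector_field (fun q => \sum_(i < k) g q (X k q) (e i q) *: e i q).
  by apply: vf_sum => i; [exact: (ip_smooth g (vX k) (ve i))|exact: ve].
have vy : vector_field y := vfB (vX k) vs.
have ty q := vf_tan q vy; have te i q := vf_tan q (ve i).
have yE q : X k q = \sum_(i < k) g q (X k q) (e i q) *: e i q + y q.
  by apply/esym; exact: subrKC.
have y0 : \forall q \near p, y q <> 0.
  apply: filterS2 iX He => q Hi [_ eX _] yq.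
  have := yE q; rewrite yq addr0 => Xk.
  have : lspan k X q (X k q) by rewrite Xk; apply: lspan_comb => i; exact: eX.
  move=> [a Xa].
  have := Hi (fun i => if (i < k)%N then a i else if i == k then -1 else 0) _ k kr.
  rewrite ltnn eqxx => H; have /eqP : (-1 : R) = 0.
    apply: H; rewrite -(big_mkord xpredT (fun i => (if (i < k)%N then a i else if i == k then -1 else 0) *: X i q)).
    rewrite (@big_cat_nat _ _ _ k.+1) //= big_nat_recr //= ltnn eqxx.
    rewrite [X in _ + X]big1_seq ?addr0; last first.
      move=> i /=; rewrite mem_index_iota => /andP[ki _].
      by rewrite ltnNge (ltnW ki) /= gtn_eqF // scale0r.
    rewrite big_mkord scaleN1r Xa; apply/eqP; rewrite subr_eq0; apply/eqP.
    by apply: eq_bigr => i _; rewrite ltn_ord.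
  by rewrite oppr_eq0 oner_eq0.
have gy : 0 < ip g y y p by apply: Defs.metric_pos => //; exact: (nbhs_singleton y0).
have [h sh hE] := smooth_fun_rsqrt (ip_smooth g vy vy) gy.
pose e' i := if i == k then scale_field h y else e i.
exists e'; split=> [i|].
  by rewrite /e'; case: eqP => _; [exact: vfZ sh vy|exact: ve].
apply: filterS2 He hE => q [eo eX Xe] [gyq hq].
have e'k : e' k q = h q *: y q by rewrite /e' eqxx.
have e'l i : (i < k)%N -> e' i q = e i q by move=> ik; rewrite /e' ltn_eqF.
have h2 : h q * h q * ip g y y q = 1.
  rewrite hq -expr2 exprVn sqr_sqrtr ?(ltW gyq) // mulVf // gt_eqF //.
have ye i : (i < k)%N -> g q (y q) (e i q) = 0.
  move=> ik; have := yE q; move/(congr1 (fun w => g q w (e i q))).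
  have ts : tangent q (\sum_(i < k) g q (X k q) (e i q) *: e i q).
    by apply: tangent_sum => j; exact: te.
  rewrite (gDl g ts (ty q) (te i q)).
  rewrite g_suml // (bigD1 (Ordinal ik)) //= eo // eqxx mulr1 big1 ?addr0 => [|j ji].
    by rewrite -[LHS]addr0 => /addrI <-.
  rewrite eo //; move: ji; rewrite -val_eqE /= => /negbTE ->; exact: mulr0.
have hn0 : h q != 0.
  by apply/negP => /eqP h0; move: h2; rewrite h0 !mul0r => /eqP; rewrite eq_sym oner_eq0.
have yX : lspan k.+1 X q (y q).
  have -> : y q = (-1) *: (\sum_(i < k) g q (X k q) (e i q) *: e i q) + X k q.
    by rewrite scaleN1r; exact: addrC.
  apply: lspan_lin; last by exact: lspan_in.
  by apply: lspan_comb => i; apply: lspan_mono; exact: eX.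
have eE' j : (j < k)%N -> lspan k.+1 e' q (e j q).
  by move=> jk; rewrite -e'l //; apply: lspan_in; exact: ltnW.
split.
- move=> i j; rewrite ltnS leq_eqVlt => /orP[/eqP->|ik];
    rewrite ltnS leq_eqVlt => /orP[/eqP->|jk].
  + rewrite eqxx e'k (gZl g _ (ty q) (tangentZ _ (ty q))) (gZr g _ (ty q) (ty q)) mulrA.
    exact: h2.
  + by rewrite e'k e'l // gZl // ye // mulr0 gtn_eqF.
  + by rewrite e'k e'l // gZr // gC // ye // mulr0 ltn_eqF.
  + by rewrite !e'l // eo.
- move=> i; rewrite ltnS leq_eqVlt => /orP[/eqP->|ik].
    rewrite e'k -[h q *: _]addr0; apply: lspan_lin => //.
    by exists (fun=> 0); rewrite big1 // => j _; rewrite scale0r.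
  by rewrite e'l //; apply: lspan_mono; exact: eX.
- move=> i; rewrite ltnS leq_eqVlt => /orP[/eqP->|ik].
    rewrite yE addrC; have -> : y q = (h q)^-1 *: e' k q by rewrite e'k scalerA mulVf ?scale1r.
    apply: lspan_lin; first by exact: lspan_in.
    by apply: lspan_comb => j; exact: eE'.
  have [a ->] := Xe i ik.
  by apply: (@lspan_comb k.+1 e' q k (fun j => a j) (fun j => e j q)) => j; exact: eE'.
Qed.

(** The members are global sections because [parallel] and the connections speak of global fields
    only; a frame is obtained near [p] alone. *)
Definition on_frame (T : M -> set tvec) r p (e : 'I_r -> M -> tvec) :=
  (forall i, section_of T (e i)) /\
  \forall q \near p, (forall i j, g q (e i q) (e j q) = (i == j)%:R) /\
    forall v, T q v <-> v = \sum_i g q v (e i q) *: e i q.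

Definition lin_closed (T : M -> set tvec) := forall q,
  [/\ T q 0, forall (a : R) u v, T q u -> T q v -> T q (a *: u + v) & forall v, T q v -> tangent q v].

Lemma distribution_lin r T : smooth_distribution r T -> lin_closed T.
Proof.
move=> sT q; have [X [vX /nbhs_singleton[_ ->]]] := sT q; split=> /=.
- by exists (fun=> 0); rewrite big1 // => i _; rewrite scale0r.
- move=> a _ _ [b ->] [d ->]; exists (fun i => a * b i + d i).
  rewrite scaler_sumr -big_split /=; apply: eq_bigr => i _.
  by rewrite scalerDl scalerA.
- by move=> _ [b ->]; apply: tangent_sum => i; exact: vf_tan.
Qed.

Lemma on_frame_exists r T p : (0 < r)%N -> smooth_distribution r T ->
  exists e : 'I_r -> M -> tvec, on_frame T p e.
Proof.
move=> r0 sT; have lT := distribution_lin sT; have [X [vX HX]] := sT p.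
pose X' (i : nat) := if insub i is Some j then X j else 0.
have X'E (i : 'I_r) : X' i = X i by rewrite /X' valK.
have vX' i : vector_field (X' i) by rewrite /X'; case: insubP => [j _ _|_]; [exact: vX|exact: vf0].
have iX' : \forall q \near p, forall a : nat -> R, \sum_(i < r) a i *: X' i q = 0 ->
     forall i, (i < r)%N -> a i = 0.
  apply: near_mono HX => q [iq _] a aX i ir.
  have := iq (fun i : 'I_r => a i) _ (Ordinal ir); apply; rewrite -[RHS]aX.
  by apply: eq_bigr => j _; rewrite X'E.
have [e [ve He]] := gram_schmidt vX' iX' (leqnn r).
pose A q : Prop := (forall a : 'I_r -> R, \sum_i a i *: X i q = 0 -> forall i, a i = 0) /\
  T q = [set v | exists a : 'I_r -> R, v = \sum_i a i *: X i q].
pose B q : Prop := [/\ forall i j, (i < r)%N -> (j < r)%N -> g q (e i q) (e j q) = (i == j)%:R,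
  forall i, (i < r)%N -> lspan r X' q (e i q) &
  forall i, (i < r)%N -> lspan r e q (X' i q)].
have nO : nbhs p [set q | A q /\ B q] by apply: filterS2 HX He => q; split.
have [chi [K [schi _ chi1 [_ KO] chi0]]] := bump_function nO.
have TE q : A q -> forall v, T q v <-> lspan r X' q v.
  move=> [_ ->] v; split=> [[a ->]|[a ->]] /=.
    exists (fun i => if insub i is Some j then a j else 0); apply: eq_bigr => i _.
    by rewrite X'E valK.
  by exists (fun i => a i); apply: eq_bigr => i _; rewrite X'E.
(* The cutoff keeps the fields inside [T] everywhere, as they are 0 outside [K]. *)
exists (fun i => scale_field chi (e i)); split.
- move=> i; split; first exact: vfZ schi (ve i).
  move=> q; rewrite /scale_field; have [/KO[HXq [_ eX _]]|/chi0->] := pselect (K q); last first.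
    by rewrite scale0r; have [] := lT q.
  have [T0 Tl _] := lT q; rewrite -[chi q *: _]addr0; apply: Tl => //.
  by apply/(TE _ HXq); exact: eX.
- apply: filterS2 nO chi1 => q [HXq [eo eX Xe]] c1.
  have es i : scale_field chi (e i) q = e i q by rewrite /scale_field c1 scale1r.
  have te i := vf_tan q (ve i).
  split=> [i j|v]; first by rewrite !es eo.
  split=> [/(TE _ HXq)[a va]|->].
    have [b vb] : lspan r e q v.
      rewrite va; apply: (@lspan_comb r e q r (fun i => a i) (fun i => X' i q)) => i; exact: Xe.
    rewrite [LHS]vb; apply: eq_bigr => i _; rewrite es; congr (_ *: _).
    rewrite vb g_suml // (bigD1 i) //= eo // eqxx mulr1 big1 ?addr0 // => j ji.
    by rewrite eo // val_eqE (negbTE ji) mulr0.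
  have [T0 Tl _] := lT q; elim/big_rec: _ => // i w _ Tw; apply: Tl => //.
  by rewrite es; apply/(TE _ HXq); exact: eX.
Qed.

(** Near [p] the field is the sum of theta(e_i) e_i over a local orthonormal frame. Its products
    with [T] determine it, so different frames agree and the local fields glue without a partition
    of unity. *)
Lemma dual_field r T (theta : M -> tvec -> R) : (0 < r)%N -> smooth_distribution r T ->
  one_form theta -> exists2 H, section_of T H & forall p v, T p v -> g p (H p) v = theta p v.
Proof.
move=> r0 sT [thl ths]; have lT := distribution_lin sT.
have [e He] := choice (fun p => on_frame_exists p r0 sT).
pose H0 p q := \sum_i theta q (e p i q) *: e p i q.
have ve p i : vector_field (e p i) by have [/(_ i)[]] := He p.
have te p i q := vf_tan q (ve p i).
have Te p i q : T q (e p i q) by have [/(_ i)[_ H] _] := He p; exact: H.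
have TH p q : T q (H0 p q).
  have [T0 Tl _] := lT q; rewrite /H0; elim/big_rec: _ => // i w _ Tw; exact: Tl.
have th_sum p q (a : 'I_r -> R) : theta q (\sum_i a i *: e p i q) = \sum_i a i * theta q (e p i q).
  have th0 : theta q 0 = 0.
    have := thl q 1 0 0 (@tangent0 R n M q) (@tangent0 R n M q).
    by rewrite scale1r mul1r addr0 => e0; apply: (addrI (theta q 0)); rewrite addr0 -e0.
  elim: (index_enum _) => [|i s IH]; first by rewrite !big_nil.
  rewrite !big_cons -IH; apply: thl; first exact: te.
  by apply: tangent_sum => j; exact: te.
have HE p : \forall q \near p, forall v, T q v -> g q (H0 p q) v = theta q v.
  have [_] := He p; apply: near_mono => q [eo eT] v /eT ->.
  rewrite th_sum g_sumr; last 2 first.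
  - by move=> i; exact: te.
  - by have [_ _ Tt] := lT q; exact: Tt.
  apply: eq_bigr => i _; congr (_ * _); rewrite /H0 g_suml //.
  by rewrite (bigD1 i) //= eo eqxx mulr1 big1 ?addr0 // => j ji; rewrite eo (negbTE ji) mulr0.
exists (fun p => H0 p p); last by move=> p v Tv; exact: (nbhs_singleton (HE p)).
split; last by move=> p; exact: TH.
apply: vf_local => p; exists (H0 p).
  by apply: vf_sum => i; [exact: ths|exact: ve].
apply: near_mono (HE p) => q HEq.
have HEqq := nbhs_singleton (HE q).
have [_ Tl Tt] := lT q.
have t1 := Tt _ (TH p q); have t2 := Tt _ (TH q q).
have Tz : T q (H0 q q - H0 p q) by rewrite addrC -scaleN1r; exact: Tl.
apply/eqP; rewrite -subr_eq0; apply/eqP; apply: (g_eq0 (g := g)); first exact: Tt.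
by rewrite (gBl g t2 t1 (Tt _ Tz)) HEq // HEqq // subrr.
Qed.

End Frames.

(** * Conformal products *)

Section ConformalProduct.
Context {R : realType} {n : nat} (M : smoothManifold R n).
Local Notation tvec := ((M -> R) -> R^o).
Implicit Types (p q : M) (f h : M -> R) (u v w : tvec) (X Y Z W V x y : M -> tvec).
Variable g : riemannianMetric M.
Variables nab : (M -> tvec) -> (M -> tvec) -> (M -> tvec).

Local Notation "<< X , Y >>" := (ip g X Y).

Section LeviCivita.
Hypothesis LC : levi_civita g nab.

Lemma lc_vf X Y : vector_field X -> vector_field Y -> vector_field (nab X Y).
Proof. by case: LC => cN _ _; exact: conn_vf. Qed.

Lemma lc_bracket X Y : vector_field X -> vector_field Y ->
  lie_bracket X Y = nab X Y - nab Y X.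
Proof. by case: LC => _ tN _; exact: bracketE. Qed.

Lemma lc_bracket_vf X Y : vector_field X -> vector_field Y -> vector_field (lie_bracket X Y).
Proof. by case: LC => cN tN _; exact: (bracket_vf cN). Qed.

Lemma ipDl X Y Z p : vector_field X -> vector_field Y -> vector_field Z ->
  <<X + Y, Z>> p = <<X, Z>> p + <<Y, Z>> p.
Proof. by move=> vX vY vZ; exact: (gDl g (vf_tan p vX) (vf_tan p vY) (vf_tan p vZ)). Qed.

Lemma ipBl X Y Z p : vector_field X -> vector_field Y -> vector_field Z ->
  <<X - Y, Z>> p = <<X, Z>> p - <<Y, Z>> p.
Proof. by move=> vX vY vZ; exact: (gBl g (vf_tan p vX) (vf_tan p vY) (vf_tan p vZ)). Qed.

Lemma lc_norm X Y p : vector_field X -> vector_field Y ->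
  X p <<Y, Y>> = 2 * <<nab X Y, Y>> p.
Proof.
move=> vX vY; rewrite (lc_metric p LC vX vY vY) (ipC g vY (lc_vf vX vY)); ring.
Qed.

Lemma curvature_ip X Y Z W p : vector_field X -> vector_field Y -> vector_field Z ->
  vector_field W -> <<curvature nab X Y Z, W>> p =
    X p <<nab Y Z, W>> - <<nab Y Z, nab X W>> p -
    (Y p <<nab X Z, W>> - <<nab X Z, nab Y W>> p) - <<nab (lie_bracket X Y) Z, W>> p.
Proof.
move=> vX vY vZ vW; have vYZ := lc_vf vY vZ; have vXZ := lc_vf vX vZ.
have h1 := lc_vf vX vYZ; have h2 := lc_vf vY vXZ; have h3 := lc_vf (lc_bracket_vf vX vY) vZ.
rewrite /curvature (ipBl p (vfB h1 h2) h3 vW) (ipBl p h1 h2 vW).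
by rewrite (lc_metric p LC vX vYZ vW) (lc_metric p LC vY vXZ vW) !addrK.
Qed.

Lemma curvature_skew X Y Z p : vector_field X -> vector_field Y -> vector_field Z ->
  <<curvature nab X Y Z, Z>> p = 0.
Proof.
move=> vX vY vZ; have vB := lc_bracket_vf vX vY.
rewrite (curvature_ip p vX vY vZ vZ).
have half V : vector_field V -> <<nab V Z, Z>> = (fun q => 2^-1 * (fun r => V r <<Z, Z>>) q).
  move=> vV; apply/funext => q; rewrite (lc_norm q vV vZ) mulrA mulVf ?mul1r //.
have sZ := ip_smooth g vZ vZ.
have e V W : vector_field V -> vector_field W ->
    V p <<nab W Z, Z>> = 2^-1 * V p (fun r => W r <<Z, Z>>).
  by move=> vV vW; rewrite (half W vW); exact: (tanZ _ (vf_tan p vV) (vf_smooth vW sZ)).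
rewrite (e X Y vX vY) (e Y X vY vX) (half _ vB) {1}/lie_bracket /lie_derivative.
rewrite (ipC g (lc_vf vY vZ) (lc_vf vX vZ)); ring.
Qed.

End LeviCivita.

(** A structure with its ranks, a Lee form and the dual sections [H1], [H2] made explicit. The
    curvature condition is freed of its quotient, and the symmetry between the factors lets
    [cp_swap] transfer each identity to the other one. *)
Record conformal_product D (T1 T2 : M -> set tvec) (theta : M -> tvec -> R) (r1 r2 : nat)
    H1 H2 (kappa : R) : Prop := ConformalProductData {
  cp_lc : levi_civita g nab;
  cp_curv : forall X Y p, vector_field X -> vector_field Y ->
    (forall a b : R, a *: X p + b *: Y p = 0 -> a = 0 /\ b = 0) ->
    <<curvature nab X Y Y, X>> p = kappa * (<<X, X>> p * <<Y, Y>> p - <<X, Y>> p ^+ 2);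
  cp_weyl : weyl_connection g D;
  cp_lee : lee_form g D theta;
  cp_rank1 : (0 < r1)%N; cp_rank2 : (0 < r2)%N;
  cp_dist1 : smooth_distribution r1 T1; cp_dist2 : smooth_distribution r2 T2;
  cp_dec : forall p v, tangent p v -> exists v1 v2, [/\ T1 p v1, T2 p v2 & v = v1 + v2];
  cp_orth : forall p u v, T1 p u -> T2 p v -> g p u v = 0;
  cp_par1 : parallel D T1; cp_par2 : parallel D T2;
  cp_sec1 : section_of T1 H1; cp_sec2 : section_of T2 H2;
  cp_dual1 : forall p v, T1 p v -> g p (H1 p) v = theta p v;
  cp_dual2 : forall p v, T2 p v -> g p (H2 p) v = theta p v }.

Lemma cp_swap D T1 T2 theta r1 r2 H1 H2 kappa :
  conformal_product D T1 T2 theta r1 r2 H1 H2 kappa ->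
  conformal_product D T2 T1 theta r2 r1 H2 H1 kappa.
Proof.
case=> LC K W L l1 l2 d1 d2 dec o p1 p2 s1 s2 e1 e2; split => //.
- by move=> p v /dec[v1 [v2 [t1 t2 ->]]]; exists v2, v1; rewrite addrC.
- move=> p u v t1 t2; have [_ _ t] := distribution_lin d2 p.
  have [_ _ t'] := distribution_lin d1 p.
  by rewrite (gC g (t _ t1) (t' _ t2)); exact: o.
Qed.

Section Identities.
Variables (D : (M -> tvec) -> (M -> tvec) -> (M -> tvec)) (T1 T2 : M -> set tvec).
Variables (theta : M -> tvec -> R) (r1 r2 : nat) (H1 H2 : M -> tvec) (kappa : R).
Hypothesis C : conformal_product D T1 T2 theta r1 r2 H1 H2 kappa.

Lemma cp_vf1 : vector_field H1. Proof. by have [] := cp_sec1 C. Qed.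
Lemma cp_vf2 : vector_field H2. Proof. by have [] := cp_sec2 C. Qed.

Lemma cp_tan1 p v : T1 p v -> tangent p v.
Proof. by have [_ _ H] := distribution_lin (cp_dist1 C) p; exact: H. Qed.

Lemma cp_tan2 p v : T2 p v -> tangent p v.
Proof. by have [_ _ H] := distribution_lin (cp_dist2 C) p; exact: H. Qed.

Lemma cp_ip0 x y p : section_of T1 x -> section_of T2 y -> <<x, y>> p = 0.
Proof. by move=> [_ sx] [_ sy]; exact: (cp_orth C). Qed.

Lemma cp_ip0C x y p : section_of T1 x -> section_of T2 y -> <<y, x>> p = 0.
Proof. by move=> sx sy; rewrite (ipC g (proj1 sy) (proj1 sx)); exact: cp_ip0. Qed.

Lemma cp_theta X p : vector_field X -> theta p (X p) = <<H1, X>> p + <<H2, X>> p.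
Proof.
move=> vX; have tX := vf_tan p vX; have [v1 [v2 [t1 t2 e]]] := cp_dec C tX.
have tv1 := cp_tan1 t1; have tv2 := cp_tan2 t2.
have tH1 := vf_tan p cp_vf1; have tH2 := vf_tan p cp_vf2.
have [[thl _] _] := cp_lee C.
have s1 : T1 p (H1 p) by have [_] := cp_sec1 C; exact.
have s2 : T2 p (H2 p) by have [_] := cp_sec2 C; exact.
have := thl p 1 v1 v2 tv1 tv2; rewrite scale1r mul1r -e => ->.
rewrite /ip e (gDr g tv1 tv2 tH1) (gDr g tv1 tv2 tH2) (cp_orth C s1 t2).
rewrite (gC g tH2 tv1) (cp_orth C t1 s2) (cp_dual1 C t1) (cp_dual2 C t2).
by rewrite addr0 add0r.
Qed.

Lemma cp_theta1 x p : section_of T1 x -> theta p (x p) = <<H1, x>> p.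
Proof. by case=> _ sx; rewrite -(cp_dual1 C (sx p)). Qed.

Lemma cp_theta2 y p : section_of T2 y -> theta p (y p) = <<H2, y>> p.
Proof. by case=> _ sy; rewrite -(cp_dual2 C (sy p)). Qed.

(** D_X x stays in T1, so its product with [y] is 0 and [weyl_nabla] leaves only the terms in the
    Lee form. *)
Lemma nab_mixed X x y p : vector_field X -> section_of T1 x -> section_of T2 y ->
  <<nab X x, y>> p = <<H2, y>> p * <<X, x>> p - <<H1, x>> p * <<X, y>> p.
Proof.
move=> vX sx sy; have [vx _] := sx; have [vy _] := sy.
have := weyl_nabla p (cp_weyl C) (cp_lc C) (cp_lee C) vX vx vy.
rewrite (cp_ip0 p (cp_par1 C vX sx) sy) (cp_ip0 p sx sy) (cp_theta1 p sx) (cp_theta2 p sy).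
lra.
Qed.

Lemma nab_mixedC X x y p : vector_field X -> section_of T1 x -> section_of T2 y ->
  <<nab X y, x>> p = <<H1, x>> p * <<X, y>> p - <<H2, y>> p * <<X, x>> p.
Proof.
move=> vX sx sy; have [vx _] := sx; have [vy _] := sy; have LC := cp_lc C.
have := lc_metric p LC vX vx vy.
have -> : <<x, y>> = (fun=> 0) by apply/funext => q; exact: cp_ip0.
rewrite (tan_cst 0 (vf_tan p vX)) (nab_mixed p vX sx sy) (ipC g vx (lc_vf LC vX vy)); lra.
Qed.

(** [weyl_nabla] is tested against the difference Z of the two sides, which gives g(Z, Z) = 0. *)
Lemma nab_D X Y p : vector_field X -> vector_field Y ->
  nab X Y p = D X Y p - theta p (X p) *: Y p - theta p (Y p) *: X p +
    <<X, Y>> p *: (H1 p + H2 p).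
Proof.
move=> vX vY; have [cD _ _] := cp_weyl C; have LC := cp_lc C.
have [[thl ths] _] := cp_lee C.
have vN := lc_vf LC vX vY; have vD := conn_vf cD vX vY.
have vH := vfD cp_vf1 cp_vf2.
have e1 := vfZ (ths X vX) vY; have e2 := vfZ (ths Y vY) vX.
have e3 := vfZ (ip_smooth g vX vY) vH.
pose V := D X Y - scale_field (fun q => theta q (X q)) Y - scale_field (fun q => theta q (Y q)) X
  + scale_field <<X, Y>> (H1 + H2).
have vV : vector_field V := vfD (vfB (vfB vD e1) e2) e3.
pose Z := nab X Y - V; have vZ : vector_field Z := vfB vN vV.
suff z0 : Z p = 0 by apply/eqP; rewrite -subr_eq0; apply/eqP.
have tZ := vf_tan p vZ; apply: (g_eq0 (g := g) tZ).
have := weyl_nabla p (cp_weyl C) LC (cp_lee C) vX vY vZ.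
rewrite (cp_theta p vZ) => e.
have : <<Z, Z>> p = <<nab X Y, Z>> p - <<V, Z>> p := ipBl p vN vV vZ.
rewrite /V (ipDl p (vfB (vfB vD e1) e2) e3 vZ) (ipBl p (vfB vD e1) e2 vZ) (ipBl p vD e1 vZ).
have gs f W : vector_field W -> <<scale_field f W, Z>> p = f p * <<W, Z>> p.
  by move=> vW; exact: (gZl g _ (vf_tan p vW) tZ).
rewrite (gs _ _ vY) (gs _ _ vX) (gs _ _ vH) (ipDl p cp_vf1 cp_vf2 vZ) e /ip => ->; ring.
Qed.

End Identities.
End ConformalProduct.

(** * Curvature of mixed planes *)

Section Structure.
Context {R : realType} {n : nat} (M : smoothManifold R n).
Local Notation tvec := ((M -> R) -> R^o).
Implicit Types (p q : M) (f h : M -> R) (X Y Z W V x y v w : M -> tvec).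
Variable g : riemannianMetric M.
Variables nab D : (M -> tvec) -> (M -> tvec) -> (M -> tvec).
Variables (theta : M -> tvec -> R) (kappa : R).

Local Notation "<< X , Y >>" := (ip g X Y).
Local Notation product T1 T2 r1 r2 H1 H2 := (conformal_product g nab D T1 T2 theta r1 r2 H1 H2 kappa).

(** In [nab_D] every term but g(x, x') H2 lies in T1. *)
Lemma nab_split T1 T2 r1 r2 H1 H2 x x' p : product T1 T2 r1 r2 H1 H2 ->
  section_of T1 x -> section_of T1 x' ->
  exists2 u, T1 p u & nab x x' p = u + <<x, x'>> p *: H2 p.
Proof.
move=> C sx sx'; have [vx tx] := sx; have [vx' tx'] := sx'.
have [T0 Tl _] := distribution_lin (cp_dist1 C) p.
have [_ s1] := cp_sec1 C; have [_ sD] := cp_par1 C vx sx'.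
exists (- theta p (x p) *: x' p + (- theta p (x' p) *: x p + (<<x, x'>> p *: H1 p + D x x' p))).
  exact: (Tl _ _ _ (tx' p) (Tl _ _ _ (tx p) (Tl _ _ _ (s1 p) (sD p)))).
rewrite (nab_D C p vx vx') scalerDr !scaleNr.
move: (theta p (x p) *: _) (theta p (x' p) *: _) (_ *: H1 p) (_ *: H2 p) (D x x' p) => a b c d e.
by apply/funext => f; rewrite !fctE; ring.
Qed.

Lemma nab_split_mixed T1 T2 r1 r2 H1 H2 x y p : product T1 T2 r1 r2 H1 H2 ->
  section_of T1 x -> section_of T2 y ->
  exists2 u, T1 p u & nab y x p = u - <<H1, x>> p *: y p.
Proof.
move=> C sx sy; have [vx tx] := sx; have [vy ty] := sy.
have [T0 Tl _] := distribution_lin (cp_dist1 C) p.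
have [_ sD] := cp_par1 C vy sx.
exists (- theta p (y p) *: x p + D y x p); first exact: (Tl _ _ _ (tx p) (sD p)).
rewrite (nab_D C p vy vx) (cp_ip0C C p sx sy) scale0r addr0 (cp_theta1 C p sx) scaleNr.
by rewrite [in RHS]addrC [RHS]addrC [- _ + D y x p]addrC.
Qed.

Lemma g_split T1 T2 r1 r2 H1 H2 p (u v u' v' : tvec) : product T1 T2 r1 r2 H1 H2 ->
  T1 p u -> T1 p u' -> T2 p v -> T2 p v' -> g p (u + v) (u' + v') = g p u u' + g p v v'.
Proof.
move=> C tu tu' tv tv'; have au := cp_tan1 C tu; have au' := cp_tan1 C tu'.
have av := cp_tan2 C tv; have av' := cp_tan2 C tv'.
rewrite (gDl g au av (tangentD au' av')) (gDr g au' av' au) (gDr g au' av' av).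
rewrite (cp_orth C tu tv') (gC g av au') (cp_orth C tu' tv); ring.
Qed.

Lemma ip_gt0 x p : vector_field x -> x p <> 0 -> 0 < <<x, x>> p.
Proof. by move=> vx x0; exact: (Defs.metric_pos g (vf_tan p vx) x0). Qed.

Lemma orthogonal_indep x y p : vector_field x -> vector_field y -> x p <> 0 -> y p <> 0 ->
  <<x, y>> p = 0 -> forall a b : R, a *: x p + b *: y p = 0 -> a = 0 /\ b = 0.
Proof.
move=> vx vy x0 y0 o a b e; have tx := vf_tan p vx; have ty := vf_tan p vy.
have k1 : a * <<x, x>> p = 0.
  have := congr1 (fun z : tvec => g p z (x p)) e.
  rewrite (gDl g (tangentZ a tx) (tangentZ b ty) tx) (gZl g a tx tx) (gZl g b ty tx).
  by rewrite (gC g ty tx) -/(ip g x y p) o mulr0 addr0 (g0l g tx).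
have k2 : b * <<y, y>> p = 0.
  have := congr1 (fun z : tvec => g p z (y p)) e.
  rewrite (gDl g (tangentZ a tx) (tangentZ b ty) ty) (gZl g a tx ty) (gZl g b ty ty).
  by rewrite -/(ip g x y p) o mulr0 add0r (g0l g ty).
move: k1 k2 => /eqP; rewrite mulf_eq0 (gt_eqF (ip_gt0 vx x0)) orbF => /eqP -> /eqP.
by rewrite mulf_eq0 (gt_eqF (ip_gt0 vy y0)) orbF => /eqP ->.
Qed.

(** In [curvature_ip] the products that are differentiated mix the two factors, hence are explicit
    in [H1] and [H2] by [nab_mixedC]; the two products of covariant derivatives are computed factor
    by factor in [q1] and [q2]. The homogeneous form makes unit sections unnecessary. *)
Lemma sectional_mixed T1 T2 r1 r2 H1 H2 x y p : product T1 T2 r1 r2 H1 H2 ->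
  section_of T1 x -> section_of T2 y -> x p <> 0 -> y p <> 0 ->
  <<y, y>> p * (<<nab x H1, x>> p - <<H1, x>> p ^+ 2) +
  <<x, x>> p * (<<nab y H2, y>> p - <<H2, y>> p ^+ 2) = kappa * <<x, x>> p * <<y, y>> p.
Proof.
move=> C sx sy x0 y0; have [vx tx] := sx; have [vy ty] := sy; have LC := cp_lc C.
have tvx := vf_tan p vx; have tvy := vf_tan p vy.
have v1 := cp_vf1 C; have v2 := cp_vf2 C; have C' := cp_swap C.
have [_ s1] := cp_sec1 C; have [_ s2] := cp_sec2 C.
have [T10 T1l _] := distribution_lin (cp_dist1 C) p.
have [T20 T2l _] := distribution_lin (cp_dist2 C) p.
have o := cp_ip0 C p sx sy.
have ind := orthogonal_indep vx vy x0 y0 o.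
have := cp_curv C vx vy ind; rewrite o expr0n subr0 mulrA => <-.
have vxy := lc_vf LC vx vy; have vyx := lc_vf LC vy vx.
rewrite (curvature_ip LC p vx vy vy vx) (nab_mixedC C p (lc_bracket_vf LC vx vy) sx sy).
rewrite (lc_bracket LC vx vy) (ipBl g p vxy vyx vx) (ipBl g p vxy vyx vy).
have -> : <<nab y y, x>> = (fun q => <<H1, x>> q * <<y, y>> q).
  by apply/funext => q; rewrite (nab_mixedC C q vy sx sy) (cp_ip0C C q sx sy); ring.
have -> : <<nab x y, x>> = (fun q => - (<<H2, y>> q * <<x, x>> q)).
  by apply/funext => q; rewrite (nab_mixedC C q vx sx sy) (cp_ip0 C q sx sy); ring.
have sm1 := ip_smooth g v1 vx; have sm2 := ip_smooth g v2 vy.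
have smx := ip_smooth g vx vx; have smy := ip_smooth g vy vy.
rewrite (tanM tvx sm1 smy) (tanN tvy (smooth_funM sm2 smx)) (tanM tvy sm2 smx).
rewrite (lc_metric p LC vx v1 vx) (lc_metric p LC vy v2 vy) (lc_norm LC p vx vy) (lc_norm LC p vy vx).
rewrite (nab_mixed C p vy sx sy) (cp_ip0C C p sx sy).
have [A tA eA] := nab_split p C' sy sy; have [B tB eB] := nab_split p C sx sx.
have [E tE eE] := nab_split_mixed p C sx sy; have [F tF eF] := nab_split_mixed p C' sy sx.
have Z1 a : T1 p (a *: H1 p) by rewrite -[_ *: _]addr0; exact: T1l.
have Z2 a : T2 p (a *: H2 p) by rewrite -[_ *: _]addr0; exact: T2l.
have Zx a : T1 p (- (a *: x p)) by rewrite -scaleNr -[_ *: _]addr0; exact: T1l.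
have Zy a : T2 p (- (a *: y p)) by rewrite -scaleNr -[_ *: _]addr0; exact: T2l.
have tH1 := vf_tan p v1; have tH2 := vf_tan p v2.
have tvA := cp_tan2 C tA; have tvB := cp_tan1 C tB.
have tvE := cp_tan1 C tE; have tvF := cp_tan2 C tF.
have q1 : <<nab y y, nab x x>> p =
  <<y, y>> p * <<H1, nab x x>> p + <<x, x>> p * <<H2, nab y y>> p.
  rewrite /ip eA eB addrC (g_split C (Z1 _) tB tA (Z2 _)).
  rewrite (gZl g _ tH1 tvB) (gZr g _ tH2 tvA).
  rewrite (gDr g tvB (tangentZ _ tH2) tH1) (gDr g (tangentZ _ tH1) tvA tH2).
  rewrite (gZr g _ tH2 tH1) (gZr g _ tH1 tH2) (gC g tH2 tH1) (cp_orth C (s1 p) (s2 p)) (gC g tH2 tvA).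
  by rewrite /ip; ring.
have q2 : <<nab x y, nab y x>> p =
  - <<H1, x>> p * <<nab x y, y>> p - <<H2, y>> p * <<nab y x, x>> p.
  rewrite /ip eE eF [F - _]addrC (g_split C (Zx _) tE tF (Zy _)).
  rewrite (gDl g (tangentN (tangentZ _ tvx)) tvF tvy) (gDl g tvE (tangentN (tangentZ _ tvy)) tvx).
  rewrite (gNr g (tangentZ _ tvy) tvF) (gNl g (tangentZ _ tvx) tvE) (gNl g (tangentZ _ tvx) tvy).
  rewrite (gNl g (tangentZ _ tvy) tvx) (gZr g _ tvy tvF) (gZl g _ tvx tvE) (gZl g _ tvx tvy).
  rewrite (gZl g _ tvy tvx) (gC g tvy tvx) -![g p (x p) (y p)]/(ip g x y p) o (gC g tvE tvx).
  rewrite /ip; ring.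
rewrite q1 q2; ring.
Qed.

(* Polarising the sectional curvature of the planes spanned by v and w + x, and
   using the Bianchi identity, gives 2 R(v, w, x, v) = 0. *)
Lemma curvature_mixed0 T1 T2 r1 r2 H1 H2 x v w p : product T1 T2 r1 r2 H1 H2 ->
  section_of T1 x -> section_of T2 v -> section_of T2 w -> <<v, w>> p = 0 ->
  x p <> 0 -> v p <> 0 -> w p <> 0 -> <<curvature nab v w x, v>> p = 0.
Proof.
move=> C sx sv sw o x0 v0 w0.
have [vx tx] := sx; have [vv tv] := sv; have [vw tw] := sw; have LC := cp_lc C.
have [cN tN _] := LC; have vwx := vfD vw vx.
have tvx := vf_tan p vx; have tvv := vf_tan p vv; have tvw := vf_tan p vw.
have oxv := cp_ip0 C p sx sv; have oxw := cp_ip0 C p sx sw.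
have K y : vector_field y -> y p <> 0 -> <<y, v>> p = 0 ->
    <<curvature nab v y y, v>> p = kappa * (<<v, v>> p * <<y, y>> p).
  move=> vy y0 oy; have ov : <<v, y>> p = 0 by rewrite (ipC g vv vy).
  by rewrite (cp_curv C vv vy (orthogonal_indep vv vy v0 y0 ov)) ov expr0n subr0.
have e1 : <<w + x, w>> p = <<w, w>> p by rewrite (ipDl g p vw vx vw) oxw addr0.
have e2 : <<w + x, x>> p = <<x, x>> p.
  by rewrite (ipDl g p vw vx vx) (ipC g vw vx) oxw add0r.
have e3 : <<w + x, w + x>> p = <<w, w>> p + <<x, x>> p.
  by rewrite (ipDl g p vw vx vwx) (ipC g vw vwx) (ipC g vx vwx) e1 e2.
have e4 : <<w + x, v>> p = 0 by rewrite (ipDl g p vw vx vv) (ipC g vw vv) o oxv addr0.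
have n0 : (w + x) p <> 0.
  by move=> z; move: (ip_gt0 vw w0); rewrite -e1 /ip z (g0l g tvw) ltxx.
have cw := curvature_vf cN tN vv vw vx; have cx := curvature_vf cN tN vv vx vw.
have cww := curvature_vf cN tN vv vw vw; have cxx := curvature_vf cN tN vv vx vx.
have := K _ vwx n0 e4; rewrite e3 (curvatureDm cN tN vv vw vx vwx).
rewrite (curvatureDr cN tN vv vw vw vx) (curvatureDr cN tN vv vx vw vx).
rewrite (ipDl g p (vfD cww cw) (vfD cx cxx) vv) (ipDl g p cww cw vv) (ipDl g p cx cxx vv).
have ow : <<w, v>> p = 0 by rewrite (ipC g vw vv).
rewrite (K w vw w0 ow) (K x vx x0 oxv).
have b3 := curvature_vf cN tN vw vx vv; have b2 := curvature_vf cN tN vx vv vw.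
have := congr1 (fun Z => g p (Z p) (v p)) (bianchi cN tN vv vw vx).
rewrite -/(ip g _ v p) (ipDl g p (vfD cw b3) b2 vv) (ipDl g p cw b3 vv) /= (g0l g tvv).
rewrite (curvature_skew LC p vw vx vv) (curvatureN cN tN vv vx vw).
have -> : <<- curvature nab v x w, v>> p = - <<curvature nab v x w, v>> p.
  exact: (gNl g (vf_tan p cx) tvv).
lra.
Qed.

End Structure.

(** * The maximum principle for nonnegative curvature *)

Section MaximumPrinciple.
Context {R : realType} {n : nat} (M : smoothManifold R n).
Local Notation tvec := ((M -> R) -> R^o).
Implicit Types (p q : M) (f h : M -> R) (X Y Z W V x y v w : M -> tvec).
Variable g : riemannianMetric M.
Variables nab D : (M -> tvec) -> (M -> tvec) -> (M -> tvec).
Variables (theta : M -> tvec -> R) (kappa : R).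

Local Notation "<< X , Y >>" := (ip g X Y).
Local Notation product T1 T2 r1 r2 H1 H2 := (conformal_product g nab D T1 T2 theta r1 r2 H1 H2 kappa).

Lemma section_lin T r f x y : smooth_distribution r T -> smooth_fun f ->
  section_of T x -> section_of T y -> section_of T (scale_field f x + y).
Proof.
move=> dT sf [vx tx] [vy ty]; split; first exact: (vfD (vfZ sf vx) vy).
by move=> p; have [_ Tl _] := distribution_lin dT p; exact: Tl (tx p) (ty p).
Qed.

Lemma nonzero_section T r p : (0 < r)%N -> smooth_distribution r T ->
  exists2 x, section_of T x & x p <> 0.
Proof.
move=> r0 dT; have [e [se /nbhs_singleton[eo _]]] := on_frame_exists g p r0 dT.
pose i := Ordinal r0; exists (e i) => // z; have := eo i i.
have [ve _] := se i; rewrite {1}z (g0l g (vf_tan p ve)) eqxx => /eqP.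
by rewrite eq_sym oner_eq0.
Qed.

Lemma orthogonal_section T r p w : (1 < r)%N -> smooth_distribution r T -> section_of T w ->
  exists v, [/\ section_of T v, v p <> 0 & <<v, w>> p = 0].
Proof.
move=> r1 dT [vw _]; have [e [se /nbhs_singleton[eo _]]] := on_frame_exists g p (ltnW r1) dT.
pose i := Ordinal (ltnW r1); pose j := Ordinal r1.
have [vi _] := se i; have [vj _] := se j.
have ti := vf_tan p vi; have tj := vf_tan p vj; have tw := vf_tan p vw.
have ij : g p (e i p) (e j p) = 0 by rewrite eo.
have ji : g p (e j p) (e i p) = 0 by rewrite eo.
have ii : g p (e i p) (e i p) = 1 by rewrite eo eqxx.
have jj : g p (e j p) (e j p) = 1 by rewrite eo eqxx.
have [ai|ai] := eqVneq (<<e i, w>> p) 0.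
  exists (e i); split => // z; have := ii; rewrite {1}z (g0l g ti) => /eqP.
  by rewrite eq_sym oner_eq0.
(* b e_i - a e_j is orthogonal to [w] by the choice of [a] and [b], and nonzero because [a] is. The
   summand 0 in [Z] gives it the shape of [section_lin]. *)
pose a := <<e i, w>> p; pose b := <<e j, w>> p.
pose Z := scale_field (fun=> - a) (e j) + 0.
have s0 : section_of T 0.
  by split=> [|q]; [exact: vf0|have [] := distribution_lin dT q].
have sZ : section_of T Z := section_lin dT (@smooth_fun_cst R n M (- a)) (se j) s0.
exists (scale_field (fun=> b) (e i) + Z); split.
- exact: (section_lin dT (@smooth_fun_cst R n M b) (se i) sZ).
- move=> z; have : g p (b *: e i p + - a *: e j p) (e j p) = 0.
    have -> : b *: e i p + - a *: e j p = 0 by rewrite -[RHS]z -[_ *: e j p]addr0.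
    exact: (g0l g tj).
  rewrite (gDl g (tangentZ _ ti) (tangentZ _ tj) tj) (gZl g _ ti tj) (gZl g _ tj tj) ij jj.
  by rewrite mulr0 mulr1 add0r => /eqP; rewrite oppr_eq0 (negbTE ai).
- have : g p (b *: e i p + - a *: e j p) (w p) = 0.
    rewrite (gDl g (tangentZ _ ti) (tangentZ _ tj) tw) (gZl g _ ti tw) (gZl g _ tj tw).
    by rewrite -/(ip g (e i) w p) -/(ip g (e j) w p) -/a -/b; ring.
  by rewrite -[_ *: e j p]addr0.
Qed.

Lemma ip_nab_mixed T1 T2 r1 r2 H1 H2 x w v v' p : product T1 T2 r1 r2 H1 H2 ->
  section_of T1 x -> section_of T2 w -> section_of T2 v -> section_of T2 v' ->
  <<nab w x, nab v v'>> p =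
  <<v, v'>> p * <<H1, nab w x>> p - <<H1, x>> p * <<w, nab v v'>> p.
Proof.
move=> C sx sw sv sv'; have [vw tw] := sw; have [_ tx] := sx.
have tvw := vf_tan p vw; have tH1 := vf_tan p (cp_vf1 C).
have [_ s1] := cp_sec1 C.
have [T10 T1l _] := distribution_lin (cp_dist1 C) p.
have [T20 T2l _] := distribution_lin (cp_dist2 C) p.
have [A tA eA] := nab_split p (cp_swap C) sv sv'.
have [E tE eE] := nab_split_mixed p C sx sw.
have Z1 a : T1 p (a *: H1 p) by rewrite -[_ *: _]addr0; exact: (T1l _ _ _ (s1 p) T10).
have Zw a : T2 p (- (a *: w p)).
  by rewrite -scaleNr -[_ *: _]addr0; exact: (T2l _ _ _ (tw p) T20).
have tvA := cp_tan2 C tA; have tvE := cp_tan1 C tE.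
have oH : g p (H1 p) (w p) = 0 := cp_orth C (s1 p) (tw p).
rewrite /ip eE eA [A + _]addrC (g_split C tE (Z1 _) (Zw _) tA).
rewrite (gBr g tvE (tangentZ _ tvw) tH1) (gZr g _ tvw tH1) oH mulr0 subr0.
rewrite (gNl g (tangentZ _ tvw) tvA) (gZl g _ tvw tvA) (gZr g _ tH1 tvE) (gC g tvE tH1).
by rewrite (gDr g (tangentZ _ tH1) tvA tvw) (gZr g _ tH1 tvw) (gC g tvw tH1) oH mulr0 add0r.
Qed.

(** A [v] in T2 orthogonal to [w] exists because T2 has rank at least 2. In the expansion of R(v, w,
    x, v) = 0 everything cancels except |v|^2 g(nabla_w H1, x). *)
Lemma nab_H1_perp_nonzero T1 T2 r1 r2 H1 H2 x w p : product T1 T2 r1 r2 H1 H2 -> (1 < r2)%N ->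
  section_of T1 x -> section_of T2 w -> w p <> 0 -> <<nab w H1, x>> p = 0.
Proof.
move=> C r2p sx sw w0; have [vx tx] := sx; have [vw tw] := sw; have LC := cp_lc C.
have v1 := cp_vf1 C; have vn := lc_vf LC vw v1.
have z0 : x p = 0 -> <<nab w H1, x>> p = 0.
  move=> z; rewrite /ip (gC g (vf_tan p vn) (vf_tan p vx)) z; exact: (g0l g (vf_tan p vn)).
have [/z0 //|x0] := pselect (x p = 0).
have [v [sv vn0 o]] := orthogonal_section p r2p (cp_dist2 C) sw.
have [vv tv] := sv.
have := curvature_mixed0 C sx sv sw o x0 vn0 w0.
rewrite (curvature_ip LC p vv vw vx vv) (nab_mixed C p (lc_bracket_vf LC vv vw) sx sv).
have vvw := lc_vf LC vv vw; have vwv := lc_vf LC vw vv; have vvv := lc_vf LC vv vv.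
have tvv := vf_tan p vv; have tvw := vf_tan p vw.
rewrite (lc_bracket LC vv vw) (ipBl g p vvw vwv vx) (ipBl g p vvw vwv vv).
rewrite (nab_mixedC C p vv sx sw) (nab_mixedC C p vw sx sv) (ipC g vw vv) o.
rewrite (cp_ip0C C p sx sv) (cp_ip0C C p sx sw).
have -> : <<nab w x, v>> = (fun q => - (<<H1, x>> q * <<w, v>> q)).
  by apply/funext => q; rewrite (nab_mixed C q vw sx sv) (cp_ip0C C q sx sw); ring.
have -> : <<nab v x, v>> = (fun q => - (<<H1, x>> q * <<v, v>> q)).
  by apply/funext => q; rewrite (nab_mixed C q vv sx sv) (cp_ip0C C q sx sv); ring.
have sm1 := ip_smooth g v1 vx; have swv := ip_smooth g vw vv; have svv := ip_smooth g vv vv.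
rewrite (tanN tvv (smooth_funM sm1 swv)) (tanM tvv sm1 swv).
rewrite (tanN tvw (smooth_funM sm1 svv)) (tanM tvw sm1 svv).
rewrite (lc_metric p LC vv vw vv) (lc_metric p LC vw v1 vx) (lc_norm LC p vw vv).
rewrite (ip_nab_mixed p C sx sw sv sv) (ip_nab_mixed p C sx sv sw sv).
rewrite (ipC g vw vv) o (ipC g vv vwv) => e.
have : <<v, v>> p * <<nab w H1, x>> p = 0 by move: e; lra.
by move=> /eqP; rewrite mulf_eq0 (gt_eqF (ip_gt0 g vv vn0)) => /eqP.
Qed.

(** A [w] vanishing at [p] is the difference of w + y and [y], both nonzero there. *)
Lemma nab_H1_perp T1 T2 r1 r2 H1 H2 x w p : product T1 T2 r1 r2 H1 H2 -> (1 < r2)%N ->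
  section_of T1 x -> section_of T2 w -> <<nab w H1, x>> p = 0.
Proof.
move=> C r2p sx sw; have [w0|] := pselect (w p = 0); last exact: (nab_H1_perp_nonzero C r2p sx sw).
have [y sy y0] := nonzero_section p (cp_rank2 C) (cp_dist2 C).
have [[cN _ _] v1] := (cp_lc C, cp_vf1 C); have [vw vy] := (proj1 sw, proj1 sy).
have s1 := section_lin (cp_dist2 C) (@smooth_fun_cst R n M 1) sw sy.
have swy : section_of T2 (w + y).
  have -> : w + y = scale_field (fun=> 1) w + y; last exact: s1.
  by congr (_ + y); apply/funext => q; rewrite /scale_field scale1r.
have z : (w + y) p <> 0 by move=> e; apply: y0; rewrite -e -[RHS]/(w p + y p) w0 add0r.
have := nab_H1_perp_nonzero C r2p sx swy z; rewrite (connDl cN vw vy v1).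
rewrite (ipDl g p (conn_vf cN vw v1) (conn_vf cN vy v1) (proj1 sx)).
by rewrite (nab_H1_perp_nonzero C r2p sx sy y0) addr0.
Qed.

Lemma smooth_max f : [set: M] !=set0 -> compact [set: M] -> smooth_fun f ->
  exists q, forall p, f p <= f q.
Proof.
move=> n0 cM sf; have cf := smooth_fun_cont sf.
have [|q _ Hq] := @compact_EVT_max M R f [set: M] n0 cM; first exact: continuous_subspaceT.
by exists q => p; apply: Hq; exact: mem_set.
Qed.

Lemma small_multiplier (B C a b : R) : 0 <= B -> 0 <= C -> 0 < a -> 0 < b ->
  exists e, [/\ 0 < e, e * B <= a & e * C <= b].
Proof.
move=> B0 C0 a0 b0; have B1 : 0 < B + 1 by rewrite ltr_wpDl.
have C1 : 0 < C + 1 by rewrite ltr_wpDl.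
have h1 : 0 < a / (B + 1) by rewrite divr_gt0.
have h2 : 0 < b / (C + 1) by rewrite divr_gt0.
have le1 : a / (B + 1) * B <= a.
  by rewrite mulrAC ler_pdivrMr // ler_pM2l // lerDl.
have le2 : b / (C + 1) * C <= b.
  by rewrite mulrAC ler_pdivrMr // ler_pM2l // lerDl.
exists (Num.min (a / (B + 1)) (b / (C + 1))); split; first by rewrite lt_min h1 h2.
- by apply: le_trans le1; rewrite ler_wpM2r // ge_min lexx.
- by apply: le_trans le2; rewrite ler_wpM2r // ge_min lexx orbT.
Qed.

(* At a maximum of |H1|^2 + e |H2|^2, with e small, the sectional curvature of the
   planes containing H1 makes the second derivative along T2 positive. *)
Lemma cp_H1_zero T1 T2 r1 r2 H1 H2 p : product T1 T2 r1 r2 H1 H2 -> compact [set: M] ->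
  (1 < r2)%N -> 0 <= kappa -> H1 p = 0.
Proof.
move=> C cM r2p k0; have LC := cp_lc C.
have n0 : [set: M] !=set0 by exists p.
have s1 := cp_sec1 C; have s2 := cp_sec2 C; have v1 := cp_vf1 C; have v2 := cp_vf2 C.
set f1 := <<H1, H1>>; set f2 := <<H2, H2>>.
have sf1 : smooth_fun f1 := ip_smooth g v1 v1.
have sf2 : smooth_fun f2 := ip_smooth g v2 v2.
have sh : smooth_fun (fun q => - H1 q f2) := smooth_funN (vf_smooth v1 sf2).
have f1_0 q : 0 <= f1 q := g_ge0 g (vf_tan q v1).
have f2_0 q : 0 <= f2 q := g_ge0 g (vf_tan q v2).
have Uf1 y q : section_of T2 y -> y q f1 = 0.
  by move=> sy; rewrite (lc_norm LC q (proj1 sy) v1) (nab_H1_perp q C r2p s1 sy) mulr0.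
have [q1 m1] := smooth_max n0 cM sf1; have [q2 m2] := smooth_max n0 cM sf2.
have [q3 m3] := smooth_max n0 cM sh.
have [m0|mn] := ltP 0 (f1 q1); last first.
  apply: (g_eq0 (g := g) (vf_tan p v1)); apply/eqP; rewrite eq_le.
  by rewrite (le_trans (m1 p) mn) (f1_0 p).
exfalso; set m := f1 q1 in m0 m1.
(* The first bound, e |H2|^2 <= m/2, keeps f1 >= m/2 at the maximum of [G]. The second, with the
   critical equation along [H1], makes g(nabla_H1 H1, H1) smaller than f1^2 there. *)
have [e [e0 eB eC]] := small_multiplier (f2_0 q2) (normr_ge0 (- H1 q3 f2))
  (divr_gt0 m0 (ltr0Sn R 1)) (divr_gt0 (mulr_gt0 m0 m0) (ltr0Sn R 3)).
have sef : smooth_fun (fun q => e * f2 q) := smooth_funM (@smooth_fun_cst R n M e) sf2.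
pose G q := e * f2 q + f1 q; have sG : smooth_fun G := smooth_funD sef sf1.
have [q mq] := smooth_max n0 cM sG.
have GX (X : M -> tvec) z : vector_field X -> X z G = e * X z f2 + X z f1.
  by move=> vX; exact: (tan_lin e (vf_tan z vX) sf2 sf1).
have crit X : vector_field X -> e * X q f2 + X q f1 = 0.
  by move=> vX; rewrite -(GX X q vX); exact: (critical_point sG mq (vf_tan q vX)).
have c1 := crit H1 v1; have := crit H2 v2; rewrite (Uf1 _ q s2) addr0 => /eqP.
rewrite mulf_eq0 (gt_eqF e0) /= => /eqP c2.
have f1q : m / 2 <= f1 q.
  have := mq q1; rewrite /G -/m => h.
  have h2 : e * f2 q <= e * f2 q2 by rewrite ler_pM2l.
  have h3 : 0 <= e * f2 q1 by rewrite mulr_ge0 // ltW.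
  lra.
have H1q : H1 q <> 0.
  move=> z; move: f1q; rewrite /f1 /ip z (g0l g (@tangent0 R n M q)) leNgt => /negP; apply.
  by rewrite divr_gt0.
(* In [sectional_mixed] for [H1] and [y], solved for this term, everything is nonnegative and the
   contribution of f1^2 - g(nabla_H1 H1, H1) is positive. *)
have Qpos y : section_of T2 y -> y q <> 0 -> 0 < <<nab y H2, y>> q.
  move=> sy y0; have N0 := ip_gt0 g (proj1 sy) y0.
  have := sectional_mixed C s1 sy H1q y0; rewrite -/f1 => E.
  have f1p : 0 < f1 q by apply: lt_le_trans f1q; rewrite divr_gt0.
  have d1 := lc_norm LC q v1 v1; rewrite -/f1 in d1.
  have hb : e * - H1 q f2 <= m * m / 4.
    apply: le_trans eC; rewrite ler_pM2l //; apply: le_trans (m3 q) _; exact: ler_norm.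
  have hsq : m * m / 4 <= f1 q ^+ 2.
    have : (m / 2) ^+ 2 <= f1 q ^+ 2 by rewrite ler_sqr ?nnegrE ?divr_ge0 ?(ltW m0) // f1_0.
    by rewrite expr2; lra.
  have mm : 0 < m * m by rewrite mulr_gt0.
  have pos : 0 < f1 q ^+ 2 - <<nab H1 H1, H1>> q by lra.
  rewrite -(pmulr_rgt0 _ f1p).
  have -> : f1 q * <<nab y H2, y>> q = kappa * f1 q * <<y, y>> q + f1 q * <<H2, y>> q ^+ 2 +
     <<y, y>> q * (f1 q ^+ 2 - <<nab H1 H1, H1>> q) by rewrite -E /f1; ring.
  have p1 : 0 <= kappa * f1 q * <<y, y>> q by rewrite !mulr_ge0 ?(ltW f1p) ?(ltW N0).
  have p2 : 0 <= f1 q * <<H2, y>> q ^+ 2 by rewrite mulr_ge0 ?sqr_ge0 ?(ltW f1p).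
  exact: (ltr_wpDl (addr_ge0 p1 p2) (mulr_gt0 N0 pos)).
have H2q : H2 q = 0.
  have [//|z] := pselect (H2 q = 0); have := Qpos _ s2 z.
  have := lc_norm LC q v2 v2; rewrite -/f2 c2 => e2; have -> : <<nab H2 H2, H2>> q = 0 by lra.
  by rewrite ltxx.
have [y sy y0] := nonzero_section q (ltnW r2p) (cp_dist2 C); have [vy _] := sy.
(* As H2 vanishes at [q], the second derivative of [G] along [y] is 2e |nabla_y H2|^2. A maximum
   forces it to be 0, against [Qpos]. *)
have vn := lc_vf LC vy v2; have := second_order_max sG mq vy.
have -> : lie_derivative y G = (fun z => (e * 2) * <<nab y H2, H2>> z).
  apply/funext => z; rewrite /lie_derivative (GX y z vy) (Uf1 y z sy) addr0 -mulrA.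
  by rewrite -(lc_norm LC z vy v2).
rewrite (tanZ _ (vf_tan q vy) (ip_smooth g vn v2)) (lc_metric q LC vy vn v2).
have -> : <<nab y (nab y H2), H2>> q = 0.
  have tn := vf_tan q (lc_vf LC vy vn).
  by rewrite /ip (gC g tn (vf_tan q v2)) H2q (g0l g tn).
rewrite add0r pmulr_rle0; last by rewrite mulr_gt0.
move=> le0; have tn := vf_tan q vn.
have z : nab y H2 q = 0.
  by apply: (g_eq0 (g := g) tn); apply/eqP; rewrite eq_le le0 (g_ge0 g tn).
by have := Qpos y sy y0; rewrite /ip z (g0l g (vf_tan q vy)) ltxx.
Qed.

Lemma cp_zero T1 T2 r1 r2 H1 H2 p : product T1 T2 r1 r2 H1 H2 -> compact [set: M] ->
  (1 < r2)%N -> 0 <= kappa -> [/\ H1 p = 0, H2 p = 0 & kappa = 0].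
Proof.
move=> C cM r2p k0; have LC := cp_lc C.
have n0 : [set: M] !=set0 by exists p.
have H10 : H1 = 0 by apply/funext => q; exact: (cp_H1_zero q C).
have s1 := cp_sec1 C; have s2 := cp_sec2 C; have v1 := cp_vf1 C; have v2 := cp_vf2 C.
(* This is [sectional_mixed] with H1 = 0. At a maximum of |H2|^2, taking y = H2 gives |H2|^4 + kappa
   |H2|^2 = 0; once H2 = 0, any nonzero [y] gives kappa = 0. *)
have S y q : section_of T2 y -> y q <> 0 ->
    <<nab y H2, y>> q = <<H2, y>> q ^+ 2 + kappa * <<y, y>> q.
  move=> sy y0; have [x sx x0] := nonzero_section q (cp_rank1 C) (cp_dist1 C).
  have := sectional_mixed C sx sy x0 y0.
  have tx := vf_tan q (proj1 sx); have xx := ip_gt0 g (proj1 sx) x0.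
  have -> : <<nab x H1, x>> q = 0.
    rewrite H10; have [cN _ _] := LC.
    have := connBr cN (proj1 sx) (@vf0 R n M) (@vf0 R n M); rewrite subrr subrr => ->.
    exact: (g0l g tx).
  have -> : <<H1, x>> q = 0 by rewrite H10; exact: (g0l g tx).
  rewrite expr0n subr0 mulr0 add0r mulrAC [kappa * _ * _]mulrC => /(mulfI (lt0r_neq0 xx)) e.
  by rewrite -e addrC subrK.
have [q mq] := smooth_max n0 cM (ip_smooth g v2 v2).
have H2q : H2 q = 0.
  have [//|z] := pselect (H2 q = 0); have := S _ _ s2 z.
  have := lc_norm LC q v2 v2; rewrite (critical_point (ip_smooth g v2 v2) mq (vf_tan q v2)).
  have := ip_gt0 g v2 z => h e1 e2.
  have h2 : 0 < <<H2, H2>> q ^+ 2 by rewrite exprn_gt0.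
  have h3 : 0 <= kappa * <<H2, H2>> q by rewrite mulr_ge0 // ltW.
  by exfalso; lra.
have H20 : H2 = 0.
  apply/funext => z; have tz := vf_tan z v2; apply: (g_eq0 (g := g) tz).
  apply/eqP; rewrite eq_le (g_ge0 g tz) andbT; apply: le_trans (mq z) _.
  by rewrite /ip H2q (g0l g (@tangent0 R n M q)).
split; [by rewrite H10|by rewrite H20|].
have [y sy y0] := nonzero_section p (ltnW r2p) (cp_dist2 C).
have ty := vf_tan p (proj1 sy); have := S y p sy y0; rewrite H20.
have [cN _ _] := LC.
have := connBr cN (proj1 sy) (@vf0 R n M) (@vf0 R n M); rewrite subrr subrr => ->.
rewrite /ip (g0l g ty) expr0n add0r => /esym/eqP.
by rewrite mulf_eq0 (gt_eqF (ip_gt0 g (proj1 sy) y0)) orbF => /eqP.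
Qed.

End MaximumPrinciple.

(** * The divergence theorem *)

Lemma lsum_sub (R : realType) n (N : nat) (F : 'rV[R]_n -> R) (J : finType)
    (k : J -> {ffun 'I_n -> 'I_(2 * N ^ 2).+1}) (d : R) :
  (forall x, 0 <= F x) -> injective k -> (forall j, d <= F (lpt (k j))) ->
  (N%:R ^+ n)^-1 * (#|J|%:R * d) <= lsum N F.
Proof.
move=> F0 ik dF; rewrite /lsum ler_wpM2l ?invr_ge0 ?exprn_ge0 //.
apply: (@le_trans _ _ (\sum_(j : J) F (lpt (k j)))).
  by rewrite mulr_natl -sumr_const; apply: ler_sum => j _; exact: dF.
rewrite -(big_imset (h := k) (A := predT) (fun m => F (lpt m))) /=; last by move=> i j _ _; exact: ik.
rewrite [leRHS](bigID (mem (k @: predT))) /= lerDl.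
by apply: sumr_ge0 => m _; exact: F0.
Qed.

(** If [F] exceeds d on a ball, at least (s N)^n lattice points lie in it, and the Riemann sums stay
    above s^n d. *)
Lemma null_nonneg (R : realType) n (F : 'rV[R]_n -> R) (a : 'rV[R]_n) : continuous F ->
  (forall x, 0 <= F x) -> null F -> F a = 0.
Proof.
move=> cF F0 nF; apply/eqP; rewrite eq_le F0 andbT leNgt; apply/negP => Fa.
pose d := F a / 2; have d0 : 0 < d by rewrite divr_gt0.
have dFa : d < F a by rewrite /d; lra.
have nd : \forall x \near a, d < F x by exact: (cvgr_gt _ (cF a)).
have [r r0 Br] := nbhs_nball nd.
(* A cube of side r/2 contains floor(r N / 2) lattice points per axis, which is at least s N as soon
   as s N >= 1. The bound [b] below ensures this and keeps the cube inside the box. *)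
pose s := r / 4; have s0 : 0 < s by rewrite divr_gt0.
have sn : 0 < s ^+ n * d by rewrite mulr_gt0 // exprn_gt0.
have /cvgr0Pnorm_lt/(_ _ sn) nF' := nF.
have [b hb] := nat_bound (`|a| + r + s^-1 + 1).
suff [N [N0 hN]] : exists N, (`|lsum N F| < s ^+ n * d) /\ (b <= N)%N; last first.
  have : \forall N \near \oo, (`|lsum N F| < s ^+ n * d) /\ (b <= N)%N.
    by apply: filterI => //; exact: nbhs_infty_ge.
  by move=> /filter_ex[N HN]; exists N.
have hN' : `|a| + r + s^-1 + 1 <= N%:R by apply: le_trans hb _; rewrite ler_nat.
have a0 : 0 <= `|a| by [].
have si : 0 < s^-1 by rewrite invr_gt0.
have Np : 0 < N%:R :> R by lra.
have ai i : `|a 0 i| <= `|a| := coord_le_norm a i.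
have x0 i : 0 <= N%:R * (N%:R + a 0 i).
  by rewrite mulr_ge0 ?(ltW Np) //; have := ai i; rewrite ler_norml; lra.
have rN : 0 <= r / 2 * N%:R by rewrite mulr_ge0 ?(ltW Np) // divr_ge0 // ltW.
pose q i := Num.truncn (N%:R * (N%:R + a 0 i)).
pose m := Num.truncn (r / 2 * N%:R).
have qi i := truncn_itv (x0 i); have mi := truncn_itv rN.
have sN : 1 <= s * N%:R.
  rewrite -ler_pdivrMl // mulr1; lra.
have qm i (j : 'I_m) : (q i + j < (2 * N ^ 2).+1)%N.
  rewrite ltnS -(ler_nat R) natrD natrM natrX.
  have /andP[h1 _] := qi i; have /andP[h2 _] := mi.
  have h3 : (j : nat)%:R <= m%:R :> R by rewrite ler_nat ltnW.
  have := ai i; rewrite ler_norml => /andP[_ h4].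
  rewrite -/(q i) in h1; rewrite -/m in h2; nra.
pose k (j : {ffun 'I_n -> 'I_m}) : {ffun 'I_n -> 'I_(2 * N ^ 2).+1} :=
  [ffun i => Ordinal (qm i (j i))].
have ik : injective k.
  move=> j j' /ffunP e; apply/ffunP => i; have := e i; rewrite !ffunE => /(congr1 val) /=.
  by move=> /addnI/val_inj.
have dF j : d <= F (lpt (k j)).
  apply/ltW/Br; apply: rV_norm_lt => // i; rewrite !mxE !ffunE /=.
  have /andP[h1 h2] := qi i; have /andP[h3 _] := mi.
  have h4 : (j i : nat)%:R <= m%:R :> R by rewrite ler_nat ltnW.
  rewrite -/(q i) in h1 h2; rewrite -/m in h3; rewrite -[(q i).+1%:R]natr1 in h2.
  have -> : (q i + j i)%:R / N%:R - N%:R - a 0 i =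
     ((q i)%:R + (j i : nat)%:R - N%:R * (N%:R + a 0 i)) / N%:R by rewrite natrD; field; rewrite gt_eqF.
  have j0 : 0 <= (j i : nat)%:R :> R by [].
  rewrite ltr_norml ltr_pdivrMr // ltr_pdivlMr //; rewrite /s in sN; apply/andP; split; nra.
have := lsum_sub F0 ik dF; rewrite card_ffun !card_ord natrX mulrA -exprVn -exprMn => h.
have ms : s <= N%:R^-1 * m%:R.
  have /andP[_ h2] := mi; rewrite -/m -[m.+1%:R]natr1 in h2.
  rewrite mulrC ler_pdivlMr //; rewrite /s in sN *; nra.
have : s ^+ n * d <= lsum N F.
  have z : 0 <= N%:R^-1 * m%:R :> R by rewrite mulr_ge0 // invr_ge0.
  apply: le_trans h; rewrite (ler_pM2r d0).
  by apply: lerXn2r => //; rewrite nnegrE // ltW.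
by move=> /(lt_le_trans N0); rewrite ltNge ler_norm.
Qed.

(** * Functions read in a chart, and partitions of unity *)

Section ChartRepresentation.
Context {R : realType} {n : nat} (M : smoothManifold R n).
Implicit Types (p q : M) (f h : M -> R) (c : @chart R n M) (K : set M).

Definition chart_rep c h (x : 'rV[R]_n) : R :=
  if `[< img c x >] then h (chart_inv c x) else 0.

Lemma chart_repE c h x : img c x -> chart_rep c h x = h (chart_inv c x).
Proof. by move=> ix; rewrite /chart_rep asboolT. Qed.

Lemma chart_rep0 c h K x : (forall q, ~ K q -> h q = 0) -> ~ (chart_map c @` K) x ->
  chart_rep c h x = 0.
Proof.
move=> h0 Kx; rewrite /chart_rep; case: asboolP => // /img_inv[_ e]; apply: h0 => Ki.
by apply: Kx; exists (chart_inv c x).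
Qed.

Lemma chart_image_compact c K : compact K -> K `<=` chart_dom c -> compact (chart_map c @` K).
Proof.
move=> cK KD; apply: continuous_compact cK; apply: continuous_in_subspaceT => p /set_mem /KD.
exact: chart_map_cont.
Qed.

Lemma chart_image_closed c K : compact K -> K `<=` chart_dom c -> closed (chart_map c @` K).
Proof.
by move=> cK KD; apply: compact_closed (chart_image_compact cK KD); exact: norm_hausdorff.
Qed.

Lemma chart_rep_near0 c h K x : compact K -> K `<=` chart_dom c -> (forall q, ~ K q -> h q = 0) ->
  ~ (chart_map c @` K) x -> \forall y \near x, chart_rep c h y = 0.
Proof.
move=> cK KD h0 Kx; have oC : open (~` (chart_map c @` K)).
  by rewrite openC; exact: chart_image_closed.
by apply: near_mono (open_nbhs_nbhs (conj oC Kx)) => y Ky; exact: (chart_rep0 h0).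
Qed.

Lemma chart_rep_smoothc c h K : atlas c -> smooth_fun h -> compact K -> K `<=` chart_dom c ->
  (forall q, ~ K q -> h q = 0) -> smoothc (chart_rep c h).
Proof.
move=> ac sh cK KD h0; split.
  apply: smooth_local => x _; have [ix|ix] := pselect (img c x).
    exists (img c) => //; apply: (smooth_ext (@img_open R n M c) (f := h \o chart_inv c)).
      by move=> y iy; rewrite chart_repE.
    exact: sh.
  have Kx : ~ (chart_map c @` K) x by move=> [p /KD cp e]; apply: ix; exists p.
  have [r r0 Br] := nbhs_nball (chart_rep_near0 cK KD h0 Kx).
  exists (nball x r); first by rewrite /nball /= subrr normr0.
  apply: (smooth_ext (@nball_open R n x r) (f := fun=> 0)); last exact: smooth_cst.
  by move=> y /Br ->.
have [B [_ HB]] := compact_bounded (chart_image_compact cK KD).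
have [b hb] := nat_bound (B + 1); exists b => x bx; apply: (chart_rep0 h0) => Kx.
have B1 : B < B + 1 by rewrite ltrDl.
have xB : `|x| <= B + 1 := HB _ B1 x Kx.
by have := le_lt_trans (le_trans xB hb) bx; rewrite ltxx.
Qed.

Lemma chart_rep_sum c (I : Type) (r : seq I) (h : I -> M -> R) x :
  chart_rep c (fun q => \sum_(i <- r) h i q) x = \sum_(i <- r) chart_rep c (h i) x.
Proof. by rewrite /chart_rep; case: asboolP => // _; rewrite big1. Qed.

Lemma partition_of_unity (O : M -> set M) : compact [set: M] -> (forall p, nbhs p (O p)) ->
  exists (m : nat) (pt : 'I_m -> M) (rho : 'I_m -> M -> R) (K : 'I_m -> set M),
    [/\ forall k, smooth_fun (rho k), forall k q, 0 <= rho k q, forall q, \sum_k rho k q = 1 &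
        forall k, [/\ compact (K k), K k `<=` O (pt k) & forall q, ~ K k q -> rho k q = 0]].
Proof.
move=> cM nO; have /choice[chi Hchi] : forall p, exists chi : M -> R, exists K : set M,
    [/\ smooth_fun chi, forall q, 0 <= chi q, \forall q \near p, chi q = 1,
      compact K /\ K `<=` O p & forall q, ~ K q -> chi q = 0].
  by move=> p; exact: bump_function (nO p).
have [KK HK] := choice Hchi.
pose U p := [set q | 0 < chi p q].
have oU p : open (U p).
  rewrite openE => q cq; have [sc _ _ _ _] := HK p.
  exact: (cvgr_gt _ (smooth_fun_cont sc (x := q))).
have [s covD] : exists s : seq M, forall q, exists2 p, p \in s & U p q.
  (* The filter of properties shared by all sufficiently large finite lists turns the near-covering
     form of compactness into a finite subcover. *)
  pose F : set_system (seq M) :=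
    [set A | exists s0 : seq M, forall s : seq M, {subset s0 <= s} -> A s].
  have FF : Filter F.
    split; first by exists [::].
    - move=> A B [sA HA] [sB HB]; exists (sA ++ sB) => s hs.
      by split; [apply: HA|apply: HB] => x xs; apply: hs; rewrite mem_cat xs ?orbT.
    - by move=> A B AB [s0 HA]; exists s0 => s /HA/AB.
  have := proj1 (compact_near_coveringP [set: M]) cM (seq M) F
    (fun s q => exists2 p, p \in s & U p q) FF.
  case=> [q _|s0 Hs0]; last by exists s0 => q; exact: (Hs0 s0 _ q I).
  have Uq : U q q by have [_ _ c1 _ _] := HK q; rewrite /U /= (nbhs_singleton c1) ltr01.
  exists (U q, [set s : seq M | q \in s]) => /=; last by move=> [q' s] /= [Uq' qs]; exists q.
  split; first exact: open_nbhs_nbhs.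
  by exists [:: q] => s hs; apply: hs; rewrite mem_head.
pose S q := \sum_(p <- s) chi p q.
have c0 p q : 0 <= chi p q by have [] := HK p.
have S0 q : 0 < S q.
  have [p pD Uq] := covD q; rewrite /S (big_rem p) //=.
  by apply: (ltr_wpDr _ Uq); apply: sumr_ge0 => ? _; exact: c0.
have sS : smooth_fun S by apply: smooth_fun_sum => p _; have [] := HK p.
have sV : smooth_fun (fun q => (S q)^-1) by apply: smooth_funV => // q; rewrite gt_eqF.
exists (size s), (fun k => tnth (in_tuple s) k), (fun k q => chi (tnth (in_tuple s) k) q * (S q)^-1).
exists (fun k => KK (tnth (in_tuple s) k)); split.
- by move=> k; apply: smooth_funM sV; have [] := HK (tnth (in_tuple s) k).
- by move=> k q; rewrite mulr_ge0 // invr_ge0 ltW.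
- move=> q; rewrite -mulr_suml; have <- : S q = \sum_(k < size s) chi (tnth (in_tuple s) k) q.
    by rewrite /S (big_tnth _ _ s).
  by rewrite mulfV // gt_eqF.
- move=> k; have [_ _ _ [cK KO] k0] := HK (tnth (in_tuple s) k); split => //.
  by move=> q /k0 ->; rewrite mul0r.
Qed.

End ChartRepresentation.

(** * The divergence in a chart *)

Section LocalDivergence.
Context {R : realType} {n : nat} (M : smoothManifold R n).
Local Notation tvec := ((M -> R) -> R^o).
Implicit Types (p q : M) (f h : M -> R) (c : @chart R n M) (O K : set M).
Implicit Types (X : 'I_n -> M -> R) (e : 'I_n -> M -> tvec) (w : M -> R).
Variable g : riemannianMetric M.

Lemma smooth_fun_det m (F : 'I_m -> 'I_m -> M -> R) : (forall i j, smooth_fun (F i j)) ->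
  smooth_fun (fun q => \det (\matrix_(i, j) F i j q)).
Proof.
move=> sF c ac; apply: (smooth_det (A := fun x => \matrix_(i, j) F i j (chart_inv c x)) (@img_open R n M c)).
move=> i j; apply: (smooth_ext (@img_open R n M c) (f := F i j \o chart_inv c)); last exact: sF.
by move=> x _; rewrite mxE.
Qed.

Lemma tan_det m (F : 'I_m -> 'I_m -> M -> R) p (v : tvec) : tangent p v ->
  (forall i j, smooth_fun (F i j)) ->
  v (fun q => \det (\matrix_(i, j) F i j q)) =
  \sum_i \sum_j v (F i j) * cofactor (\matrix_(i, j) F i j p) i j.
Proof.
move=> tv sF; have [c ac cp] := atlas_cover p; have [X HX] := coords_exist ac cp.
have ip := img_in cp.
rewrite (tan_coord ac cp HX tv (smooth_fun_det sF)).
have D k : 'D_(bv k) ((fun q => \det (\matrix_(i, j) F i j q)) \o chart_inv c) (chart_map c p) =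
    \sum_i \sum_j 'D_(bv k) (F i j \o chart_inv c) (chart_map c p) *
      cofactor (\matrix_(i, j) F i j p) i j.
  have [|_ ->] := is_derive_det (A := fun x => \matrix_(i, j) F i j (chart_inv c x))
    (dA := fun i j => 'D_(bv k) (F i j \o chart_inv c) (chart_map c p))
    (x := chart_map c p) (v := bv k).
    move=> i j; have -> : (fun x => (\matrix_(i, j) F i j (chart_inv c x)) i j) = F i j \o chart_inv c.
      by apply/funext => x; rewrite mxE.
    by apply/derivableP; exact: (smooth_derivable (sF i j c ac) ip).
  by rewrite chart_mapK.
under eq_bigr => k _ do rewrite D mulr_sumr.
rewrite exchange_big /=; apply: eq_bigr => i _.
under eq_bigr => k _ do rewrite mulr_sumr.
rewrite exchange_big /=; apply: eq_bigr => j _.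
rewrite (tan_coord ac cp HX tv (sF i j)) mulr_suml.
by apply: eq_bigr => k _; rewrite mulrA.
Qed.

Definition frame_mx X e q := \matrix_(a < n, i < n) e a q (X i).

(* w is the Riemannian density in the coordinates X: the frame e is orthonormal. *)
Record local_data O c X e w : Prop := LocalData {
  ld_atlas : atlas c;
  ld_open : open O;
  ld_dom : O `<=` chart_dom c;
  ld_X : forall i, smooth_fun (X i);
  ld_XE : forall i q, O q -> X i q = chart_map c q 0 i;
  ld_e : forall a, vector_field (e a);
  ld_on : forall q a b, O q -> g q (e a q) (e b q) = (a == b)%:R;
  ld_span : forall q v, O q -> tangent q v -> v = \sum_a g q v (e a q) *: e a q;
  ld_w : smooth_fun w;
  ld_wE : forall q, O q -> w q * `|\det (frame_mx X e q)| = 1 }.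

Lemma local_data_exists p (e : 'I_n -> M -> tvec) : (forall a, vector_field (e a)) ->
  (\forall q \near p, (forall a b, g q (e a q) (e b q) = (a == b)%:R) /\
     forall v, tangent q v -> v = \sum_a g q v (e a q) *: e a q) ->
  exists O c X w, O p /\ local_data O c X e w.
Proof.
move=> ve He; have [c ac cp] := atlas_cover p; have [X HX] := coords_exist ac cp.
have sX i : smooth_fun (X i) by have [] := HX i.
have sE a i : smooth_fun (fun q => e a q (X i)) := vf_smooth (ve a) (sX i).
have sD : smooth_fun (fun q => \det (frame_mx X e q)) := smooth_fun_det sE.
have sD2 : smooth_fun (fun q => \det (frame_mx X e q) * \det (frame_mx X e q)) := smooth_funM sD sD.
have dp : \det (frame_mx X e p) != 0.
  have tp a := vf_tan p (ve a).
  have [on _] := nbhs_singleton He.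
  have : row_free (frame_mx X e p).
    apply: (frame_coords_unit (v := fun a => e a p) ac cp HX tp) => k k0 a.
    have := congr1 (fun v => g p v (e a p)) k0.
    rewrite (g0l g (tp a)) (g_suml g _ _ _ tp (tp a)) (bigD1 a) //= on eqxx mulr1 big1 ?addr0 //.
    by move=> b ba; rewrite on (negbTE ba) mulr0.
  by rewrite row_free_unit unitmxE unitfE.
have d2p : 0 < \det (frame_mx X e p) * \det (frame_mx X e p).
  by rewrite -expr2 lt_neqAle eq_sym sqrf_eq0 dp sqr_ge0.
(* The inverse root of det^2 is 1/|det| near [p], and [smooth_fun_rsqrt] continues it to a global
   smooth function. *)
have [w sw Hw] := smooth_fun_rsqrt sD2 d2p.
have nX : \forall q \near p, forall i, X i q = chart_map c q 0 i.
  by apply: (filter_forall (nbhs_filter p)) => i; have [] := HX i.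
pose A q := [/\ chart_dom c q, forall i, X i q = chart_map c q 0 i,
  (forall a b, g q (e a q) (e b q) = (a == b)%:R) /\
     forall v, tangent q v -> v = \sum_a g q v (e a q) *: e a q &
  0 < \det (frame_mx X e q) * \det (frame_mx X e q) /\
     w q = (Num.sqrt (\det (frame_mx X e q) * \det (frame_mx X e q)))^-1].
have nA : nbhs p [set q | A q].
  by apply: filterS3 (near_dom cp) nX (filterI He Hw) => q ? ? [? ?]; split.
exists ([set q | A q]^°), c, X, w; split; first exact: nA.
have sub q : ([set q | A q]^°) q -> A q by move=> /nbhs_singleton.
split => //.
- exact: open_interior.
- by move=> q /sub[].
- by move=> i q /sub[_ H _ _]; exact: H.
- by move=> q a b /sub[_ _ [H _] _]; exact: H.
- by move=> q v /sub[_ _ [_ H] _]; exact: H.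
- move=> q /sub[_ _ _ [d2 ->]]; rewrite -expr2 sqrtr_sqr mulVf //.
  by rewrite normr_eq0; apply/negP => /eqP d0; move: d2; rewrite d0 mulr0 ltxx.
Qed.

Section Data.
Variables (O : set M) (c : @chart R n M) (X : 'I_n -> M -> R) (e : 'I_n -> M -> tvec) (w : M -> R).
Hypothesis L : local_data O c X e w.

Lemma ld_coords q : O q -> coords c q X.
Proof.
move=> Oq i; split; first exact: ld_X L i.
have : \forall z \near q, O z by apply: open_nbhs_nbhs; split; [exact: ld_open L|].
by apply: near_mono => z Oz; exact: (ld_XE L).
Qed.

Lemma ld_w_gt0 q : O q -> 0 < w q.
Proof.
move=> Oq; have := ld_wE L Oq; have [w0 h|//] := leP (w q) 0.
have : w q * `|\det (frame_mx X e q)| <= 0 by rewrite mulr_le0_ge0.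
by rewrite h ler10.
Qed.

(** Components of the coordinate vectors in the frame, that is, the inverse of [frame_mx]. *)
Definition frame_inv q (i a : 'I_n) := g q (dtan c q i) (e a q).

Lemma frame_invl q i j : O q -> \sum_a frame_inv q i a * e a q (X j) = (i == j)%:R.
Proof.
move=> Oq; have cq := ld_dom L Oq; rewrite -(dtan_coords i j cq (ld_coords Oq)).
have := ld_span L Oq (tangent_dtan i (ld_atlas L) cq) => /(congr1 (fun v : tvec => v (X j))).
by rewrite tvec_sumE => ->.
Qed.

Lemma frame_inv_mx q : O q -> (\matrix_(i, a) frame_inv q i a) *m frame_mx X e q = 1%:M.
Proof.
move=> Oq; apply/matrixP => i j; rewrite !mxE -(frame_invl i j Oq).
by apply: eq_bigr => a _; rewrite !mxE.
Qed.

Lemma frame_invr q a b : O q -> \sum_i e a q (X i) * frame_inv q i b = (a == b)%:R.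
Proof.
move=> Oq; have := mulmx1C (frame_inv_mx Oq) => /matrixP/(_ a b); rewrite !mxE => <-.
by apply: eq_bigr => i _; rewrite !mxE.
Qed.

Lemma frame_cofactor q a i : O q ->
  cofactor (frame_mx X e q) a i = \det (frame_mx X e q) * frame_inv q i a.
Proof.
move=> Oq; have := congr1 (mulmx (\matrix_(i, a) frame_inv q i a)) (mul_mx_adj (frame_mx X e q)).
rewrite mulmxA (frame_inv_mx Oq) mul1mx mul_mx_scalar => /matrixP/(_ i a).
by rewrite !mxE.
Qed.

Lemma frame_component q a z : O q -> tangent q z ->
  \sum_i frame_inv q i a * z (X i) = g q z (e a q).
Proof.
move=> Oq tz; have zE j : z (X j) = \sum_b g q z (e b q) * e b q (X j).
  by have := ld_span L Oq tz => /(congr1 (fun v : tvec => v (X j))); rewrite tvec_sumE.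
under eq_bigr => i _ do rewrite zE mulr_sumr.
rewrite exchange_big /= (bigD1 a) //= [X in _ + X]big1 ?addr0; last first.
  move=> b ba; rewrite (eq_bigr (fun i => g q z (e b q) * (e b q (X i) * frame_inv q i a))).
    by rewrite -mulr_sumr (frame_invr b a Oq) (negbTE ba) mulr0.
  by move=> i _; rewrite mulrC mulrA.
rewrite (eq_bigr (fun i => g q z (e a q) * (e a q (X i) * frame_inv q i a))).
  by rewrite -mulr_sumr (frame_invr a a Oq) eqxx mulr1.
by move=> i _; rewrite mulrC mulrA.
Qed.

(** Differentiation of w^2 det^2 = 1 on [O], where the squares dispose of the absolute value. The
    cofactors turn the derivative of det into a trace with the inverse frame matrix. *)
Lemma weight_derivative q (v : tvec) : O q -> tangent q v ->
  v w = - w q * \sum_a \sum_i v (fun x => e a x (X i)) * frame_inv q i a.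
Proof.
move=> Oq tv; pose d x := \det (frame_mx X e x).
have sE a i : smooth_fun (fun x => e a x (X i)) := vf_smooth (ld_e L a) (ld_X L i).
have sd : smooth_fun d := smooth_fun_det sE.
have sw := ld_w L; have sw2 := smooth_funM sw sw; have sd2 := smooth_funM sd sd.
have nO : \forall x \near q, O x by apply: open_nbhs_nbhs; split; [exact: ld_open L|].
have one x : O x -> w x * w x * (d x * d x) = 1.
  move=> Ox; rewrite mulrACA -expr2 -(real_normK (num_real (w x * d x))).
  by rewrite normrM (gtr0_norm (ld_w_gt0 Ox)) (ld_wE L Ox) expr1n.
have : v (fun x => w x * w x * (d x * d x)) = 0.
  rewrite -(tan_cst 1 tv); apply: (tan_ext tv (smooth_funM sw2 sd2) (@smooth_fun_cst R n M 1)).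
  by apply: near_mono nO => x; exact: one.
rewrite (tanM tv sw2 sd2) (tanM tv sw sw) (tanM tv sd sd).
have dq : d q != 0 by apply/negP => /eqP d0; have := one q Oq; rewrite d0 !mulr0 => /eqP; rewrite eq_sym oner_eq0.
have wq : w q != 0 by rewrite gt_eqF // ld_w_gt0.
have -> : v d = d q * \sum_a \sum_i v (fun x => e a x (X i)) * frame_inv q i a.
  rewrite (tan_det tv sE) mulr_sumr; apply: eq_bigr => a _.
  rewrite mulr_sumr; apply: eq_bigr => i _.
  by rewrite (frame_cofactor a i Oq) mulrCA.
set s := \sum_a _ => E0; have : (2 * w q * d q * d q) * (v w + w q * s) = 0.
  by rewrite -[RHS]E0; ring.
move=> /eqP; rewrite !mulf_eq0 (negbTE dq) (negbTE wq) pnatr_eq0 /= addr_eq0 => /eqP ->.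
by rewrite mulNr.
Qed.

(** By [weight_derivative] the left side is w times the sum of g([e_a, Y], e_a). The bracket is
    nabla_{e_a} Y - nabla_Y e_a, and its last term is orthogonal to e_a, which has constant
    length. *)
Lemma local_divergence nab (Y : M -> tvec) q : levi_civita g nab -> vector_field Y -> O q ->
  \sum_i dtan c q i (fun x => w x * Y x (X i)) = w q * \sum_a ip g (nab (e a) Y) (e a) q.
Proof.
move=> LC vY Oq; have cq := ld_dom L Oq; have cX := ld_coords Oq; have ac := ld_atlas L.
have tY := vf_tan q vY; have sw := ld_w L.
have sYX i : smooth_fun (fun x => Y x (X i)) := vf_smooth vY (ld_X L i).
have td i := tangent_dtan i ac cq.
have te a := vf_tan q (ld_e L a).
under eq_bigr => i _ do rewrite (tanM (td i) sw (sYX i)).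
rewrite big_split /= -mulr_sumr.
have -> : \sum_i dtan c q i w * Y q (X i) = Y q w.
  rewrite (tan_coord ac cq cX tY sw); apply: eq_bigr => i _.
  by rewrite mulrC dtanE.
rewrite (weight_derivative Oq tY) mulNr -mulrBr; congr (_ * _).
have -> : \sum_i dtan c q i (fun x => Y x (X i)) =
    \sum_a \sum_i e a q (fun x => Y x (X i)) * frame_inv q i a.
  rewrite exchange_big /=; apply: eq_bigr => i _.
  have := ld_span L Oq (td i) => /(congr1 (fun v : tvec => v (fun x => Y x (X i)))).
  by rewrite tvec_sumE => ->; apply: eq_bigr => a _; rewrite mulrC.
rewrite -sumrB; apply: eq_bigr => a _.
have va := ld_e L a.
have vb := lc_bracket_vf LC va vY.
have -> : \sum_i e a q (fun x => Y x (X i)) * frame_inv q i a -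
    \sum_i Y q (fun x => e a x (X i)) * frame_inv q i a =
    \sum_i frame_inv q i a * lie_bracket (e a) Y q (X i).
  rewrite -sumrB; apply: eq_bigr => i _; rewrite /lie_bracket /lie_derivative; ring.
rewrite (frame_component a Oq (vf_tan q vb)) -/(ip g (lie_bracket (e a) Y) (e a) q).
rewrite (lc_bracket LC va vY) (ipBl g q (lc_vf LC va vY) (lc_vf LC vY va) va).
have : Y q (ip g (e a) (e a)) = 0.
  rewrite -(tan_cst 1 tY); apply: (tan_ext tY (ip_smooth g va va) (@smooth_fun_cst R n M 1)).
  have nO : \forall x \near q, O x by apply: open_nbhs_nbhs; split; [exact: ld_open L|].
  by apply: near_mono nO => x Ox; rewrite /ip (ld_on L) // eqxx.
rewrite (lc_norm LC q vY va) => /eqP; rewrite mulf_eq0 pnatr_eq0 /= => /eqP ->.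
by rewrite subr0.
Qed.

(** rho div H + H(rho) is the divergence of rho H; multiplied by the density it is a sum of partial
    derivatives in the chart, null by [null_derive]. *)
Lemma null_local_divergence nab (H : M -> tvec) d rho K : levi_civita g nab -> vector_field H ->
  (forall q, O q -> d q = \sum_a ip g (nab (e a) H) (e a) q) ->
  smooth_fun rho -> compact K -> K `<=` O -> (forall q, ~ K q -> rho q = 0) ->
  null (chart_rep c (fun q => (rho q * d q + H q rho) * w q)).
Proof.
move=> LC vH dE sr cK KO r0; have ac := ld_atlas L; have sw := ld_w L.
have KD : K `<=` chart_dom c by move=> q /KO; exact: ld_dom L q.
pose Y := scale_field rho H; have vY : vector_field Y := vfZ sr vH.
pose F i q := w q * Y q (X i).
have sF i : smooth_fun (F i) := smooth_funM sw (vf_smooth vY (ld_X L i)).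
have F0 i q : ~ K q -> F i q = 0.
  by move=> Kq; rewrite /F /Y /scale_field r0 // scale0r; exact: mulr0.
have [cN tN _] := LC.
have nF i : null ('D_(bv i) (chart_rep c (F i))).
  have [s [b hb]] := chart_rep_smoothc ac (sF i) cK KD (F0 i).
  exact: null_derive s hb.
apply: (null_ext (F := fun x => \sum_i 'D_(bv i) (chart_rep c (F i)) x)); last exact: null_sum.
move=> x; have [[q Kq qx]|Kx] := pselect ((chart_map c @` K) x).
  have cq := KD _ Kq; have Oq := KO _ Kq; have ix : img c x by exists q.
  have iq : chart_inv c x = q by rewrite -qx chart_mapK.
  rewrite chart_repE // iq.
  have -> : \sum_i 'D_(bv i) (chart_rep c (F i)) x = \sum_i dtan c q i (F i).
    apply: eq_bigr => i _; rewrite (dtanE c q i (sF i)) qx; apply: near_eq_derive.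
    have : \forall y \near x, img c y by apply: open_nbhs_nbhs; split; [exact: img_open|].
    by apply: near_mono => y iy; rewrite chart_repE.
  rewrite (local_divergence LC vY Oq) mulrC; congr (_ * _).
  rewrite dE // mulr_sumr.
  have -> : H q rho = \sum_a e a q rho * ip g H (e a) q.
    have := ld_span L Oq (vf_tan q vH) => /(congr1 (fun v : tvec => v rho)).
    by rewrite tvec_sumE => ->; apply: eq_bigr => a _; rewrite mulrC.
  rewrite -big_split /=; apply: eq_bigr => a _; have va := ld_e L a.
  have [_ _ _ leib] := cN.
  rewrite /Y (leib rho (e a) H sr va vH).
  have s1 : vector_field (scale_field (lie_derivative (e a) rho) H) := vfZ (vf_smooth va sr) vH.
  have s2 : vector_field (scale_field rho (nab (e a) H)) := vfZ sr (conn_vf cN va vH).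
  rewrite (ipDl g q s1 s2 va) [RHS]addrC; congr (_ + _).
    exact: (gZl g (lie_derivative (e a) rho q) (vf_tan q vH) (vf_tan q va)).
  exact: (gZl g (rho q) (vf_tan q (conn_vf cN va vH)) (vf_tan q va)).
rewrite big1 => [|i _].
  apply/esym; apply: (chart_rep0 (K := K)) Kx => q Kq; rewrite (r0 q Kq) mul0r add0r.
  rewrite -[X in X * _](_ : 0 = _) ?mul0r // -(tan_cst 0 (vf_tan q vH)).
  apply/esym; apply: (tan_ext (vf_tan q vH) sr (@smooth_fun_cst R n M 0)).
  have oK : open (~` K) by rewrite openC; apply: compact_closed => //; exact: manifold_hausdorff.
  by apply: near_mono (open_nbhs_nbhs (conj oK Kq)) => z; exact: r0.
rewrite -[RHS](derive_cst 0 x (bv i)); apply: near_eq_derive.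
exact: (chart_rep_near0 cK KD (F0 i) Kx).
Qed.

End Data.
End LocalDivergence.

(** * From one chart to the whole manifold *)

Section DivergenceTheorem.
Context {R : realType} {n : nat} (M : smoothManifold R n.+1).
Local Notation tvec := ((M -> R) -> R^o).
Implicit Types (p q : M) (f h : M -> R) (c : @chart R n.+1 M) (O K : set M).
Implicit Types (X : 'I_n.+1 -> M -> R) (e : 'I_n.+1 -> M -> tvec) (w : M -> R).
Variable g : riemannianMetric M.

Lemma local_data_sub O c X e w O1 : local_data g O c X e w -> open O1 -> O1 `<=` O ->
  local_data g O1 c X e w.
Proof.
case=> ac oO Od sX XE ve on sp sw wE oO1 s; split => //.
- by move=> q /s /Od.
- by move=> i q /s; exact: XE.
- by move=> q a b /s; exact: on.
- by move=> q v /s; exact: sp.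
- by move=> q /s; exact: wE.
Qed.

Section Overlap.
Variables (O : set M) (c : @chart R n.+1 M) (X : 'I_n.+1 -> M -> R) (e : 'I_n.+1 -> M -> tvec).
Variables (O' : set M) (c' : @chart R n.+1 M) (X' : 'I_n.+1 -> M -> R) (e' : 'I_n.+1 -> M -> tvec).
Variables (w w' : M -> R).
Hypothesis L : local_data g O c X e w.
Hypothesis L' : local_data g O' c' X' e' w'.

Let phi (y : 'rV[R]_n.+1) := chart_map c' (chart_inv c y).

Lemma jac_transition q : O q -> O' q ->
  jac phi (chart_map c q) = \matrix_(i, j) dtan c q i (X' j).
Proof.
move=> Oq Oq'; have cq := ld_dom L Oq; have iq := img_in cq.
apply/matrixP => i j; rewrite !mxE (dtanE c q i (ld_X L' j)); apply: near_eq_derive.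
have nO : \forall z \near chart_inv c (chart_map c q), O' z.
  by rewrite chart_mapK //; apply: open_nbhs_nbhs; split; [exact: ld_open L'|].
by apply: near_mono (near_inv iq nO) => y Oy; rewrite /= (ld_XE L').
Qed.

(** The two orthonormal frames differ by an orthogonal matrix [Q], so E' = Q E J and |det E'| = |det
    E| |det J|. *)
Lemma density_change q : O q -> O' q ->
  jac phi (chart_map c q) \in unitmx /\ w' q * `|\det (jac phi (chart_map c q))| = w q.
Proof.
move=> Oq Oq'; have cq := ld_dom L Oq; have ac := ld_atlas L.
have te a := vf_tan q (ld_e L a); have te' a := vf_tan q (ld_e L' a).
set J := jac phi _; pose E := frame_mx X e q; pose E' := frame_mx X' e' q.
pose Q := \matrix_(b, a) g q (e' b q) (e a q).
have EJ : E' = Q *m (E *m J).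
  apply/matrixP => b j; rewrite mxE [LHS](congr1 (fun v : tvec => v (X' j)) (ld_span L Oq (te' b))).
  rewrite tvec_sumE mxE; apply: eq_bigr => a _; rewrite mxE; congr (_ * _).
  rewrite (tan_coord ac cq (ld_coords L Oq) (te a) (ld_X L' j)) mxE.
  by apply: eq_bigr => i _; rewrite /J (jac_transition Oq Oq') !mxE (dtanE c q i (ld_X L' j)).
have QQ : Q *m Q^T = 1%:M.
  apply/matrixP => b b'; rewrite !mxE -(ld_on L' b b' Oq') [in RHS](ld_span L Oq (te' b')).
  rewrite (g_sumr g _ _ _ te (te' b)); apply: eq_bigr => a _; rewrite !mxE; exact: mulrC.
have dQ : `|\det Q| = 1.
  have := congr1 determinant QQ; rewrite det_mulmx det_tr det1 -expr2 => d2.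
  apply/eqP; rewrite -(@eqrXn2 _ 2) // ?normr_ge0 // expr1n.
  by rewrite -normrX d2 normr1.
have wE := ld_wE L Oq; have wE' := ld_wE L' Oq'.
move: wE'; rewrite -/E' EJ !det_mulmx !normrM dQ mul1r => wE'.
split.
  rewrite unitmxE unitfE; apply/negP => /eqP d0; move: wE'; rewrite d0 normr0 !mulr0 => /eqP.
  by rewrite eq_sym oner_eq0.
have dE : `|\det E| != 0.
  by apply/negP => /eqP d0; move: wE; rewrite -/E d0 mulr0 => /eqP; rewrite eq_sym oner_eq0.
by apply: (mulIf dE); rewrite -[RHS]/(w q * `|\det (frame_mx X e q)|) wE -wE' mulrAC mulrA.
Qed.

(** [local_cov] handles functions supported near one point, and a partition of unity cuts [h] into
    such pieces. Pieces supported off [K] are 0. *)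
Lemma null_chart_change K h : compact K -> K `<=` O -> K `<=` O' -> smooth_fun h ->
  (forall q, ~ K q -> h q = 0) -> compact [set: M] ->
  null (fun x => chart_rep c (fun q => h q * w q) x - chart_rep c' (fun q => h q * w' q) x).
Proof.
move=> cK KO KO' sh h0 cM; have ac := ld_atlas L; have ac' := ld_atlas L'.
have sw := ld_w L; have sw' := ld_w L'.
pose good (chi : M -> R) := null (fun x => chart_rep c (fun q => chi q * (h q * w q)) x -
  chart_rep c' (fun q => chi q * (h q * w' q)) x).
have H p : exists Op, nbhs p Op /\ forall chi K1, smooth_fun chi -> compact K1 -> K1 `<=` Op ->
    (forall q, ~ K1 q -> chi q = 0) -> good chi.
  have [Kp|Kp] := pselect (K p); last first.
    exists (~` K); split.
      have oK : open (~` K) by rewrite openC; apply: compact_closed => //; exact: manifold_hausdorff.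
      exact: open_nbhs_nbhs.
    move=> chi K1 _ _ K1K chi0; apply: null_ext null0 => x.
    have z q (y : R) : chi q * (h q * y) = 0.
      have [/K1K/h0 ->|/chi0 ->] := pselect (K1 q); by rewrite ?mul0r ?mulr0.
    by rewrite /chart_rep !z !if_same subrr.
  have Op := KO _ Kp; have Op' := KO' _ Kp; have cp := ld_dom L Op; have cp' := ld_dom L' Op'.
  set a := chart_map c p; set U := chart_map c @` (chart_dom c `&` chart_dom c').
  have Ua : U a by exists p.
  have [uJ _] := density_change Op Op'.
  have [r [rho [r0 rho0 Br cov]]] := local_cov (@overlap_open R n.+1 M c c') Ua
    (fun j => @transition_smooth R n.+1 M c c' j ac ac') uJ.
  exists [set q | [/\ O q, O' q, nball a r (chart_map c q) & nball (chart_map c' p) rho (chart_map c' q)]].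
  split.
    have n1 : \forall q \near p, O q by apply: open_nbhs_nbhs; split; [exact: ld_open L|].
    have n2 : \forall q \near p, O' q by apply: open_nbhs_nbhs; split; [exact: ld_open L'|].
    have n3 : \forall q \near p, nball a r (chart_map c q).
      exact: (near_chart (P := nball a r) cp (nball_nbhs a r0)).
    have n4 : \forall q \near p, nball (chart_map c' p) rho (chart_map c' q).
      exact: (near_chart (P := nball (chart_map c' p) rho) cp' (nball_nbhs _ rho0)).
    by apply: filterS3 n1 n2 (filterI n3 n4) => q ? ? [? ?]; split.
  move=> chi K1 sc cK1 K1O chi0.
  pose F := chart_rep c' (fun q => chi q * (h q * w' q)).
  have z q (y : R) : ~ K1 q -> chi q * y = 0 by move=> /chi0 ->; rewrite mul0r.
  have s' : smooth_fun (fun q => chi q * (h q * w' q)) := smooth_funM sc (smooth_funM sh sw').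
  have K1d : K1 `<=` chart_dom c' by move=> q /K1O[_ Oq' _ _]; exact: ld_dom L' q Oq'.
  have sF : smoothc F := chart_rep_smoothc ac' s' cK1 K1d (fun q Kq => z q _ Kq).
  have pa : phi a = chart_map c' p by rewrite /phi /a chart_mapK.
  apply: (null_ext _ (cov F sF _)) => [x|y]; last first.
    rewrite -/(phi a) pa => ry; rewrite /F /chart_rep; case: asboolP => // /img_inv[_ iy].
    apply: z => /K1O[_ _ _]; rewrite /nball /= iy => /lt_le_trans/(_ ry).
    by rewrite ltxx.
  rewrite -/(phi x); congr (_ - _); case: asboolP => [/[dup] xb /Br[q [cq cq'] qx]|xb].
    have ix : img c x by exists q.
    have px : phi x = chart_map c' q by rewrite /phi -qx chart_mapK.
    have iq : chart_inv c x = q by rewrite -qx chart_mapK.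
    rewrite px /F chart_repE; last exact: img_in.
    rewrite chart_mapK // chart_repE // iq.
    have [/K1O[Oq Oq' _ _]|K1q] := pselect (K1 q); last by rewrite !(z _ _ K1q) mul0r.
    by have [_ <-] := density_change Oq Oq'; rewrite -/phi qx !mulrA.
  rewrite /chart_rep; case: asboolP => // /img_inv[_ ix]; rewrite z //.
  by move=> /K1O[_ _]; rewrite ix.
have [Op HOp] := choice H.
have [m [pt [rho [KK [sr r0 r1 HK]]]]] := partition_of_unity cM (fun p => proj1 (HOp p)).
have nk k : good (rho k).
  by have [cKk KkO rk0] := HK k; exact: (proj2 (HOp (pt k)) (rho k) (KK k) (sr k) cKk KkO rk0).
apply: (null_ext (F := fun x => \sum_k (chart_rep c (fun q => rho k q * (h q * w q)) x -
  chart_rep c' (fun q => rho k q * (h q * w' q)) x))); last exact: null_sum.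
move=> x; rewrite sumrB -!chart_rep_sum; congr (_ - _).
  by congr (chart_rep c _ x); apply/funext => q; rewrite -mulr_suml r1 mul1r.
by congr (chart_rep c' _ x); apply/funext => q; rewrite -mulr_suml r1 mul1r.
Qed.

End Overlap.

(** The pieces rho_i d + H(rho_i) are null, each in its own chart, and add up to [d] because the
    rho_i sum to 1 and H(1) = 0. Brought to common charts they show that the nonnegative function
    [G] is null, although it is positive somewhere. *)
Theorem no_positive_divergence nab (H : M -> tvec) (d : M -> R) : levi_civita g nab ->
  [set: M] !=set0 -> compact [set: M] -> vector_field H -> smooth_fun d -> (forall q, 0 < d q) ->
  (forall p, exists2 e : 'I_n.+1 -> M -> tvec, forall a, vector_field (e a) &
    \forall q \near p, [/\ forall a b, g q (e a q) (e b q) = (a == b)%:R,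
      forall v, tangent q v -> v = \sum_a g q v (e a q) *: e a q &
      d q = \sum_a ip g (nab (e a) H) (e a) q]) -> False.
Proof.
move=> LC [p0 _] cM vH sd d0 He.
pose P p (t : set M * @chart R n.+1 M * ('I_n.+1 -> M -> R) * ('I_n.+1 -> M -> tvec) * (M -> R)) :=
  let: (A, c, X, e, w) := t in [/\ A p, local_data g A c X e w &
    forall q, A q -> d q = \sum_a ip g (nab (e a) H) (e a) q].
have HP p : exists t, P p t.
  have [e ve ne] := He p.
  have [|O [c [X [w [Op L]]]]] := @local_data_exists R n.+1 M g p e ve.
    by apply: near_mono ne => q [].
  pose A := O `&` [set q | d q = \sum_a ip g (nab (e a) H) (e a) q]^°.
  exists (A, c, X, e, w); split.
  - split => //; apply: (near_mono _ ne) => q [_ _ dq]; exact: dq.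
  - apply: (local_data_sub L) => [|q []//]; apply: openI; first exact: ld_open L.
    exact: open_interior.
  - by move=> q [_ /nbhs_singleton].
have [t Ht] := choice HP.
pose O p := (t p).1.1.1.1; pose c p := (t p).1.1.1.2; pose X p := (t p).1.1.2.
pose e p := (t p).1.2; pose w p := (t p).2.
have {}Ht p : [/\ O p p, local_data g (O p) (c p) (X p) (e p) (w p) &
    forall q, O p q -> d q = \sum_a ip g (nab (e p a) H) (e p a) q].
  by have := Ht p; rewrite /P /O /c /X /e /w; case: (t p) => [[[[? ?] ?] ?] ?].
have LL p : local_data g (O p) (c p) (X p) (e p) (w p) by have [] := Ht p.
have nO p : nbhs p (O p).
  by apply: open_nbhs_nbhs; split; [exact: ld_open (LL p)|have [] := Ht p].
have [m [pt [rho [K [sr r0 r1 HK]]]]] := partition_of_unity cM nO.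
pose D i q := rho i q * d q + H q (rho i).
have sD i : smooth_fun (D i) := smooth_funD (smooth_funM (sr i) sd) (vf_smooth vH (sr i)).
have oK i : closed (K i).
  by have [cK _ _] := HK i; apply: compact_closed cK; exact: manifold_hausdorff.
have D0 i q : ~ K i q -> D i q = 0.
  move=> Kq; have [_ _ k0] := HK i; rewrite /D (k0 q Kq) mul0r add0r.
  rewrite -(tan_cst 0 (vf_tan q vH)); apply: (tan_ext (vf_tan q vH) (sr i) (@smooth_fun_cst R n.+1 M 0)).
  have oC : open (~` (K i)) by rewrite openC.
  by apply: near_mono (open_nbhs_nbhs (conj oC Kq)) => z; exact: k0.
have N1 i : null (chart_rep (c (pt i)) (fun q => D i q * w (pt i) q)).
  have [cK KO k0] := HK i; have [_ _ dE] := Ht (pt i).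
  exact: (null_local_divergence (LL (pt i)) LC vH dE (sr i) cK KO k0).
(* The piece [D i] is cut again by [rho k] and read in the chart of k instead of that of i. In a
   fixed chart, the sum over i then restores [d]. *)
have N2 i k : null (fun x => chart_rep (c (pt k)) (fun q => rho k q * D i q * w (pt k) q) x -
    chart_rep (c (pt i)) (fun q => rho k q * D i q * w (pt i) q) x).
  have [cKi KOi ki0] := HK i; have [cKk KOk kk0] := HK k.
  have cI : compact (K k `&` K i) by apply: compact_closedI.
  apply: (null_chart_change (LL (pt k)) (LL (pt i)) cI _ _ (smooth_funM (sr k) (sD i)) _ cM).
  - by move=> q [/KOk].
  - by move=> q [_ /KOi].
  - move=> q Kq; have [Kk|/kk0 ->] := pselect (K k q); last by rewrite mul0r.
    by rewrite D0 ?mulr0 // => Ki; apply: Kq.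
have N3 i : null (fun x => \sum_k chart_rep (c (pt k)) (fun q => rho k q * D i q * w (pt k) q) x).
  apply: null_ext (nullD (null_sum (index_enum _) (N2 i)) (N1 i)) => x; rewrite sumrB -chart_rep_sum.
  rewrite [X in _ - X + _](_ : _ = chart_rep (c (pt i)) (fun q => D i q * w (pt i) q) x) ?subrK //.
  by congr (chart_rep _ _ x); apply/funext => q; rewrite -!mulr_suml r1 mul1r.
pose G x := \sum_k chart_rep (c (pt k)) (fun q => rho k q * d q * w (pt k) q) x.
have nG : null G.
  apply: null_ext (null_sum (index_enum _) N3) => x; rewrite exchange_big /=; apply: eq_bigr => k _.
  rewrite -chart_rep_sum; congr (chart_rep _ _ x); apply/funext => q.
  rewrite -mulr_suml -mulr_sumr; congr (_ * _ * _); rewrite /D big_split /= -mulr_suml r1 mul1r.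
  rewrite -(tan_sum _ (vf_tan q vH) sr) (_ : (fun z => _) = (fun=> 1)) ?(tan_cst _ (vf_tan q vH)) ?addr0 //.
  by apply/funext => z; exact: r1.
have sG : smooth_on setT G.
  apply: smooth_sum; first exact: openT.
  move=> k _; have [cK KO k0] := HK k.
  have KD : K k `<=` chart_dom (c (pt k)) by move=> q /KO; exact: ld_dom (LL (pt k)) q.
  have s1 : smooth_fun (fun q => rho k q * d q * w (pt k) q) := smooth_funM (smooth_funM (sr k) sd) (ld_w (LL (pt k))).
  have [|sc _] := chart_rep_smoothc (ld_atlas (LL (pt k))) s1 cK KD; last exact: sc.
  by move=> q /k0 ->; rewrite !mul0r.
have pos k q : 0 <= rho k q * d q * w (pt k) q.
  have [_ KO k0] := HK k; have [/KO Oq|/k0 ->] := pselect (K k q); last by rewrite !mul0r.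
  by rewrite !mulr_ge0 ?r0 // ?(ltW (d0 q)) // ltW // (ld_w_gt0 (LL (pt k)) Oq).
have posr k x : 0 <= chart_rep (c (pt k)) (fun q => rho k q * d q * w (pt k) q) x.
  by rewrite /chart_rep; case: asboolP.
have G0 x : 0 <= G x by apply: sumr_ge0 => k _.
have cG : continuous G by move=> x; exact: (smooth_cont sG I).
have [k rk] : exists k, 0 < rho k p0.
  apply/not_existsP => nk; have := r1 p0; rewrite big1 => [/eqP|k _]; first by rewrite eq_sym oner_eq0.
  by apply/eqP; rewrite eq_le r0 andbT leNgt; apply/negP; exact: nk.
have [_ KO k0] := HK k.
have Kp : K k p0 by apply/not_notP => /k0 z; move: rk; rewrite z ltxx.
have Op := KO _ Kp; have cp := ld_dom (LL (pt k)) Op.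
have := null_nonneg (chart_map (c (pt k)) p0) cG G0 nG.
rewrite /G (bigD1 k) //= chart_repE; last exact: img_in.
rewrite chart_mapK // => /eqP; rewrite paddr_eq0 //; last by apply: sumr_ge0 => j _.
by rewrite gt_eqF // !mulr_gt0 // (ld_w_gt0 (LL (pt k)) Op).
Qed.

End DivergenceTheorem.

(** * Proof of the theorem *)

Section Conclusion.
Context {R : realType} {n : nat} (M : smoothManifold R n).
Local Notation tvec := ((M -> R) -> R^o).
Implicit Types (p q : M) (X Y Z x y : M -> tvec).
Variable g : riemannianMetric M.
Variables nab D : (M -> tvec) -> (M -> tvec) -> (M -> tvec).
Variables (theta : M -> tvec -> R) (kappa : R).

Local Notation "<< X , Y >>" := (ip g X Y).
Local Notation product T1 T2 r1 r2 H1 H2 := (conformal_product g nab D T1 T2 theta r1 r2 H1 H2 kappa).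

(** The vector |Y|^2 X - g(X, Y) Y has square norm |Y|^2 times the Gram determinant. *)
Lemma gram_neq0 X Y p : vector_field X -> vector_field Y ->
  (forall a b : R, a *: X p + b *: Y p = 0 -> a = 0 /\ b = 0) ->
  <<X, X>> p * <<Y, Y>> p - <<X, Y>> p ^+ 2 != 0.
Proof.
move=> vX vY ind; have tX := vf_tan p vX; have tY := vf_tan p vY.
have Y0 : Y p <> 0.
  move=> Y0; have [|_ /eqP] := ind 0 1; last by rewrite oner_eq0.
  by rewrite Y0 scaler0 scale0r addr0.
have YY := ip_gt0 g vY Y0; apply/negP => /eqP d0.
pose a := <<Y, Y>> p; pose b := - <<X, Y>> p.
have aX := tangentZ a tX; have bY := tangentZ b tY; have tZ := tangentD aX bY.
have [|a0 _] := ind a b; last by move: YY; rewrite -/a a0 ltxx.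
apply: (g_eq0 (g := g) tZ).
rewrite (gDl g aX bY tZ) (gDr g aX bY aX) (gDr g aX bY bY).
rewrite (gZl g a tX aX) (gZl g a tX bY) (gZl g b tY aX) (gZl g b tY bY).
rewrite (gZr g a tX tX) (gZr g b tY tX) (gZr g a tX tY) (gZr g b tY tY) (gC g tY tX).
rewrite -/(ip g X Y p) -/(ip g X X p) -/(ip g Y Y p).
transitivity (a * (<<X, X>> p * <<Y, Y>> p - <<X, Y>> p ^+ 2)); last by rewrite d0 mulr0.
rewrite /a /b; ring.
Qed.

Lemma conformal_product_exists T1 T2 : levi_civita g nab ->
  (forall X Y p, vector_field X -> vector_field Y ->
      (forall a b : R, a *: X p + b *: Y p = 0 -> a = 0 /\ b = 0) ->
      g p (curvature nab X Y Y p) (X p) /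
        (g p (X p) (X p) * g p (Y p) (Y p) - g p (X p) (Y p) ^+ 2) = kappa) ->
  conformal_product_structure g D T1 T2 -> lee_form g D theta ->
  exists r1 r2 H1 H2, product T1 T2 r1 r2 H1 H2.
Proof.
move=> LC K [W [r1 r10 d1] [r2 r20 d2] dec [ort p1 p2]] L; have [th _] := L.
have [H1 s1 e1] := dual_field g r10 d1 th; have [H2 s2 e2] := dual_field g r20 d2 th.
exists r1, r2, H1, H2; split => //.
- move=> X Y p vX vY ind; rewrite -(K X Y p vX vY ind) -/(ip g X X p) -/(ip g Y Y p) -/(ip g X Y p).
  by rewrite mulfVK // gram_neq0.
- by move=> p; have [H _] := dec p; exact: H.
Qed.

Section Frame.
Variables (T1 T2 : M -> set tvec) (r1 r2 : nat) (H1 H2 : M -> tvec).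
Hypothesis C : product T1 T2 r1 r2 H1 H2.
Variables (p : M) (e1 : 'I_r1 -> M -> tvec) (e2 : 'I_r2 -> M -> tvec).
Hypothesis F1 : on_frame g T1 p e1.
Hypothesis F2 : on_frame g T2 p e2.

Definition joint_frame (i : 'I_(r1 + r2)) : M -> tvec :=
  match fintype.split i with inl a => e1 a | inr b => e2 b end.

Lemma joint_frame_l a : joint_frame (lshift r2 a) = e1 a.
Proof. by rewrite /joint_frame; case: splitP => j /= e; [congr e1; apply: val_inj|have := ltn_ord a; rewrite e ltnNge leq_addr]. Qed.

Lemma joint_frame_r b : joint_frame (rshift r1 b) = e2 b.
Proof.
rewrite /joint_frame; case: splitP => j /= e; first by have := ltn_ord j; rewrite -e ltnNge leq_addr.
by congr e2; apply: val_inj; apply: (@addnI r1).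
Qed.

Lemma joint_frame_vf i : vector_field (joint_frame i).
Proof.
by rewrite /joint_frame; case: (fintype.split i) => a; [have [/(_ a)[]] := F1|have [/(_ a)[]] := F2].
Qed.

Lemma joint_frame_on : \forall q \near p,
  (forall i j, g q (joint_frame i q) (joint_frame j q) = (i == j)%:R) /\
  forall v, tangent q v -> v = \sum_i g q v (joint_frame i q) *: joint_frame i q.
Proof.
have [S1 N1] := F1; have [S2 N2] := F2.
apply: filterS2 N1 N2 => q [h1 t1] [h2 t2].
have T1q a : T1 q (e1 a q) by have [_] := S1 a; exact.
have T2q b : T2 q (e2 b q) by have [_] := S2 b; exact.
have te1 a := cp_tan1 C (T1q a); have te2 b := cp_tan2 C (T2q b).
split=> [i j|v tv].
  rewrite -(fintype.splitK i) -(fintype.splitK j); case: (fintype.split i) => a; case: (fintype.split j) => b; rewrite /=.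
  - by rewrite !joint_frame_l h1 (inj_eq (@lshift_inj _ _)).
  - by rewrite joint_frame_l joint_frame_r (cp_orth C) // eq_lrshift.
  - by rewrite joint_frame_l joint_frame_r (gC g) // (cp_orth C) // eq_rlshift.
  - by rewrite !joint_frame_r h2 (inj_eq (@rshift_inj _ _)).
have [v1 [v2 [Tv1 Tv2 ve]]] := cp_dec C tv.
have tv1 := cp_tan1 C Tv1; have tv2 := cp_tan2 C Tv2.
rewrite big_split_ord /= {1}ve; congr (_ + _).
  rewrite {1}(proj1 (t1 v1) Tv1); apply: eq_bigr => a _; rewrite joint_frame_l; congr (_ *: _).
  by rewrite ve (gDl g tv1 tv2 (te1 a)) (gC g tv2 (te1 a)) (cp_orth C (T1q a) Tv2) addr0.
rewrite {1}(proj1 (t2 v2) Tv2); apply: eq_bigr => b _; rewrite joint_frame_r; congr (_ *: _).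
by rewrite ve (gDl g tv1 tv2 (te2 b)) (cp_orth C Tv1 (T2q b)) add0r.
Qed.

Lemma joint_frame_card : (r1 + r2)%N = n.
Proof.
have [hon sp] := nbhs_singleton joint_frame_on; have tj i := vf_tan p (joint_frame_vf i).
apply: (frame_card (v := fun i => joint_frame i p) tj) => [a a0 i|w tw]; last first.
  by exists (fun i => g p w (joint_frame i p)); exact: sp.
have := congr1 (fun v : tvec => g p v (joint_frame i p)) a0.
rewrite (g0l g (tj i)) (g_suml g _ _ _ tj (tj i)) (bigD1 i) //= hon eqxx mulr1 big1 ?addr0 //.
by move=> j ji; rewrite hon (negbTE ji) mulr0.
Qed.

(* The trace of sectional_mixed over the mixed planes of the frame. *)
Lemma joint_frame_trace : \forall q \near p,
  r2%:R * \sum_i <<nab (joint_frame i) H1, joint_frame i>> q +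
  r1%:R * \sum_i <<nab (joint_frame i) H2, joint_frame i>> q =
  kappa * r1%:R * r2%:R - r2%:R * (r2%:R - 1) * <<H1, H1>> q - r1%:R * (r1%:R - 1) * <<H2, H2>> q.
Proof.
have [S1 N1] := F1; have [S2 N2] := F2.
apply: filterS2 N1 N2 => q [h1 t1] [h2 t2].
have s1 := cp_sec1 C; have s2 := cp_sec2 C; have C' := cp_swap C.
have n1 a : <<e1 a, e1 a>> q = 1 by rewrite /ip h1 eqxx.
have n2 b : <<e2 b, e2 b>> q = 1 by rewrite /ip h2 eqxx.
have z1 a : e1 a q <> 0.
  move=> z; have := n1 a; rewrite /ip z (g0l g (@tangent0 R n M q)) => /eqP.
  by rewrite eq_sym oner_eq0.
have z2 b : e2 b q <> 0.
  move=> z; have := n2 b; rewrite /ip z (g0l g (@tangent0 R n M q)) => /eqP.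
  by rewrite eq_sym oner_eq0.
rewrite !big_split_ord /=.
under eq_bigr => a _ do rewrite joint_frame_l.
under [X in _ + _ * (X + _)]eq_bigr => a _ do rewrite joint_frame_l.
under [X in _ * (_ + X) + _]eq_bigr => b _ do rewrite joint_frame_r.
under [X in _ + _ * (_ + X)]eq_bigr => b _ do rewrite joint_frame_r.
(* Each of the r2 frame vectors in T2 contributes -|H1|^2 to the divergence of H1; the squares of
   theta on the T1 part give back one |H1|^2, whence the factor r2 - 1. *)
have m1 b : <<nab (e2 b) H1, e2 b>> q = - <<H1, H1>> q.
  rewrite (nab_mixed C q (proj1 (S2 b)) s1 (S2 b)) (cp_ip0C C q s1 (S2 b)) n2; ring.
have m2 a : <<nab (e1 a) H2, e1 a>> q = - <<H2, H2>> q.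
  rewrite (nab_mixed C' q (proj1 (S1 a)) s2 (S1 a)) (cp_ip0C C' q s2 (S1 a)) n1; ring.
rewrite (eq_bigr _ (fun b _ => m1 b)) (eq_bigr _ (fun a _ => m2 a)) !sumr_const !card_ord.
have q1 : \sum_a <<H1, e1 a>> q ^+ 2 = <<H1, H1>> q.
  have te1 a := vf_tan q (proj1 (S1 a)); have tH := vf_tan q (cp_vf1 C).
  have := proj1 (t1 (H1 q)) (proj2 s1 q) => /(congr1 (g q (H1 q))).
  rewrite (g_sumr g _ _ _ te1 tH) -/(ip g H1 H1 q) => ->.
  by apply: eq_bigr => a _; rewrite expr2.
have q2 : \sum_b <<H2, e2 b>> q ^+ 2 = <<H2, H2>> q.
  have te2 b := vf_tan q (proj1 (S2 b)); have tH := vf_tan q (cp_vf2 C).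
  have := proj1 (t2 (H2 q)) (proj2 s2 q) => /(congr1 (g q (H2 q))).
  rewrite (g_sumr g _ _ _ te2 tH) -/(ip g H2 H2 q) => ->.
  by apply: eq_bigr => b _; rewrite expr2.
have sec a b : (<<nab (e1 a) H1, e1 a>> q - <<H1, e1 a>> q ^+ 2) +
    (<<nab (e2 b) H2, e2 b>> q - <<H2, e2 b>> q ^+ 2) = kappa.
  by have := sectional_mixed C (S1 a) (S2 b) (z1 a) (z2 b); rewrite n1 n2 !mul1r !mulr1.
have : \sum_(a < r1) \sum_(b < r2) kappa = kappa * r1%:R * r2%:R.
  by rewrite !sumr_const !card_ord -[kappa *+ _]mulr_natr -[_ *+ r1 in LHS]mulr_natr mulrAC.
rewrite (eq_bigr (fun a => r2%:R * (<<nab (e1 a) H1, e1 a>> q - <<H1, e1 a>> q ^+ 2) +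
    (\sum_b <<nab (e2 b) H2, e2 b>> q - <<H2, H2>> q))); last first.
  move=> a _; rewrite -(eq_bigr _ (fun b _ => sec a b)) big_split /= sumr_const card_ord.
  by rewrite sumrB q2 -[_ *+ r2]mulr_natl.
rewrite big_split /= -mulr_sumr sumrB q1 sumr_const card_ord => <-.
rewrite -[(- _) *+ r2]mulr_natl -[(- _) *+ r1]mulr_natl -[(_ - _) *+ r1]mulr_natl; ring.
Qed.

End Frame.
End Conclusion.

Section Contradiction.
Context {R : realType} {n : nat} (M : smoothManifold R n.+1).
Local Notation tvec := ((M -> R) -> R^o).
Variable g : riemannianMetric M.

Lemma conformal_product_rank nab D theta kappa T1 T2 r1 r2 H1 H2 (p : M) :
  conformal_product g nab D T1 T2 theta r1 r2 H1 H2 kappa -> (r1 + r2)%N = n.+1.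
Proof.
move=> C; have [e1 F1] := on_frame_exists g p (cp_rank1 C) (cp_dist1 C).
have [e2 F2] := on_frame_exists g p (cp_rank2 C) (cp_dist2 C).
exact: (joint_frame_card C F1 F2).
Qed.

(** The field r2 H1 + r1 H2 is rescaled by [s], so that [no_positive_divergence] covers both signs
    of the trace. *)
Lemma conformal_product_divergence nab D theta kappa T1 T2 r1 r2 H1 H2 (s : R) :
  conformal_product g nab D T1 T2 theta r1 r2 H1 H2 kappa ->
  [set: M] !=set0 -> compact [set: M] ->
  (forall q, 0 < s * (kappa * r1%:R * r2%:R - r2%:R * (r2%:R - 1) * ip g H1 H1 q -
    r1%:R * (r1%:R - 1) * ip g H2 H2 q)) -> False.
Proof.
move=> C n0 cM d0.
pose d q := s * (kappa * r1%:R * r2%:R - r2%:R * (r2%:R - 1) * ip g H1 H1 q -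
    r1%:R * (r1%:R - 1) * ip g H2 H2 q).
have v1 := cp_vf1 C; have v2 := cp_vf2 C; have LC := cp_lc C; have [cN _ _] := LC.
have sc k := @smooth_fun_cst R n.+1 M k.
pose k1 := s * r2%:R; pose k2 := s * r1%:R.
pose H := scale_field (fun=> k1) H1 + scale_field (fun=> k2) H2.
have w1 : vector_field (scale_field (fun=> k1) H1) := vfZ (sc k1) v1.
have w2 : vector_field (scale_field (fun=> k2) H2) := vfZ (sc k2) v2.
have sd : smooth_fun d.
  apply: smooth_funM (sc s) _; apply: smooth_funB; first apply: smooth_funB; first exact: sc.
    exact: (smooth_funM (sc _) (ip_smooth g v1 v1)).
  exact: (smooth_funM (sc _) (ip_smooth g v2 v2)).
apply: (no_positive_divergence (g := g) (H := H) (d := d) LC n0 cM (vfD w1 w2) sd d0) => p.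
have [e1 F1] := on_frame_exists g p (cp_rank1 C) (cp_dist1 C).
have [e2 F2] := on_frame_exists g p (cp_rank2 C) (cp_dist2 C).
have rn := joint_frame_card C F1 F2.
pose f := joint_frame e1 e2; have vf i : vector_field (f i) := joint_frame_vf F1 F2 i.
exists (fun a => f (cast_ord (esym rn) a)); first by move=> a; exact: vf.
apply: filterS2 (joint_frame_on C F1 F2) (joint_frame_trace C F1 F2) => q [hon sp] tr.
have re (V : zmodType) (G : 'I_(r1 + r2) -> V) : \sum_a G (cast_ord (esym rn) a) = \sum_i G i.
  rewrite [RHS](reindex (cast_ord (esym rn))) //.
  by exists (cast_ord rn) => i _; [rewrite cast_ordKV|rewrite cast_ordK].
split=> [a b|v tv|].
- by rewrite hon (inj_eq (@cast_ord_inj _ _ _)).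
- by rewrite [RHS](re _ (fun i => g q v (f i q) *: f i q)); exact: sp.
- rewrite [RHS](re _ (fun i => ip g (nab (f i) H) (f i) q)) /d -tr.
  rewrite mulrDr !mulrA !mulr_sumr -big_split /=; apply: eq_bigr => i _.
  rewrite /H (connDr cN (vf i) w1 w2); have [_ _ _ leib] := cN.
  have lc k Z : vector_field Z -> ip g (nab (f i) (scale_field (fun=> k) Z)) (f i) q =
      k * ip g (nab (f i) Z) (f i) q.
    move=> vZ; have z : lie_derivative (f i) (fun=> k) q = 0 := tan_cst k (vf_tan q (vf i)).
    rewrite /ip (leib _ _ _ (sc k) (vf i) vZ).
    rewrite -[(scale_field _ Z + _) q]/(lie_derivative (f i) (fun=> k) q *: Z q + k *: nab (f i) Z q).
    rewrite z scale0r add0r.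
    exact: (gZl g k (vf_tan q (conn_vf cN (vf i) vZ)) (vf_tan q (vf i))).
  rewrite (ipDl g q (conn_vf cN (vf i) w1) (conn_vf cN (vf i) w2) (vf i)).
  by rewrite (lc k1 H1 v1) (lc k2 H2 v2).
Qed.

End Contradiction.

Theorem theorem1p1 (R : realType) (n : nat) (M : smoothManifold R n)
    (g : riemannianMetric M) (kappa : R) :
  (2 <= n)%N ->
  [set: M] !=set0 ->
  compact [set: M] ->
  constant_sectional_curvature g kappa ->
  (kappa <> 0 ->
     ~ exists D T1 T2, conformal_product_structure g D T1 T2) /\
  (kappa = 0 -> (3 <= n)%N ->
     forall D T1 T2, conformal_product_structure g D T1 T2 ->
       (forall theta, lee_form g D theta ->
          forall p v, tangent p v -> theta p v = 0) /\
       levi_civita g D).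
Proof.
case: n M g => [M g n2|n M g n2 M0 cM [nab LC K]]; first by [].
(* Since n >= 3, one of the ranks is at least 2, and [cp_swap] makes [cp_zero] available for
   either. *)
have zero D T1 T2 theta r1 r2 H1 H2 p : (3 <= n.+1)%N -> 0 <= kappa ->
    conformal_product g nab D T1 T2 theta r1 r2 H1 H2 kappa -> [/\ H1 p = 0, H2 p = 0 & kappa = 0].
  move=> n3 k0 C; have rn := conformal_product_rank p C.
  have [r2p|r2p] := ltnP 1 r2; first exact: (cp_zero p C cM r2p k0).
  have r1p : (1 < r1)%N by rewrite -(leq_add2r 1) (leq_trans n3) // -rn leq_add2l.
  by have [? ? ?] := cp_zero p (cp_swap C) cM r1p k0; split.
split=> [k0 [D [T1 [T2 S]]]|k0 n3 D T1 T2 S]; have [W _ _ _ _] := S; have [cD tD [th0 L0]] := W.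
  have [r1 [r2 [H1 [H2 C]]]] := conformal_product_exists LC K S L0.
  have [p _] := M0; have r10 := cp_rank1 C; have r20 := cp_rank2 C.
  have rr : 0 < r1%:R * r2%:R :> R by rewrite mulr_gt0 // ltr0n.
  have [kn|kp|//] := ltgtP kappa 0; last first.
    have [n3|n1] := ltnP 2 n.+1; first by have [_ _] := zero _ _ _ _ _ _ _ _ p n3 (ltW kp) C.
    have rn := conformal_product_rank p C.
    (* Both ranks being 1, the quadratic terms of the trace disappear and it equals kappa > 0. *)
    have e1 : r1 = 1%N by lia.
    have e2 : r2 = 1%N by lia.
    apply: (conformal_product_divergence (s := 1) C M0 cM) => q.
    by rewrite e1 e2 !subrr !mulr0 !mul0r !subr0 !mulr1 mul1r.
  (* For kappa < 0 no term of the trace is positive and the first one is negative. *)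
  apply: (conformal_product_divergence (s := -1) C M0 cM) => q.
  have f1 := g_ge0 g (vf_tan q (cp_vf1 C)); have f2 := g_ge0 g (vf_tan q (cp_vf2 C)).
  have c1 : 0 <= r1%:R * (r1%:R - 1) * ip g H2 H2 q.
    by rewrite !mulr_ge0 // subr_ge0 ler1n.
  have c2 : 0 <= r2%:R * (r2%:R - 1) * ip g H1 H1 q.
    by rewrite !mulr_ge0 // subr_ge0 ler1n.
  have c3 : kappa * (r1%:R * r2%:R) < 0 by rewrite nmulr_rlt0.
  by rewrite mulrA in c3; lra.
have th_0 theta : lee_form g D theta -> forall p v, tangent p v -> theta p v = 0.
  move=> L p v tv; have [r1 [r2 [H1 [H2 C]]]] := conformal_product_exists LC K S L.
  have kz : 0 <= kappa by rewrite k0.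
  have [h1 h2 _] := zero _ _ _ _ _ _ _ _ p n3 kz C.
  have [v1 [v2 [t1 t2 ->]]] := cp_dec C tv.
  have tv1 := cp_tan1 C t1; have tv2 := cp_tan2 C t2.
  have [[thl _] _] := L; have := thl p 1 v1 v2 tv1 tv2; rewrite scale1r mul1r => ->.
  by rewrite -(cp_dual1 C t1) -(cp_dual2 C t2) h1 h2 (g0l g tv1) (g0l g tv2) addr0.
split; first exact: th_0.
(* A vanishing Lee form means D g = 0, so the torsion-free connection [D] is itself Levi-Civita. *)
split; [exact: cD|exact: tD|move=> X Y Z vX vY vZ p]; have [_ HL] := L0.
by rewrite (HL X Y Z vX vY vZ p) (th_0 th0 L0 p _ (vf_tan p vX)) mulr0 mul0r.
Qed.
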